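(* For each fixed $T>0$, $$\mathcal{R}^r=\{f\in hol(D^r_\infty):\ f(z+2)=f(z)=-f(-z)\ \text{ for all } z\in D^r_\infty,\ f|_{-1+D}\in\mathcal{H}^r_T(-1+D)\},$$ where $\mathcal{H}^r_T(-1+D)$ is the reproducing kernel Hilbert space of analytic functions on $-1+D$ with reproducing kernel $$\mathcal{K}_r(z,w;T)=\sum_{m,n\in\mathbb{Z}}\mathcal{K}_0(z+2n+1,w+2m+1;T),\qquad z,w\in-1+D.$$ The space $\mathcal{H}^r_T(-1+D)$ is endowed with the norm $$\|f\|_{\mathcal{H}^r_T(-1+D)}=\inf\{\|u\|_{L^2_{\mathbb{C}}(0,T)}:\ f=2\mathcal{L}^r_Tu,\ u\in L^2_{\mathbb{C}}(0,T)\}.$$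
   Context: Identify $\mathbb{R}^2$ with $\mathbb{C}$. Let $D=\{x+iy: |y|<x,\ |y|<2-x\}$, $D^\ell_\infty=\bigcup_{n\in\mathbb{Z}}(2n+D)$ and $D^r_\infty=-1+D^\ell_\infty$. For an open set $\Omega\subset\mathbb{C}$, $hol(\Omega)$ is the set of analytic functions on $\Omega$. $L^2_{\mathbb{C}}(0,T)$ is the space of complex-valued square integrable functions on $(0,T)$. Kernel: $$\mathcal{K}_0(z,w;T)=\frac{z\overline{w}}{\pi}e^{-\frac{z^2+\overline{w}^2}{4T}}\left(\frac{1}{(z^2+\overline{w}^2)^2}+\frac{1}{4T(z^2+\overline{w}^2)}\right)$$ whenever $z^2+\overline{w}^2\neq 0$. Heat kernel: $K(x,t)=\frac{1}{\sqrt{4\pi t}}e^{-x^2/(4t)}$ for $t>0$; $\theta(x,t)=\sum_{n\in\mathbb{Z}}K(x+2n,t)$; for $z\in\mathbb{C}$, $(\partial_xK)(z,t)=-\frac{z}{4\sqrt{\pi}\,t^{3/2}}e^{-z^2/(4t)}$, and $(\partial_x\theta)(z,t)=\sum_{n\in\mathbb{Z}}(\partial_xK)(z+2n,t)$. Control system: $\partial_tw-\partial_{xx}w=0$ for $0<x<1$, $0<t<T$; $w(0,t)=u_\ell(t)$, $w(1,t)=u_r(t)$ for $0<t<T$; $w(x,0)=0$ for $0<x<1$. For $u_\ell,u_r\in L^2_{\mathbb{C}}(0,T)$ its solution is the unique $w\in C([0,T],W^{-1,2}(0,1))$ given by $$w(x,t)=-2\int_0^t(\partial_x\theta)(x,t-\tau)u_\ell(\tau)\,d\tau+2\int_0^t(\partial_x\theta)(x-1,t-\tau)u_r(\tau)\,d\tau.$$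 $\mathcal{R}^r_T$ is the set of all $w(\cdot,T)$ where $w$ is the solution with $u_\ell\equiv0$ and $u_r\in L^2_{\mathbb{C}}(0,T)$. It does not depend on $T>0$ and is denoted $\mathcal{R}^r$. Elements of $\mathcal{R}^r$ are identified with their analytic extensions from $(0,1)$ to $D^r_\infty$ given by the same integral formula with $x$ replaced by $z\in D^r_\infty$. The operator $\mathcal{L}^r_T:L^2_{\mathbb{C}}(0,T)\to hol(-1+D)$ is $(\mathcal{L}^r_Tu)(z)=\int_0^T(\partial_x\theta)(z+1,T-\tau)u(\tau)\,d\tau$, $z\in-1+D$.
   Formalization: The displayed norm is off by a factor 2 from the norm of the reproducing kernel Hilbert space with kernel K_r (the displayed norm has kernel 4K_r); what is proved is that the norm for K_r equals 2·inf{‖u‖ : f = 2L^r_T u}. *)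

(* Defs.v *)
(* MathComp-Analysis; the complex numbers are R[i] for R : realType. *)
From HB Require Import structures.
From mathcomp Require Import all_boot all_order all_algebra.
From mathcomp Require Import complex.
From mathcomp Require Import all_classical all_reals all_analysis.

Set Implicit Arguments.
Unset Strict Implicit.
Unset Printing Implicit Defensive.

Import Order.TTheory GRing.Theory Num.Theory.
Import numFieldNormedType.Exports.

Local Open Scope classical_set_scope.
Local Open Scope complex_scope.
Local Open Scope ring_scope.

Section Complex.
Context {R : realType}.
Local Notation C := R[i].
Local Notation mu := (@lebesgue_measure R).

Definition cexp (z : C) : C :=
  (expR (complex.Re z) * cos (complex.Im z))
    +i* (expR (complex.Re z) * sin (complex.Im z)).

(* Unconditional sum of a family over an arbitrary index type: positive and
   negative parts of the real and imaginary parts are summed separately.  The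
   value is meaningful for absolutely summable families only. *)
Definition rsum (I : choiceType) (a : I -> R) : R :=
  fine (esum setT (EFin \o a)^\+ - esum setT (EFin \o a)^\-)%E.

Definition csum (I : choiceType) (a : I -> C) : C :=
  rsum (fun i => complex.Re (a i)) +i* rsum (fun i => complex.Im (a i)).

Definition cintegral (a b : R) (f : R -> C) : C :=
  (\int[mu]_(t in `]a, b[) complex.Re (f t))
    +i* (\int[mu]_(t in `]a, b[) complex.Im (f t)).

(* R[i]^o is R[i] as a normed space over itself, so that [derivable _ z 1] is
   complex differentiability at z. *)
Definition hol (Omega : set C) (f : C -> C) : Prop :=
  forall z, Omega z -> derivable (f : C^o -> C^o) z 1.

Definition analytic_on (Omega : set C) (g : Omega -> C) : Prop :=
  exists2 f : C -> C, hol Omega f & g = sigL Omega f.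

Definition sqmod (z : C) : R := complex.Re z ^+ 2 + complex.Im z ^+ 2.

Definition L2C (T : R) (u : R -> C) : Prop :=
  [/\ measurable_fun `]0, T[ (fun t => complex.Re (u t)),
      measurable_fun `]0, T[ (fun t => complex.Im (u t)) &
      (\int[mu]_(t in `]0%R, T[) (sqmod (u t))%:E < +oo)%E].

Definition L2norm (T : R) (u : R -> C) : R :=
  Num.sqrt (\int[mu]_(t in `]0, T[) sqmod (u t)).

End Complex.

Section RKHS.
Context {R : realType} {X : Type}.
Local Notation C := R[i].

Definition ipnorm (ip : (X -> C) -> (X -> C) -> C) (f : X -> C) : R :=
  Num.sqrt (complex.Re (ip f f)).

(* The set H of functions X -> C, with the inner product ip (linear in its
   first argument, and irrelevant outside H), is a Hilbert space with
   reproducing kernel K. *)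
Record is_rkhs (K : X -> X -> C) (H : set (X -> C))
    (ip : (X -> C) -> (X -> C) -> C) : Prop := IsRKHS {
  rkhs_zero : H (fun=> 0);
  rkhs_lin : forall a f g, H f -> H g -> H (fun x => a * f x + g x);
  rkhs_ip_lin : forall a f g h, H f -> H g -> H h ->
    ip (fun x => a * f x + g x) h = a * ip f h + ip g h;
  rkhs_ip_conj : forall f g, H f -> H g -> ip g f = (ip f g)^*;
  rkhs_ip_ge0 : forall f, H f -> 0 <= ip f f;
  rkhs_ip_eq0 : forall f, H f -> ip f f = 0 -> f = (fun=> 0);
  rkhs_complete : forall f : nat -> X -> C, (forall n, H (f n)) ->
    (forall e : R, 0 < e -> exists N, forall m n, (N <= m)%N -> (N <= n)%N ->
       ipnorm ip (fun x => f m x - f n x) < e) ->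
    exists2 g, H g &
      forall e : R, 0 < e -> exists N, forall n, (N <= n)%N ->
        ipnorm ip (fun x => f n x - g x) < e;
  rkhs_kernel : forall w, H (fun z => K z w);
  rkhs_reproducing : forall f w, H f -> f w = ip f (fun z => K z w)
}.

End RKHS.

Section Heat.
Context {R : realType}.
Local Notation C := R[i].

Definition D : set C :=
  [set z | `|complex.Im z| < complex.Re z /\
           `|complex.Im z| < 2 - complex.Re z].

Definition Dl_infty : set C :=
  \bigcup_(n in [set: int]) [set (2 * n)%:~R + z | z in D].

Definition Dr_infty : set C := [set -1 + z | z in Dl_infty].

Definition Dr : set C := [set -1 + z | z in D].

Definition dxK (z : C) (t : R) : C :=
  - (z / (4 * Num.sqrt pi * t `^ (3 / 2))%:C) * cexp (- (z ^+ 2 / (4 * t)%:C)).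

Definition dxtheta (z : C) (t : R) : C :=
  csum (fun n : int => dxK (z + (2 * n)%:~R) t).

Definition heat_solution (ul ur : R -> C) (z : C) (t : R) : C :=
  - 2 * cintegral 0 t (fun tau => dxtheta z (t - tau) * ul tau)
  + 2 * cintegral 0 t (fun tau => dxtheta (z - 1) (t - tau) * ur tau).

(* The states reached at time T with ul = 0, extended from (0, 1) to Dr_infty
   by the integral formula: the values of f : C -> C outside Dr_infty are
   irrelevant. *)
Definition reach_r (T : R) : set (C -> C) :=
  [set f | exists2 ur, L2C T ur &
     forall z, Dr_infty z -> f z = heat_solution (fun=> 0) ur z T].

Definition Lr (T : R) (u : R -> C) (z : C) : C :=
  cintegral 0 T (fun tau => dxtheta (z + 1) (T - tau) * u tau).

Definition K0 (T : R) (z w : C) : C :=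
  let q := z ^+ 2 + w^* ^+ 2 in
  z * w^* / pi%:C * cexp (- (q / (4 * T)%:C))
    * (1 / q ^+ 2 + 1 / ((4 * T)%:C * q)).

Definition Kr (T : R) (z w : C) : C :=
  csum (fun mn : int * int =>
    K0 T (z + (2 * mn.2)%:~R + 1) (w + (2 * mn.1)%:~R + 1)).

Definition Kr_Dr (T : R) (z w : Dr) : C := Kr T (set_val z) (set_val w).

(* Infimum in \bar R, hence +oo if g is not in the range of 2 Lr.  As K0 z w
   is the L^2 pairing over (0, T) of dxK z and dxK w, Kr is the kernel of the
   range of Lr; the range of 2 Lr has kernel 4 Kr, so that range_norm is half
   of the norm attached to Kr. *)
Definition range_norm (T : R) (g : Dr -> C) : \bar R :=
  ereal_inf [set (L2norm T u)%:E | u in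
    [set u | L2C T u /\ g = sigL Dr (fun z => 2 * Lr T u z)]].

End Heat.

(* Main.v *)
Require Import Defs.
From HB Require Import structures.
From mathcomp Require Import all_boot all_order all_algebra.
From mathcomp Require Import complex.
From mathcomp Require Import all_classical all_reals all_analysis.
From mathcomp Require Import measurable_realfun ring lra.
Set Implicit Arguments.
Unset Strict Implicit.
Unset Printing Implicit Defensive.
Import Order.TTheory GRing.Theory Num.Theory.
Import numFieldNormedType.Exports.
Local Open Scope classical_set_scope.
Local Open Scope ring_scope.

(** Why the theorem holds.

    Put [k_z(t) = conj (dxtheta (z + 1) (T - t))].  Then [Lr T u z] is the
    scalar product of [u] and [k_z] in L^2(0, T) ([LrE]), so that [Lr T] is the
    operator attached to the feature map [z |-> k_z], and the theorem splits
    into an abstract part and an analytic part.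

    Abstract part.  The functions [z |-> <u, k_z>] form a reproducing kernel
    Hilbert space with kernel [<k_w, k_z>] for the quotient norm
    ([feature_rkhs]), and every reproducing kernel Hilbert space with this
    kernel is that one.  Both statements rest on [gram_transfer]: if two
    families have the same Gram matrix, then a vector of one space can be moved
    to the other space, provided that the latter is complete, with the same
    scalar products against the family and without increase of the norm.
    Between L^2 and itself this selects a representative in the closed span of
    the features; between L^2 and an arbitrary space with the same kernel, used
    in both directions ([rkhs_feature], [rkhs_preimage]), it identifies that
    space with the range of [Lr T] and its norm with the quotient norm.

    Analytic part.  If [z] belongs to a diamond of [Dr_infty], the real parts
    of [(z + 1 + 2 n)^2] are bounded below by [c (1 + n^2)]
    ([D_lattice_coercive]), because every [z + 1 + 2 n] stays inside the cone
    where the real part of the square is positive.  The Gaussian factor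
    therefore dominates all powers of [1 / t] and of [n]: the terms of
    [dxtheta (z + 1) t] are bounded by a summable sequence that does not depend
    on [t], and so are the remainders of their first order expansions in [z]
    ([lattice_bounds]).  Consequently [k_z] is bounded, hence square
    integrable; sums and integrals may be exchanged, and the Gram function of
    [z |-> k_z] is the double sum [Kr] ([feature_gram]), each term being the
    integral over (0, T) of an explicit derivative ([dxK_integral]); and
    [Lr T u] has first order expansions with quadratic remainder, so it is
    holomorphic on [Dr_infty] ([Lr_quadratic_expansion]).

    Conclusion.  As [dxtheta] is odd and has period 2 in its space variable,
    the solution of the heat equation is [2 * Lr T u], which is odd and
    periodic; conversely a periodic function on [Dr_infty] is determined by its
    restriction to [Dr], where it is [Lr T u] for some [u], and therefore the
    state reached with the control [u / 2].  The space with kernel [Kr] carries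
    the quotient norm of [Lr T], which is twice that of [2 * Lr T]. *)

(** * Real and imaginary parts *)

Section ComplexBasics.
Context {R : realType}.
Local Notation C := R[i].
Implicit Types (z w : C) (r : R).

Lemma complex_eqP z w :
  complex.Re z = complex.Re w -> complex.Im z = complex.Im w -> z = w.
Proof. by case: z => a b; case: w => c d /= -> ->. Qed.

Lemma cReD z w : complex.Re (z + w) = complex.Re z + complex.Re w.
Proof. by case: z; case: w. Qed.

Lemma cImD z w : complex.Im (z + w) = complex.Im z + complex.Im w.
Proof. by case: z; case: w. Qed.

Lemma cReN z : complex.Re (- z) = - complex.Re z.
Proof. by case: z. Qed.

Lemma cImN z : complex.Im (- z) = - complex.Im z.
Proof. by case: z. Qed.

Lemma cReM z w : complex.Re (z * w) =
  complex.Re z * complex.Re w - complex.Im z * complex.Im w.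
Proof. by case: z; case: w. Qed.

Lemma cImM z w : complex.Im (z * w) =
  complex.Re z * complex.Im w + complex.Im z * complex.Re w.
Proof. by case: z => a b; case: w => c d /=; rewrite addrC. Qed.

Lemma cReJ z : complex.Re (z^*) = complex.Re z.
Proof. by case: z. Qed.

Lemma cImJ z : complex.Im (z^*) = - complex.Im z.
Proof. by case: z. Qed.

Lemma cReR r : complex.Re r%:C%C = r. Proof. by []. Qed.
Lemma cImR r : complex.Im r%:C%C = 0. Proof. by []. Qed.

Definition cReImE := (cReD, cImD, cReN, cImN, cReM, cImM, cReJ, cImJ, cReR, cImR).

Lemma conj_realC r : (r%:C%C)^* = r%:C%C :> C.
Proof. by apply: complex_eqP; rewrite !cReImE ?oppr0. Qed.

Lemma mulCJ z : z * z^* = (sqmod z)%:C%C.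
Proof. by apply: complex_eqP; rewrite !cReImE /sqmod; ring. Qed.

Lemma sqmod_ge0 z : 0 <= sqmod z.
Proof. by rewrite /sqmod addr_ge0 ?sqr_ge0. Qed.

Lemma sqmod0 : sqmod (0 : C) = 0.
Proof. by rewrite /sqmod /= expr0n addr0. Qed.

Lemma sqmod_eq0 z : sqmod z = 0 -> z = 0.
Proof.
move=> /eqP; rewrite /sqmod paddr_eq0 ?sqr_ge0// !sqrf_eq0 => /andP[/eqP a /eqP b].
exact: complex_eqP.
Qed.

Lemma sqmodM z w : sqmod (z * w) = sqmod z * sqmod w.
Proof. by rewrite /sqmod !cReImE; ring. Qed.

Lemma sqmodN z : sqmod (- z) = sqmod z.
Proof. by rewrite /sqmod !cReImE; ring. Qed.

Lemma sqmodD_le z w : sqmod (z + w) <= 2 * sqmod z + 2 * sqmod w.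
Proof.
rewrite /sqmod !cReImE.
have := sqr_ge0 (complex.Re z - complex.Re w).
have := sqr_ge0 (complex.Im z - complex.Im w).
nra.
Qed.

End ComplexBasics.

(** * Spaces of functions with a semi-inner product *)

Section Prehilbert.
Context {R : realType} {Y : Type}.
Local Notation C := R[i].

(** The form may be degenerate: functions on an interval are not identified
    when they agree almost everywhere. *)
Record prehilbert (S : set (Y -> C)) (ip : (Y -> C) -> (Y -> C) -> C) : Prop :=
  Prehilbert {
  ph_zero : S (fun=> 0);
  ph_lin : forall a f g, S f -> S g -> S (fun x => a * f x + g x);
  ph_ip_lin : forall a f g h, S f -> S g -> S h ->
    ip (fun x => a * f x + g x) h = a * ip f h + ip g h;
  ph_ip_conj : forall f g, S f -> S g -> ip g f = (ip f g)^*;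
  ph_ip_ge0 : forall f, S f -> 0 <= ip f f
}.

Definition ip_complete (S : set (Y -> C)) (ip : (Y -> C) -> (Y -> C) -> C) :=
  forall f : nat -> Y -> C, (forall n, S (f n)) ->
    (forall e : R, 0 < e -> exists N, forall m n, (N <= m)%N -> (N <= n)%N ->
       ipnorm ip (fun x => f m x - f n x) < e) ->
    exists2 g, S g &
      forall e : R, 0 < e -> exists N, forall n, (N <= n)%N ->
        ipnorm ip (fun x => f n x - g x) < e.

(** Linear combinations are encoded by lists of coefficients and indices, so
    that the same combination can be formed in two spaces. *)
Definition comb {X : Type} (k : X -> Y -> C) (l : seq (C * X)) : Y -> C :=
  fun y => \sum_(p <- l) p.1 * k p.2 y.

Definition comb_scale {X : Type} (c : C) (l : seq (C * X)) :=
  [seq (c * p.1, p.2) | p <- l].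

Lemma comb_cons X (k : X -> Y -> C) p l :
  comb k (p :: l) = fun y => p.1 * k p.2 y + comb k l y.
Proof. by apply/funext => y; rewrite /comb big_cons. Qed.

Lemma comb_cat X (k : X -> Y -> C) l l' :
  comb k (l ++ l') = fun y => comb k l y + comb k l' y.
Proof. by apply/funext => y; rewrite /comb big_cat. Qed.

Lemma comb_scaleE X (k : X -> Y -> C) c l :
  comb k (comb_scale c l) = fun y => c * comb k l y.
Proof.
apply/funext => y; rewrite /comb /comb_scale big_map mulr_sumr.
by apply: eq_bigr => p _; rewrite /= mulrA.
Qed.

Section Theory.
Variables (S : set (Y -> C)) (ip : (Y -> C) -> (Y -> C) -> C).
Hypothesis phS : prehilbert S ip.
Let n2 (f : Y -> C) : R := complex.Re (ip f f).

Lemma ph_scale a f : S f -> S (fun x => a * f x).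
Proof.
move=> Sf; rewrite (_ : (fun _ => _) = fun x => a * f x + 0).
  exact: (ph_lin phS _ Sf (ph_zero phS)).
by apply/funext => x; rewrite addr0.
Qed.

Lemma ph_add f g : S f -> S g -> S (fun x => f x + g x).
Proof.
move=> Sf Sg; rewrite (_ : (fun _ => _) = fun x => 1 * f x + g x).
  exact: (ph_lin phS).
by apply/funext => x; rewrite mul1r.
Qed.

Lemma ph_sub f g : S f -> S g -> S (fun x => f x - g x).
Proof.
move=> Sf Sg; rewrite (_ : (fun _ => _) = fun x => (-1) * g x + f x).
  exact: (ph_lin phS).
by apply/funext => x; rewrite mulN1r addrC.
Qed.

Lemma ph_ipDl f g h : S f -> S g -> S h ->
  ip (fun x => f x + g x) h = ip f h + ip g h.
Proof.
move=> Sf Sg Sh; rewrite -[in RHS](mul1r (ip f h)) -(ph_ip_lin phS)//.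
by congr ip; apply/funext => x; rewrite mul1r.
Qed.

Lemma ph_ipBl f g h : S f -> S g -> S h ->
  ip (fun x => f x - g x) h = ip f h - ip g h.
Proof.
move=> Sf Sg Sh; rewrite addrC -mulN1r -(ph_ip_lin phS)//.
by congr ip; apply/funext => x; rewrite mulN1r addrC.
Qed.

Lemma ph_ip0l h : S h -> ip (fun=> 0) h = 0.
Proof.
move=> Sh; have S0 := ph_zero phS.
rewrite -[RHS](subrr (ip (fun=> 0) h)) -(ph_ipBl S0 S0 Sh).
by congr ip; apply/funext => x; rewrite subrr.
Qed.

Lemma ph_ipZl a f h : S f -> S h -> ip (fun x => a * f x) h = a * ip f h.
Proof.
move=> Sf Sh; have S0 := ph_zero phS.
rewrite -[RHS]addr0 -(ph_ip0l Sh) -(ph_ip_lin phS)//.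
by congr ip; apply/funext => x; rewrite addr0.
Qed.

Lemma ph_ipDr f g h : S f -> S g -> S h ->
  ip h (fun x => f x + g x) = ip h f + ip h g.
Proof.
move=> Sf Sg Sh; rewrite (ph_ip_conj phS (ph_add Sf Sg) Sh) ph_ipDl//.
by rewrite rmorphD /= -!(ph_ip_conj phS).
Qed.

Lemma ph_ipBr f g h : S f -> S g -> S h ->
  ip h (fun x => f x - g x) = ip h f - ip h g.
Proof.
move=> Sf Sg Sh; rewrite (ph_ip_conj phS (ph_sub Sf Sg) Sh) ph_ipBl//.
by rewrite rmorphB /= -!(ph_ip_conj phS).
Qed.

Lemma ph_ipZr a f h : S f -> S h -> ip h (fun x => a * f x) = a^* * ip h f.
Proof.
move=> Sf Sh; rewrite (ph_ip_conj phS (ph_scale a Sf) Sh) ph_ipZl//.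
by rewrite rmorphM /= -!(ph_ip_conj phS).
Qed.

Lemma ph_ipE f : S f -> ip f f = (n2 f)%:C%C.
Proof.
move=> Sf; have /ger0_Im h := ph_ip_ge0 phS Sf.
by apply: complex_eqP; rewrite !cReImE.
Qed.

Lemma ph_n2_ge0 f : S f -> 0 <= n2 f.
Proof. by move=> Sf; have := ph_ip_ge0 phS Sf; rewrite ph_ipE// ler0c. Qed.

Lemma ph_n2Z a f : S f -> n2 (fun x => a * f x) = sqmod a * n2 f.
Proof.
move=> Sf; have Saf := ph_scale a Sf.
apply: complexI; rewrite -ph_ipE// ph_ipZl// ph_ipZr//.
by rewrite mulrA mulCJ ph_ipE// rmorphM.
Qed.

Lemma ph_n2B f g : S f -> S g ->
  n2 (fun x => f x - g x) = n2 f - 2 * complex.Re (ip f g) + n2 g.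
Proof.
move=> Sf Sg; rewrite /n2 ph_ipBl//; last exact: ph_sub.
rewrite !ph_ipBr// (ph_ip_conj phS Sf Sg) !cReImE; ring.
Qed.

Lemma ph_n2D f g : S f -> S g ->
  n2 (fun x => f x + g x) = n2 f + 2 * complex.Re (ip f g) + n2 g.
Proof.
move=> Sf Sg; rewrite /n2 ph_ipDl//; last exact: ph_add.
rewrite !ph_ipDr// (ph_ip_conj phS Sf Sg) !cReImE; ring.
Qed.

Lemma ph_n2D_le f g : S f -> S g ->
  n2 (fun x => f x + g x) <= 2 * n2 f + 2 * n2 g.
Proof.
move=> Sf Sg; have := ph_n2_ge0 (ph_sub Sf Sg).
by rewrite (ph_n2B Sf Sg) (ph_n2D Sf Sg); lra.
Qed.

(** With [d = 0] this is the Cauchy-Schwarz inequality.  For [d] the squared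
    distance from [f] to a subspace that contains [g], it says that a nearly
    optimal approximation leaves a nearly orthogonal remainder. *)
Lemma ph_near_orthogonal d f g : S f -> S g ->
  (forall a, d <= n2 (fun x => f x - a * g x)) ->
  sqmod (ip f g) <= (n2 f - d) * n2 g.
Proof.
move=> Sf Sg dle; set P := sqmod _; set N := n2 g.
have P0 : 0 <= P by exact: sqmod_ge0.
have N0 : 0 <= N by exact: ph_n2_ge0.
(* Along the direction of the scalar product, the squared distance is a real
   quadratic polynomial in [s], minimal at [s = 1 / n2 g]. *)
have key s : d <= n2 f - 2 * s * P + s ^+ 2 * P * N.
  apply: le_trans (dle (s%:C%C * ip f g)) _.
  rewrite (ph_n2B Sf (ph_scale _ Sg)) ph_n2Z// sqmodM ph_ipZr// rmorphM /=.
  rewrite conj_realC -mulrA (mulrC (_^*)).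
  rewrite mulCJ -/P !cReImE -/N [sqmod s%:C%C]/sqmod !cReImE; lra.
have [N0'|] := eqVneq N 0.
  have [P0'|Pn0] := eqVneq P 0; first by rewrite N0' mulr0 P0'.
  have Pgt : 0 < P by rewrite lt_def Pn0.
  have := key ((n2 f - d + 1) / P / 2); rewrite N0' mulr0 addr0.
  have -> : 2 * ((n2 f - d + 1) / P / 2) * P = n2 f - d + 1 by field.
  lra.
move=> Nn0; have Ngt : 0 < N by rewrite lt_def Nn0.
have := key N^-1.
have -> : n2 f - 2 * N^-1 * P + N^-1 ^+ 2 * P * N = n2 f - P / N by field.
by move=> h; rewrite -ler_pdivrMr//; lra.
Qed.

Lemma ph_cauchy_schwarz f g : S f -> S g -> sqmod (ip f g) <= n2 f * n2 g.
Proof.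
move=> Sf Sg; rewrite -[n2 f]subr0; apply: ph_near_orthogonal => // a.
by apply: ph_n2_ge0; apply: ph_sub => //; exact: ph_scale.
Qed.

Lemma ph_ip_null f g : S f -> S g -> n2 f = 0 -> ip f g = 0.
Proof.
move=> Sf Sg f0; apply: sqmod_eq0; apply/eqP.
by rewrite eq_le sqmod_ge0 andbT (le_trans (ph_cauchy_schwarz Sf Sg))// f0 mul0r.
Qed.

Lemma ipnorm_lt f e : 0 < e -> (ipnorm ip f < e) = (n2 f < e ^+ 2).
Proof.
move=> e0; rewrite /ipnorm -/(n2 f) -{1}(gtr0_norm e0) -sqrtr_sqr.
by rewrite ltr_sqrt// exprn_gt0.
Qed.

Section Family.
Context {X : Type} (k : X -> Y -> C).
Hypothesis Sk : forall x, S (k x).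

Lemma ph_comb l : S (comb k l).
Proof.
elim: l => [|p l ih]; last by rewrite comb_cons; exact: (ph_lin phS).
rewrite (_ : comb k [::] = fun=> 0); first exact: ph_zero phS.
by apply/funext => y; rewrite /comb big_nil.
Qed.

Lemma ph_ip_combl l h : S h ->
  ip (comb k l) h = \sum_(p <- l) p.1 * ip (k p.2) h.
Proof.
move=> Sh; elim: l => [|p l ih].
  rewrite big_nil (_ : comb k [::] = fun=> 0) ?ph_ip0l//.
  by apply/funext => y; rewrite /comb big_nil.
by rewrite comb_cons (ph_ip_lin phS)//; [rewrite ih big_cons|exact: ph_comb].
Qed.

Lemma ph_ip_combr l h : S h ->
  ip h (comb k l) = \sum_(p <- l) p.1^* * ip h (k p.2).
Proof.
move=> Sh; rewrite (ph_ip_conj phS (ph_comb l) Sh) ph_ip_combl// rmorph_sum /=.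
by apply: eq_bigr => p _; rewrite rmorphM /= -(ph_ip_conj phS).
Qed.

Definition span_closure (u : Y -> C) :=
  forall e : R, 0 < e -> exists l, n2 (fun y => u y - comb k l y) < e.

(** A vector orthogonal to a subspace is at least as far from each of its
    elements as from 0; this makes representatives in the closed span unique up
    to vectors of norm 0. *)
Lemma span_closure_null u : S u -> span_closure u ->
  (forall x, ip u (k x) = 0) -> n2 u = 0.
Proof.
move=> Su cu ou; apply/eqP; rewrite eq_le ph_n2_ge0// andbT.
apply/ler_addgt0Pl => e e0; have [l] := cu e e0.
have Sl := ph_comb l.
rewrite ph_n2B// ph_ip_combr// big1; last by move=> p _; rewrite ou mulr0.
by have := ph_n2_ge0 Sl; rewrite addr0 /=; lra.
Qed.

Lemma span_closure_lin a u v : S u -> S v -> span_closure u -> span_closure v ->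
  span_closure (fun y => a * u y + v y).
Proof.
move=> Su Sv cu cv e e0.
have a0 := sqmod_ge0 a.
have [l1 h1] := cu (e / (4 * (sqmod a + 1))) ltac:(by rewrite divr_gt0//; lra).
have [l2 h2] := cv (e / 4) ltac:(by rewrite divr_gt0//; lra).
exists (comb_scale a l1 ++ l2); rewrite comb_cat comb_scaleE.
have S1 := ph_sub Su (ph_comb l1); have S2 := ph_sub Sv (ph_comb l2).
rewrite [X in n2 X](_ : _ = fun y => a * (u y - comb k l1 y) + (v y - comb k l2 y)).
  apply: le_lt_trans (ph_n2D_le (ph_scale a S1) S2) _.
  rewrite ph_n2Z//.
  have : sqmod a * n2 (fun y => u y - comb k l1 y) <= e / 4.
    apply: (@le_trans _ _ ((sqmod a + 1) * (e / (4 * (sqmod a + 1))))).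
      apply: ler_pM => //; [exact: ph_n2_ge0|lra|exact: ltW].
    rewrite le_eqVlt; apply/orP; left; apply/eqP; field.
    by apply/negP => /eqP; lra.
  lra.
by apply/funext => y; ring.
Qed.

Lemma span_closure_lim u : S u ->
  (forall e : R, 0 < e -> exists v, [/\ S v, span_closure v &
     n2 (fun y => u y - v y) < e]) -> span_closure u.
Proof.
move=> Su h e e0; have e4 : 0 < e / 4 by rewrite divr_gt0.
have [v [Sv cv uv]] := h _ e4; have [l hl] := cv _ e4; exists l.
have Sl := ph_comb l.
rewrite [X in n2 X](_ : _ = fun y => (u y - v y) + (v y - comb k l y)).
  apply: le_lt_trans (ph_n2D_le (ph_sub Su Sv) (ph_sub Sv Sl)) _; lra.
by apply/funext => y; ring.
Qed.

Lemma span_closure_mem x : span_closure (k x).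
Proof.
move=> e e0; exists [:: (1, x)].
rewrite [X in n2 X](_ : _ = fun=> 0); first by rewrite /n2 ph_ip0l//; exact: ph_zero phS.
by apply/funext => y; rewrite /comb big_seq1 /= mul1r subrr.
Qed.

End Family.
End Theory.
End Prehilbert.

(** * Reproducing kernel Hilbert spaces from feature maps *)

Section Transfer.
Context {R : realType} {X Y Y' : Type}.
Local Notation C := R[i].
Variables (S : set (Y -> C)) (ip : (Y -> C) -> (Y -> C) -> C).
Variables (S' : set (Y' -> C)) (ip' : (Y' -> C) -> (Y' -> C) -> C).
Hypotheses (phS : prehilbert S ip) (phS' : prehilbert S' ip').
Hypothesis cS' : ip_complete S' ip'.
Variables (k : X -> Y -> C) (k' : X -> Y' -> C).
Hypotheses (Sk : forall x, S (k x)) (Sk' : forall x, S' (k' x)).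
Hypothesis gram : forall x y, ip (k x) (k y) = ip' (k' x) (k' y).
Let n2 (f : Y -> C) : R := complex.Re (ip f f).
Let n2' (f : Y' -> C) : R := complex.Re (ip' f f).

Lemma gram_comb l l' : ip (comb k l) (comb k l') = ip' (comb k' l) (comb k' l').
Proof.
rewrite (ph_ip_combl phS Sk _ (ph_comb phS Sk l')).
rewrite (ph_ip_combl phS' Sk' _ (ph_comb phS' Sk' l')).
apply: eq_bigr => p _.
rewrite (ph_ip_combr phS Sk _ (Sk p.2)) (ph_ip_combr phS' Sk' _ (Sk' p.2)).
by congr (_ * _); apply: eq_bigr => q _; rewrite gram.
Qed.

Lemma comb_sub (Z : Type) (h : X -> Z -> C) l l' :
  (fun y => comb h l y - comb h l' y) = comb h (l ++ comb_scale (-1) l').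
Proof.
by apply/funext => y; rewrite comb_cat comb_scaleE mulN1r.
Qed.

(** Combinations [c n] of the first family whose distance to [u] tends to the
    infimum form a Cauchy sequence; the same combinations of the second family
    have the same mutual distances, hence converge to some [u'].  Since [u] is
    nearly orthogonal to the family after subtraction of [c n], the scalar
    products of [u'] are those of [u]. *)
Theorem gram_transfer u : S u -> exists u', [/\ S' u',
  forall x, ip' u' (k' x) = ip u (k x), n2' u' <= n2 u &
  span_closure ip' k' u'].
Proof.
move=> Su.
have Sl l := ph_comb phS Sk l; have Sl' l := ph_comb phS' Sk' l.
pose A := [set n2 (fun y => u y - comb k l y) | l in setT].
have lbA : lbound A 0.
  by move=> _ [l _ <-]; exact: (ph_n2_ge0 phS (ph_sub phS Su (Sl l))).
have infA : has_inf A by split; [exists (n2 (fun y => u y - comb k [::] y)); exists [::]|exists 0].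
pose d := inf A.
have dle l : d <= n2 (fun y => u y - comb k l y).
  by apply: ge_inf; [exists 0|exists l].
have near n : exists l, n2 (fun y => u y - comb k l y) < d + n.+1%:R^-1.
  have n0 : 0 < n.+1%:R^-1 :> R by rewrite invr_gt0.
  have [_ [l _ <-] hl] := inf_adherent n0 infA.
  by exists l.
have [c cP] := choice near.
have combk_lin a l l' : comb k (comb_scale a l ++ l') = fun y => a * comb k l y + comb k l' y.
  by rewrite comb_cat comb_scaleE.
(* The parallelogram identity for the differences of [u] with two combinations:
   their half sum is again such a difference, hence not shorter than [d]. *)
have cauchy m n : n2' (fun y => comb k' (c m) y - comb k' (c n) y) <
    2 * m.+1%:R^-1 + 2 * n.+1%:R^-1.
  have -> : n2' (fun y => comb k' (c m) y - comb k' (c n) y) =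
            n2 (fun y => comb k (c m) y - comb k (c n) y).
    by rewrite !comb_sub /n2' /n2 gram_comb.
  pose f := fun y => u y - comb k (c m) y; pose g := fun y => u y - comb k (c n) y.
  have Sf : S f := ph_sub phS Su (Sl _); have Sg : S g := ph_sub phS Su (Sl _).
  have -> : (fun y => comb k (c m) y - comb k (c n) y) = (fun y => g y - f y).
    by apply/funext => y; rewrite /f /g; ring.
  have := dle (comb_scale (2^-1) (c m) ++ comb_scale (2^-1) (c n)).
  have -> : (fun y => u y - comb k (comb_scale 2^-1 (c m) ++ comb_scale 2^-1 (c n)) y) =
    (fun y => (2^-1)%:C%C * (g y + f y)).
    apply/funext => y; rewrite combk_lin comb_scaleE /f /g.
    have -> : (2^-1)%:C%C = 2^-1 :> C by rewrite fmorphV rmorph_nat.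
    by field.
  rewrite /n2 (ph_n2Z phS); last exact: (ph_add phS).
  rewrite (ph_n2D phS Sg Sf) (ph_n2B phS Sg Sf).
  have := cP m; have := cP n; rewrite -/f -/g /n2 /sqmod !cReImE.
  move: (n.+1%:R^-1) (m.+1%:R^-1) => en em; lra.
have small (e : R) : 0 < e -> exists N, forall n, (N <= n)%N -> n.+1%:R^-1 < e.
  move=> e0; exists (Num.truncn e^-1) => n nN.
  rewrite invf_plt ?posrE//; apply: lt_le_trans (truncnS_gt _) _.
  by rewrite ler_nat.
have [e e0|u' Su' u'P] := cS' (fun n => Sl' (c n)).
  have [N hN] := small (e ^+ 2 / 4) ltac:(by rewrite divr_gt0// exprn_gt0).
  exists N => m n mN nN.
  rewrite (ipnorm_lt _ _ e0).
  apply: lt_trans (cauchy _ _) _.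
  have := hN _ mN; have := hN _ nN.
  by move: (n.+1%:R^-1) (m.+1%:R^-1) => en em; lra.
have cvg (e : R) : 0 < e -> exists N, forall n, (N <= n)%N ->
    n2' (fun y => u' y - comb k' (c n) y) < e.
  move=> e0.
  have se0 : 0 < Num.sqrt e by rewrite sqrtr_gt0.
  have [N hN] := u'P _ se0; exists N => n /hN.
  rewrite (ipnorm_lt _ _ se0).
  rewrite sqr_sqrtr ?(ltW e0)// (ph_n2B phS' (Sl' _) Su').
  rewrite /n2' (ph_n2B phS' Su' (Sl' _)) (ph_ip_conj phS' Su' (Sl' _)) !cReImE.
  lra.
have agree x : ip' u' (k' x) = ip u (k x).
  apply/eqP; rewrite -subr_eq0; apply/eqP/sqmod_eq0/eqP.
  rewrite eq_le sqmod_ge0 andbT; apply/ler_addgt0Pl => e e0; rewrite addr0.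
  have K0 : 0 <= n2 (k x) := ph_n2_ge0 phS (Sk x).
  pose e' := e / (4 * (n2 (k x) + 1)).
  have e'0 : 0 < e' by rewrite divr_gt0//; lra.
  have ee' : 4 * e' * (n2 (k x) + 1) = e.
    by rewrite /e'; field; apply/negP => /eqP; lra.
  have [N1 h1] := cvg _ e'0; have [N2 h2] := small _ e'0.
  pose n := maxn N1 N2.
  have {}h1 := h1 n (leq_maxl _ _); have {}h2 := h2 n (leq_maxr _ _).
  have gk : ip' (comb k' (c n)) (k' x) = ip (comb k (c n)) (k x).
    have := gram_comb (c n) [:: (1, x)].
    have c1 (Z : Type) (h : X -> Z -> C) : comb h [:: (1, x)] = h x.
      by apply/funext => z; rewrite /comb big_seq1 mul1r.
    by rewrite !c1.
  have -> : ip' u' (k' x) - ip u (k x) =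
    ip' (fun y => u' y - comb k' (c n) y) (k' x)
     + - ip (fun y => u y - comb k (c n) y) (k x).
    rewrite (ph_ipBl phS' Su' (Sl' _) (Sk' _)) (ph_ipBl phS Su (Sl _) (Sk _)) gk.
    by ring.
  apply: le_trans (sqmodD_le _ _) _; rewrite sqmodN.
  have le1 := ph_cauchy_schwarz phS' (ph_sub phS' Su' (Sl' (c n))) (Sk' x).
  have : sqmod (ip (fun y => u y - comb k (c n) y) (k x)) <=
     (n2 (fun y => u y - comb k (c n) y) - d) * n2 (k x).
    apply: (ph_near_orthogonal phS) => //; first exact: (ph_sub phS).
    move=> a; have := dle (comb_scale a [:: (1, x)] ++ c n).
    congr (_ <= n2 _); apply/funext => y.
    by rewrite combk_lin /comb big_seq1 mul1r; ring.
  have kk : complex.Re (ip' (k' x) (k' x)) = n2 (k x) by rewrite /n2 gram.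
  rewrite kk in le1; move=> le2.
  have {}le1 : sqmod (ip' (fun y => u' y - comb k' (c n) y) (k' x)) <= e' * n2 (k x).
    by apply: le_trans le1 _; apply: ler_wpM2r => //; exact: ltW.
  have {}le2 : sqmod (ip (fun y => u y - comb k (c n) y) (k x)) <= e' * n2 (k x).
    apply: le_trans le2 _; apply: ler_wpM2r => //.
    have := cP n; move: h2;  move: (n.+1%:R^-1) => en; lra.
  rewrite -ee'; nra.
exists u'; split=> //; last first.
  by move=> e e0; have [N hN] := cvg e e0; exists (c N); exact: hN.
apply/ler_addgt0Pl => e e0; have [N hN] := cvg e e0; have := hN N (leqnn _).
rewrite /n2' (ph_n2B phS' Su' (Sl' _)).
have := ph_n2_ge0 phS (ph_sub phS Su (Sl (c N))).
rewrite (ph_n2B phS Su (Sl _)) -/(n2 u).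
have -> : ip' u' (comb k' (c N)) = ip u (comb k (c N)).
  rewrite (ph_ip_combr phS' Sk' _ Su') (ph_ip_combr phS Sk _ Su).
  by apply: eq_bigr => p _; rewrite agree.
rewrite gram_comb; lra.
Qed.

End Transfer.

Section FeatureMap.
Context {R : realType} {X Y : Type}.
Local Notation C := R[i].
Variables (S : set (Y -> C)) (ip : (Y -> C) -> (Y -> C) -> C).
Hypotheses (phS : prehilbert S ip) (cS : ip_complete S ip).
Variables (k : X -> Y -> C).
Hypotheses (Sk : forall x, S (k x)).
Let n2 (f : Y -> C) : R := complex.Re (ip f f).
Let K (z w : X) : C := ip (k w) (k z).

Definition feature_range : set (X -> C) :=
  [set f | exists2 u, S u & f = fun z => ip u (k z)].

(** Membership in the closed span is what makes the choice of [u] linear in [f]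
    up to vectors of norm 0, and makes its norm minimal. *)
Definition represents (f : X -> C) (u : Y -> C) :=
  [/\ S u, f = (fun z => ip u (k z)) & span_closure ip k u].

Definition representative (f : X -> C) : Y -> C := xget (fun=> 0) (represents f).

Definition feature_ip (f g : X -> C) : C := ip (representative f) (representative g).

Lemma representativeP f : feature_range f -> represents f (representative f).
Proof.
move=> [u Su fE]; apply: xgetPex.
have [v [Sv vu _ cv]] := gram_transfer phS phS cS Sk Sk (fun _ _ => erefl) Su.
exists v; split=> //; rewrite fE; apply/funext => z; exact/esym/vu.
Qed.

Lemma represents_range f u : represents f u -> feature_range f.
Proof. by move=> [Su fE _]; exists u. Qed.

Lemma represents_lin a f g u v : represents f u -> represents g v ->
  represents (fun x => a * f x + g x) (fun x => a * u x + v x).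
Proof.
move=> [Su -> cu] [Sv -> cv]; split; [exact: (ph_lin phS)| |exact: (span_closure_lin phS)].
by apply/funext => z; rewrite (ph_ip_lin phS).
Qed.

Lemma represents_sub f g u v : represents f u -> represents g v ->
  represents (fun x => f x - g x) (fun x => u x - v x).
Proof.
move=> ru rv; have := represents_lin (-1) rv ru.
by congr (represents _ _); apply/funext => z; rewrite mulN1r addrC.
Qed.

Lemma represents_ipl f u v h : represents f u -> represents f v -> S h ->
  ip u h = ip v h.
Proof.
move=> ru rv Sh; have [Suv f0 cuv] := represents_sub ru rv.
apply/eqP; rewrite -subr_eq0; case: ru rv => [Su _ _] [Sv _ _].
rewrite -(ph_ipBl phS)//; apply/eqP/(ph_ip_null phS Suv Sh).
apply: (span_closure_null phS Sk Suv cuv) => x.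
by have /(congr1 (@^~ x)) /= := f0; rewrite subrr.
Qed.

Lemma feature_ipE f g u v : represents f u -> represents g v ->
  feature_ip f g = ip u v.
Proof.
move=> ru rv; rewrite /feature_ip.
have r1 := representativeP (represents_range ru).
have r2 := representativeP (represents_range rv).
have [[[[S1 _ _] [S2 _ _]] [Su _ _]] [Sv _ _]] := (r1, r2, ru, rv).
rewrite (represents_ipl r1 ru S2) (ph_ip_conj phS S2 Su).
by rewrite (represents_ipl r2 rv Su) -(ph_ip_conj phS).
Qed.

Lemma represents_kernel w : represents (fun z => K z w) (k w).
Proof. by split=> //; exact: (span_closure_mem phS). Qed.

(** The closed span of the features, on which the map to functions is isometric
    by definition of [feature_ip], inherits completeness from the ambient
    space. *)
Theorem feature_rkhs : is_rkhs K feature_range feature_ip.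
Proof.
have rP := representativeP.
have r0 : represents (fun=> 0) (fun=> 0).
  split; first exact: (ph_zero phS).
    by apply/funext => z; rewrite (ph_ip0l phS).
  move=> e e0; exists [::].
  rewrite (_ : (fun _ => _) = fun=> 0).
    by rewrite (ph_ip0l phS)//; exact: (ph_zero phS).
  by apply/funext => y; rewrite /comb big_nil subrr.
split.
- exact: represents_range r0.
- by move=> a f g /rP rf /rP rg; exact: represents_range (represents_lin a rf rg).
- move=> a f g h /rP rf /rP rg /rP rh.
  rewrite (feature_ipE (represents_lin a rf rg) rh) (feature_ipE rf rh) (feature_ipE rg rh).
  by case: rf rg rh => ? _ _ [? _ _] [? _ _]; rewrite (ph_ip_lin phS).
- move=> f g /rP rf /rP rg; rewrite (feature_ipE rf rg) (feature_ipE rg rf).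
  by case: rf rg => ? _ _ [? _ _]; rewrite -(ph_ip_conj phS).
- move=> f /rP rf; rewrite (feature_ipE rf rf); case: rf => ? _ _.
  exact: (ph_ip_ge0 phS).
- move=> f /rP rf; rewrite (feature_ipE rf rf); case: rf => Sr fE _ r0'.
  by apply/funext => z; rewrite fE; apply: (ph_ip_null phS) => //; rewrite r0'.
- move=> f Hf cauchy.
  have rf n := rP _ (Hf n).
  have nE m n : ipnorm feature_ip (fun x => f m x - f n x) =
      ipnorm ip (fun y => representative (f m) y - representative (f n) y).
    by rewrite /ipnorm (feature_ipE (represents_sub (rf m) (rf n)) (represents_sub (rf m) (rf n))).
  have Sr n : S (representative (f n)) by case: (rf n).
  have [e e0|u Su uP] := cS Sr.
    by have [N hN] := cauchy e e0; exists N => m n mN nN; rewrite -nE; exact: hN.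
  have ru : represents (fun z => ip u (k z)) u.
    split=> //; apply: (span_closure_lim phS Sk Su) => e e0.
    have se0 : 0 < Num.sqrt e by rewrite sqrtr_gt0.
    have [N hN] := uP _ se0; have := hN N (leqnn _).
    rewrite (ipnorm_lt _ _ se0).
    rewrite sqr_sqrtr ?(ltW e0)// (ph_n2B phS (Sr _) Su) => h.
    exists (representative (f N)); split=> //; first by case: (rf N).
    by rewrite (ph_n2B phS Su (Sr _)) (ph_ip_conj phS (Sr _) Su) !cReImE; lra.
  exists (fun z => ip u (k z)); first by exists u.
  move=> e e0; have [N hN] := uP e e0; exists N => n nN.
  rewrite /ipnorm (feature_ipE (represents_sub (rf n) ru) (represents_sub (rf n) ru)).
  exact: hN.
- by move=> w; exact: represents_range (represents_kernel w).
- move=> f w /rP rf; rewrite (feature_ipE rf (represents_kernel w)).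
  by case: rf => _ fE _; rewrite [LHS](congr1 (@^~ w) fE).
Qed.

Section Uniqueness.
Variables (H : set (X -> C)) (ipH : (X -> C) -> (X -> C) -> C).
Hypothesis rkH : is_rkhs K H ipH.

Lemma rkhs_prehilbert : prehilbert H ipH.
Proof. by case: rkH. Qed.

Let gramH x y :
  ip (k x) (k y) = ipH (fun z => K z x) (fun z => K z y).
Proof. by rewrite -(rkhs_reproducing rkH)//; exact: (rkhs_kernel rkH). Qed.

(** Transfer from the feature space: the family of kernel functions of [H] has
    the same Gram matrix as the features, and evaluation at a point is the
    scalar product with the kernel function. *)
Lemma rkhs_feature u : S u -> H (fun z => ip u (k z)) /\
  ipnorm ipH (fun z => ip u (k z)) <= ipnorm ip u.
Proof.
move=> Su.
have [f [Hf fE nf _]] := gram_transfer phS rkhs_prehilbert (rkhs_complete rkH)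
  Sk (rkhs_kernel rkH) gramH Su.
have -> : (fun z => ip u (k z)) = f.
  by apply/funext => z; rewrite -fE -(rkhs_reproducing rkH).
by split=> //; rewrite /ipnorm ler_wsqrtr.
Qed.

Lemma rkhs_preimage f : H f -> exists u, [/\ S u, f = (fun z => ip u (k z)) &
  ipnorm ip u <= ipnorm ipH f].
Proof.
move=> Hf.
have [u [Su uE nu _]] := gram_transfer rkhs_prehilbert phS cS
  (rkhs_kernel rkH) Sk (fun x y => esym (gramH x y)) Hf.
exists u; split=> //; last by rewrite /ipnorm ler_wsqrtr.
by apply/funext => z; rewrite uE -(rkhs_reproducing rkH).
Qed.

End Uniqueness.
End FeatureMap.

(** * Completeness of real square integrable functions *)

Section L2Complete.
Context d (T : measurableType d) {R : realType} (mu : {measure set T -> \bar R}).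
Variables (D : set T).
Hypotheses (mD : measurable D) (fD : (mu D < +oo)%E).

(** The bound [|x| <= 2^k x^2 + 2^-k] turns the estimates on squares into
    estimates on absolute values, because the measure of [D] is finite; the sum
    of the increments is then finite almost everywhere. *)
Lemma L1_fast_cvg (u : nat -> T -> R) :
  (forall n, measurable_fun D (u n)) ->
  (forall k, (\int[mu]_(x in D) ((u k.+1 x - u k x) ^+ 2)%:E <= (4^-1 ^+ k)%:E)%E) ->
  {ae mu, forall x, D x -> cvgn (u ^~ x)}.
Proof.
move=> mu_ hu.
pose dl k x : R := u k.+1 x - u k x.
have mdl k : measurable_fun D (dl k) by apply: measurable_funB.
pose F x : \bar R := (\sum_(0 <= k <oo) `|dl k x|%:E)%E.
have mabs k : measurable_fun D (fun x => `|dl k x|%:E).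
  by apply/measurable_EFinP; apply: measurableT_comp.
have mF : measurable_fun D F by apply: ge0_emeasurable_sum => // k x Dx _; rewrite lee_fin.
pose M : R := fine (mu D).
have ME : mu D = M%:E by rewrite fineK// ge0_fin_numE.
have M0 : 0 <= M by rewrite fine_ge0.
have l1 k : (\int[mu]_(x in D) `|dl k x|%:E <= ((1 + M) * 2^-1 ^+ k)%:E)%E.
  apply: (@le_trans _ _ (\int[mu]_(x in D) ((2 ^+ k)%:E * ((dl k x) ^+ 2)%:E + (2^-1 ^+ k)%:E))%E).
    apply: ge0_le_integral => //.
    - apply: emeasurable_funD => //; apply: measurable_funeM; apply/measurable_EFinP.
      exact: measurable_funX.
    - move=> x Dx; rewrite -EFinM -EFinD lee_fin.
      rewrite -real_normK ?num_real//; set z := `|dl k x|; rewrite exprVn.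
      set a : R := 2 ^+ k; have a0 : 0 < a by rewrite exprn_gt0.
      have -> : a * z ^+ 2 + a^-1 = z + a * ((z - a^-1 / 2) ^+ 2 + 3 / 4 * a^-1 ^+ 2).
        by field; rewrite gt_eqF.
      by rewrite lerDl mulr_ge0 ?addr_ge0 ?sqr_ge0 ?mulr_ge0 ?invr_ge0 ?ltW.
  rewrite ge0_integralD//; last 2 first.
  - by move=> x Dx; rewrite -EFinM lee_fin mulr_ge0// ?sqr_ge0// exprn_ge0.
  - by apply: measurable_funeM; apply/measurable_EFinP; exact: measurable_funX.
  rewrite ge0_integralZl//; last 2 first.
  - by apply/measurable_EFinP; exact: measurable_funX.
  - by move=> x Dx; rewrite lee_fin sqr_ge0.
  rewrite integral_cst// ME mulrDl mul1r EFinD.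
  apply: leeD; last by rewrite -EFinM mulrC.
  apply: (@le_trans _ _ ((2 ^+ k)%:E * (4^-1 ^+ k)%:E)%E).
    by rewrite lee_pmul2l ?hu ?lte_fin ?exprn_gt0.
  rewrite -EFinM lee_fin -exprMn.
  by have -> : 2 * 4^-1 = 2^-1 :> R by field.
have iF : mu.-integrable D F.
  apply/integrableP; split=> //.
  under eq_integral => x _ do rewrite gee0_abs ?nneseries_ge0//.
  rewrite /F integral_nneseries//.
  apply: (@le_lt_trans _ _ (\sum_(0 <= k <oo) ((1 + M) * 2^-1 ^+ k)%:E)%E).
    by apply: lee_nneseries => // k _; rewrite integral_ge0.
  have M1 : 0 <= 2 * (1 + M) by lra.
  have := epsilon_trick0 xpredT M1; rewrite (eq_eseriesr (g := fun k => ((1 + M) * 2^-1 ^+ k)%:E)).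
    by move=> /le_lt_trans; apply; rewrite ltry.
  move=> k _; congr EFin; rewrite natrX exprS exprVn; field.
  by rewrite expf_neq0.
have := integrable_ae mD iF.
apply: filterS => x Fx Dx.
have {}Fx := Fx Dx.
have cdl : cvgn (series (fun k => dl k x)).
  apply: normed_cvg; apply: nnseries_is_cvg => [i|]; first exact: normr_ge0.
  rewrite -ge0_fin_numE//; apply: nneseries_ge0 => k _ _.
  by rewrite lee_fin normr_ge0.
have -> : u ^~ x = (fun n => u 0%N x + series (fun k => dl k x) n).
  by apply/funext => n; rewrite (eq_sum_telescope (u ^~ x)).
by apply: is_cvgD => //; exact: is_cvg_cst.
Qed.

Lemma limn_einf_ge0 (u : (\bar R)^nat) : (forall n, (0 <= u n)%E) ->
  (0 <= limn_einf u)%E.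
Proof.
move=> u0; rewrite limn_einf_lim; apply: lime_ge; first exact: is_cvg_einfs.
by apply: nearW => n; apply: le_ereal_inf_tmp => _ [k _ <-].
Qed.

Lemma limn_einf_le (u : (\bar R)^nat) (e : \bar R) N :
  (forall n, (N <= n)%N -> (u n <= e)%E) -> (limn_einf u <= e)%E.
Proof.
move=> ue; rewrite limn_einf_lim; apply: lime_le; first exact: is_cvg_einfs.
apply: nearW => n; apply: (@le_trans _ _ (u (maxn N n))); last exact/ue/leq_maxl.
by apply: ereal_inf_lbound; exists (maxn N n) => //=; exact: leq_maxr.
Qed.

Lemma measurable_fun_limn_einf (f : (T -> \bar R)^nat) :
  (forall n, measurable_fun D (f n)) ->
  measurable_fun D (fun x => limn_einf (f ^~ x)).
Proof.
move=> mf.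
rewrite (_ : (fun _ => _) = fun x => (- limn_esup (fun n => - f n x))%E).
  apply: measurableT_comp => //; apply: measurable_fun_limn_esup => n.
  exact: measurableT_comp.
by apply/funext => x; rewrite limn_esupN oppeK.
Qed.

(** A rapidly Cauchy subsequence converges almost everywhere, and Fatou's lemma
    bounds the distance of the whole sequence to its limit. *)
Theorem L2_real_complete (p : nat -> T -> R) :
  (forall n, measurable_fun D (p n)) ->
  (forall e : R, 0 < e -> exists N, forall m n, (N <= m)%N -> (N <= n)%N ->
    (\int[mu]_(x in D) ((p m x - p n x) ^+ 2)%:E <= e%:E)%E) ->
  exists2 q : T -> R, measurable_fun D q &
    forall e : R, 0 < e -> exists N, forall n, (N <= n)%N ->
      (\int[mu]_(x in D) ((p n x - q x) ^+ 2)%:E <= e%:E)%E.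
Proof.
move=> mp cp.
have [N NP] := choice (fun k : nat => cp (4^-1 ^+ k) ltac:(by rewrite exprn_gt0)).
(* Partial sums of the successors of the [N k], so that [phi] is nondecreasing
   and exceeds both [N k] and [k]. *)
pose phi k := (\sum_(j < k.+1) (N j).+1)%N.
have Nphi k : (N k <= phi k)%N by rewrite /phi big_ord_recr /= addnS ltnW// ltnS leq_addl.
have kphi k : (k <= phi k)%N.
  by elim: k => // k ih; rewrite /phi big_ord_recr /= addnS ltnS (leq_trans ih)// leq_addr.
have phiS k : (phi k <= phi k.+1)%N by rewrite /phi [leqRHS]big_ord_recr leq_addr.
have ae_cvg : {ae mu, forall x, D x -> cvgn (fun k => p (phi k) x)}.
  apply: (@L1_fast_cvg (fun k => p (phi k))) => [k|k]; first exact: mp.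
  by apply: NP; [exact: leq_trans (phiS k)|exact: Nphi].
pose q x := fine (limn_esup (fun k => (p (phi k) x)%:E)).
have mq : measurable_fun D q.
  apply: (@measurableT_comp _ _ _ _ _ _ fine); first exact: fine_measurable.
  by apply: measurable_fun_limn_esup => k; exact/measurable_EFinP.
have qlim x : cvgn (fun k => p (phi k) x) -> (fun k => p (phi k) x) @ \oo --> q x.
  move=> cx; suff -> : q x = limn (fun k => p (phi k) x) by [].
  rewrite /q; have /cvg_limn_einf_sup[_ ->] :
    (fun k => (p (phi k) x)%:E) @ \oo --> (limn (fun k => p (phi k) x))%:E.
    by apply: cvg_EFin => //; near=> k.
  by [].
exists q => // e e0; have [N0 hN0] := cp e e0; exists N0 => n nN.
have mpq k : measurable_fun D (fun x => ((p n x - p (phi k) x) ^+ 2)%:E).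
  by apply/measurable_EFinP/measurable_funX/measurable_funB.
apply: (@le_trans _ _ (\int[mu]_(x in D) limn_einf (fun k => ((p n x - p (phi k) x) ^+ 2)%:E))%E).
  apply: ae_ge0_le_integral => //.
  - by move=> x _; rewrite lee_fin sqr_ge0.
  - by apply/measurable_EFinP/measurable_funX/measurable_funB.
  - by move=> x _; apply: limn_einf_ge0 => k; rewrite lee_fin sqr_ge0.
  - exact: measurable_fun_limn_einf.
  - apply: filterS ae_cvg => x cx Dx; have {}cx := qlim x (cx Dx).
    have hc : (fun k => ((p n x - p (phi k) x) ^+ 2)%:E) @ \oo --> ((p n x - q x) ^+ 2)%:E.
      have hB : (fun k => p n x - p (phi k) x) @ \oo --> p n x - q x.
        by apply: cvgB => //; exact: cvg_cst.
      apply: cvg_EFin; first by near=> k.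
      exact: (cvgM hB hB).
    by rewrite (cvg_limn_einf_sup hc).
apply: le_trans (fatou mu mD mpq _) _; first by move=> k x _; rewrite lee_fin sqr_ge0.
apply: (@limn_einf_le _ _ N0) => k kN; apply: hN0 => //.
exact: leq_trans (kphi k).
Unshelve. all: by end_near.
Qed.

End L2Complete.

(** * Complex square integrable functions on an interval *)

Section ComplexIntegral.
Context {R : realType}.
Local Notation C := R[i].
Local Notation mu := (@lebesgue_measure R).
Variable T : R.
Let I : set (measurableTypeR R) := `]0, T[%classic.
Let mI : measurable I := measurable_itv _.

Lemma finite_itv0T : (mu I < +oo)%E.
Proof. by rewrite lebesgue_measure_itv /=; case: ifP => _; rewrite ?ltry// -EFinB ltry. Qed.

Lemma integrable_cst_itv (c : R) : mu.-integrable I (fun=> c%:E).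
Proof.
apply/integrableP; split; first exact: measurable_cst.
by rewrite integral_cst// lte_mul_pinfty// finite_itv0T.
Qed.

Definition cmeasurable (f : R -> C) :=
  measurable_fun I (fun t => complex.Re (f t)) /\
  measurable_fun I (fun t => complex.Im (f t)).

Definition cintegrable (f : R -> C) :=
  mu.-integrable I (fun t => (complex.Re (f t))%:E) /\
  mu.-integrable I (fun t => (complex.Im (f t))%:E).

Lemma cmeasurable_cst c : cmeasurable (fun=> c).
Proof. by split; exact: measurable_cst. Qed.

Lemma cmeasurableD f g : cmeasurable f -> cmeasurable g ->
  cmeasurable (fun t => f t + g t).
Proof.
move=> [f1 f2] [g1 g2]; split.
  by under eq_fun do rewrite cReD; exact: measurable_funD.
by under eq_fun do rewrite cImD; exact: measurable_funD.
Qed.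

Lemma cmeasurableM f g : cmeasurable f -> cmeasurable g ->
  cmeasurable (fun t => f t * g t).
Proof.
move=> [f1 f2] [g1 g2]; split.
  by under eq_fun do rewrite cReM; apply: measurable_funB; exact: measurable_funM.
by under eq_fun do rewrite cImM; apply: measurable_funD; exact: measurable_funM.
Qed.

Lemma cmeasurableJ f : cmeasurable f -> cmeasurable (fun t => (f t)^*).
Proof.
move=> [f1 f2]; split; first by under eq_fun do rewrite cReJ.
by under eq_fun do rewrite cImJ; exact: measurable_funN.
Qed.

Lemma measurable_sqmod f : cmeasurable f -> measurable_fun I (fun t => sqmod (f t)).
Proof. by move=> [f1 f2]; apply: measurable_funD; exact: measurable_funX. Qed.

Lemma le_cintegrable f (g : R -> R) : cmeasurable f ->
  (forall t, I t -> `|complex.Re (f t)| <= g t) ->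
  (forall t, I t -> `|complex.Im (f t)| <= g t) ->
  mu.-integrable I (fun t => (g t)%:E) -> cintegrable f.
Proof.
move=> [f1 f2] h1 h2 ig; split.
  apply: (le_integrable mI _ _ ig); first exact/measurable_EFinP.
  by move=> t It; rewrite /= lee_fin (le_trans (h1 t It))// ler_norm.
apply: (le_integrable mI _ _ ig); first exact/measurable_EFinP.
by move=> t It; rewrite /= lee_fin (le_trans (h2 t It))// ler_norm.
Qed.

Lemma cintegrableD f g : cintegrable f -> cintegrable g ->
  cintegrable (fun t => f t + g t).
Proof.
move=> [f1 f2] [g1 g2]; split.
  by under eq_fun do rewrite cReD EFinD; exact: integrableD.
by under eq_fun do rewrite cImD EFinD; exact: integrableD.
Qed.

Lemma cintegrableZ a f : cintegrable f -> cintegrable (fun t => a * f t).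
Proof.
move=> [f1 f2]; split.
  under eq_fun do rewrite cReM EFinB !EFinM.
  by apply: integrableB => //; exact: integrableZl.
under eq_fun do rewrite cImM EFinD !EFinM.
by apply: integrableD => //; exact: integrableZl.
Qed.

Lemma cintegralD f g : cintegrable f -> cintegrable g ->
  cintegral 0 T (fun t => f t + g t) = cintegral 0 T f + cintegral 0 T g.
Proof.
move=> [f1 f2] [g1 g2]; rewrite /cintegral; apply: complex_eqP; rewrite !cReImE /=.
  by rewrite -RintegralD//; apply: eq_Rintegral => t _; rewrite cReD.
by rewrite -RintegralD//; apply: eq_Rintegral => t _; rewrite cImD.
Qed.

Let integrableZ r (h : R -> R) : mu.-integrable I (EFin \o h) ->
  mu.-integrable I (EFin \o (fun t => r * h t)).
Proof. exact: integrableZl. Qed.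

Lemma cintegralZ a f : cintegrable f ->
  cintegral 0 T (fun t => a * f t) = a * cintegral 0 T f.
Proof.
move=> [f1 f2]; rewrite /cintegral; apply: complex_eqP; rewrite !cReImE /=.
  rewrite -!RintegralZl// -RintegralB//; try exact: integrableZ.
  by apply: eq_Rintegral => t _; rewrite cReM.
rewrite -!RintegralZl// -RintegralD//; try exact: integrableZ.
by apply: eq_Rintegral => t _; rewrite cImM.
Qed.

Lemma eq_cintegral f g : (forall t, I t -> f t = g t) ->
  cintegral 0 T f = cintegral 0 T g.
Proof.
move=> fg; rewrite /cintegral; congr (_ +i* _)%C; apply: eq_Rintegral => t;
  by rewrite inE => /fg ->.
Qed.

Lemma cintegralJ f : cintegrable f ->
  cintegral 0 T (fun t => (f t)^*) = (cintegral 0 T f)^*.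
Proof.
move=> [f1 f2]; rewrite /cintegral; apply: complex_eqP; rewrite !cReImE /=.
  by apply: eq_Rintegral => t _; rewrite cReJ.
rewrite -[RHS]mulN1r -RintegralZl//.
by apply: eq_Rintegral => t _; rewrite cImJ mulN1r.
Qed.

Lemma L2CP u : L2C T u <-> cmeasurable u /\
  mu.-integrable I (fun t => (sqmod (u t))%:E).
Proof.
split.
  move=> [u1 u2 u3]; split=> //; apply/integrableP; split.
    by apply/measurable_EFinP; exact: measurable_sqmod.
  by under eq_integral do rewrite gee0_abs ?lee_fin ?sqmod_ge0//.
move=> [[u1 u2] /integrableP[_]].
by under eq_integral do rewrite gee0_abs ?lee_fin ?sqmod_ge0//.
Qed.

Lemma L2C_cst c : L2C T (fun=> c).
Proof.
apply/L2CP; split; first exact: cmeasurable_cst.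
exact: integrable_cst_itv.
Qed.

Lemma L2C_lin a u v : L2C T u -> L2C T v -> L2C T (fun t => a * u t + v t).
Proof.
move=> /L2CP[mu_ iu] /L2CP[mv iv].
have mw : cmeasurable (fun t => a * u t + v t).
  by apply: cmeasurableD => //; apply: cmeasurableM => //; exact: cmeasurable_cst.
apply/L2CP; split=> //.
apply: (le_integrable mI (g := fun t => (2 * sqmod a * sqmod (u t) + 2 * sqmod (v t))%:E)).
- by apply/measurable_EFinP; exact: measurable_sqmod.
- move=> t _ /=; rewrite lee_fin ger0_norm ?sqmod_ge0//.
  rewrite (le_trans _ (ler_norm _))// (le_trans (sqmodD_le _ _))//.
  by rewrite sqmodM mulrA.
- under eq_fun do rewrite EFinD !EFinM.
  apply: integrableD => //; last exact: integrableZl.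
  under eq_fun do rewrite -muleA.
  by apply: integrableZl => //; exact: integrableZl.
Qed.

Lemma L2C_mul u v : L2C T u -> L2C T v -> cintegrable (fun t => u t * v t).
Proof.
move=> /L2CP[mu_ iu] /L2CP[mv iv].
apply: (le_cintegrable (g := fun t => sqmod (u t) + sqmod (v t))).
- exact: cmeasurableM.
- move=> t _; rewrite !cReImE /sqmod.
  move: (complex.Re (u t)) (complex.Im (u t)) (complex.Re (v t)) (complex.Im (v t)) => a b c d.
  rewrite ler_norml; apply/andP; split.
    have := sqr_ge0 (a + c); have := sqr_ge0 (b - d); have := sqr_ge0 a;
    have := sqr_ge0 b; have := sqr_ge0 c; have := sqr_ge0 d; nra.
  have := sqr_ge0 (a - c); have := sqr_ge0 (b + d); have := sqr_ge0 a;
    have := sqr_ge0 b; have := sqr_ge0 c; have := sqr_ge0 d; nra.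
- move=> t _; rewrite !cReImE /sqmod.
  move: (complex.Re (u t)) (complex.Im (u t)) (complex.Re (v t)) (complex.Im (v t)) => a b c d.
  rewrite ler_norml; apply/andP; split.
    have := sqr_ge0 (a + d); have := sqr_ge0 (b + c); have := sqr_ge0 a;
    have := sqr_ge0 b; have := sqr_ge0 c; have := sqr_ge0 d; nra.
  have := sqr_ge0 (a - d); have := sqr_ge0 (b - c); have := sqr_ge0 a;
    have := sqr_ge0 b; have := sqr_ge0 c; have := sqr_ge0 d; nra.
- under eq_fun do rewrite EFinD; exact: integrableD.
Qed.

Lemma L2C_conj u : L2C T u -> L2C T (fun t => (u t)^*).
Proof.
move=> /L2CP[m i]; apply/L2CP; split; first exact: cmeasurableJ.
by under eq_fun do rewrite /sqmod cReJ cImJ sqrrN.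
Qed.

Definition L2ip (u v : R -> C) : C := cintegral 0 T (fun t => u t * (v t)^*).

Lemma L2ip_sq u : L2ip u u = (\int[mu]_(t in I) sqmod (u t))%:C%C.
Proof.
rewrite /L2ip /cintegral; apply: complex_eqP; rewrite !cReImE /=.
  by apply: eq_Rintegral => t _; rewrite mulCJ.
rewrite (@eq_Rintegral _ _ _ mu _ (fun=> 0)); last by move=> t _; rewrite mulCJ.
by rewrite Rintegral_cst// mul0r.
Qed.

Lemma L2norm_ipnorm u : L2norm T u = ipnorm L2ip u.
Proof. by rewrite /ipnorm L2ip_sq. Qed.

Lemma L2_prehilbert : prehilbert (L2C T) L2ip.
Proof.
split.
- exact: L2C_cst.
- by move=> a f g Lf Lg; exact: L2C_lin.
- move=> a f g h Lf Lg Lh; have Lh' := L2C_conj Lh.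
  rewrite /L2ip -cintegralZ; last exact: L2C_mul.
  rewrite -cintegralD; [|apply: cintegrableZ|]; try exact: L2C_mul.
  by apply: eq_cintegral => t _; ring.
- move=> f g Lf Lg; have Lg' := L2C_conj Lg.
  rewrite /L2ip -cintegralJ; last exact: L2C_mul.
  by apply: eq_cintegral => t _; rewrite rmorphM /= conjCK mulrC.
- move=> f Lf; rewrite L2ip_sq ler0c Rintegral_ge0// => t _; exact: sqmod_ge0.
Qed.

Lemma L2_complete : ip_complete (L2C T) L2ip.
Proof.
move=> f Lf cf.
have phL := L2_prehilbert.
have Lsub m n : L2C T (fun x => f m x - f n x) := ph_sub phL (Lf m) (Lf n).
have sqE u : L2C T u ->
    (\int[mu]_(t in I) (sqmod (u t))%:E = (complex.Re (L2ip u u))%:E)%E.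
  move=> /L2CP[_ iu]; rewrite L2ip_sq /Rintegral /= fineK//.
  exact: integrable_fin_num.
have part (p : C -> R) : (forall n, measurable_fun I (fun t => p (f n t))) ->
    (forall z w, (p z - p w) ^+ 2 <= sqmod (z - w)) ->
    exists2 q : R -> R, measurable_fun I q &
    forall e : R, 0 < e -> exists N, forall n, (N <= n)%N ->
      (\int[mu]_(x in I) ((p (f n x) - q x) ^+ 2)%:E <= e%:E)%E.
  move=> mp ple; apply: (L2_real_complete mI finite_itv0T mp) => e e0.
  have se0 : 0 < Num.sqrt e by rewrite sqrtr_gt0.
  have [N hN] := cf _ se0; exists N => m n mN nN.
  apply: (@le_trans _ _ (\int[mu]_(x in I) (sqmod (f m x - f n x))%:E)%E).
    apply: ge0_le_integral => //.
    - by move=> x _; rewrite lee_fin sqr_ge0.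
    - by apply/measurable_EFinP/measurable_funX/measurable_funB.
    - by have /L2CP[msub _] := Lsub m n; apply/measurable_EFinP; exact: (measurable_sqmod msub).
    - by move=> x _; rewrite lee_fin ple.
  rewrite (sqE _ (Lsub m n)) lee_fin; have := hN m n mN nN.
  by rewrite (ipnorm_lt _ _ se0) sqr_sqrtr ?(ltW e0)//; move=> /ltW.
have mf n : cmeasurable (f n) by have /L2CP[] := Lf n.
have [z w|a ma ha] := part (@complex.Re R) (fun n => (mf n).1).
  by rewrite -cReN -cReD /sqmod lerDl sqr_ge0.
have [z w|b mb hb] := part (@complex.Im R) (fun n => (mf n).2).
  by rewrite -cImN -cImD /sqmod lerDr sqr_ge0.
pose g t : C := (a t +i* b t)%C.
have mfg n : cmeasurable (fun t => f n t - g t).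
  apply: cmeasurableD => //; split.
    by under eq_fun do rewrite cReN; exact: measurable_funN.
  by under eq_fun do rewrite cImN; exact: measurable_funN.
have key e : 0 < e -> exists N, forall n, (N <= n)%N ->
    (\int[mu]_(t in I) (sqmod (f n t - g t))%:E <= e%:E)%E.
  move=> e0; have e20 : 0 < e / 2 by rewrite divr_gt0.
  have [N1 h1] := ha _ e20; have [N2 h2] := hb _ e20.
  exists (maxn N1 N2) => n; rewrite geq_max => /andP[n1 n2].
  have [m1 m2] := mf n.
  under eq_integral do rewrite /sqmod cReD cImD cReN cImN EFinD.
  rewrite ge0_integralD//; last 4 first.
  - by move=> t _; rewrite lee_fin sqr_ge0.
  - by apply/measurable_EFinP/measurable_funX/measurable_funB.
  - by move=> t _; rewrite lee_fin sqr_ge0.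
  - by apply/measurable_EFinP/measurable_funX/measurable_funB.
  by rewrite [e]splitr EFinD leeD//; [exact: h1|exact: h2].
have Lfg n e : (\int[mu]_(t in I) (sqmod (f n t - g t))%:E <= e%:E)%E ->
    L2C T (fun t => f n t - g t).
  by move=> h; have [h1 h2] := mfg n; split=> //; rewrite (le_lt_trans h)// ltry.
have Lg : L2C T g.
  have [N hN] := key 1 ltr01; have := ph_sub phL (Lf N) (Lfg N _ (hN N (leqnn N))).
  by congr (L2C T _); apply/funext => t; ring.
exists g => // e e0.
have e2 : 0 < e ^+ 2 / 2 by rewrite divr_gt0// exprn_gt0.
have [N hN] := key _ e2; exists N => n nN; have := hN n nN.
rewrite (sqE _ (ph_sub phL (Lf n) Lg)) lee_fin (ipnorm_lt _ _ e0) => h.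
by apply: le_lt_trans h _; rewrite ltr_pdivrMr// ltr_pMr ?exprn_gt0//; lra.
Qed.

End ComplexIntegral.

(** * Unconditional real sums *)

Section RealSum.
Context {R : realType}.

(** Enumerating the index type turns an unconditional sum into a series, for
    which Tonelli's theorem and measurability are available. *)
Lemma esum_count (I : countType) (a : I -> \bar R) : (forall i, (0 <= a i)%E) ->
  \esum_(i in [set: I]) a i = (\sum_(0 <= n <oo) oapp a 0%E (pickle_inv n))%E.
Proof.
move=> a0; pose b n := oapp a 0%E (@pickle_inv I n).
have b0 n : (0 <= b n)%E by rewrite /b; case: pickle_inv.
rewrite nneseries_esumT// -/b.
have := @reindex_esum R I nat setT (range (@pickle I)) (@pickle I) b.
have -> : \esum_(i in [set: I]) b (pickle i) = \esum_(i in [set: I]) a i.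
  by apply: eq_esum => i _; rewrite /b pickleK_inv.
move=> <-; last first.
  split=> [i _|i j _ _|n [i _ <-]]; [by exists i|exact: (pcan_inj pickleK)|by exists i].
rewrite esum_mkcond; apply: eq_esum => n _; case: ifPn => //.
rewrite notin_setE => nr; rewrite /b.
case E : (pickle_inv n) => [i|] //=; exfalso; apply: nr; exists i => //.
by have := @pickle_invK I n; rewrite E.
Qed.

Lemma esumZ (I : countType) (c : R) (a : I -> \bar R) : 0 <= c ->
  (forall i, (0 <= a i)%E) ->
  \esum_(i in [set: I]) (c%:E * a i)%E = (c%:E * \esum_(i in [set: I]) a i)%E.
Proof.
move=> c0 a0; rewrite !esum_count//; last by move=> i; rewrite mule_ge0.
rewrite -nneseriesZl//; last by move=> n _; case: pickle_inv.
by apply: eq_eseriesr => n _; case: pickle_inv => //=; rewrite mule0.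
Qed.

Definition esumr (I : choiceType) (f : I -> R) : \bar R :=
  \esum_(i in [set: I]) (f i)%:E.

Definition rsummable (I : choiceType) (a : I -> R) := (esumr (fun i => `|a i|%R) < +oo)%E.

Section ChoiceIndex.
Context {I : choiceType}.
Implicit Types (a b f g M : I -> R).

Lemma posB_neg a i : a^\+ i - a^\- i = a i.
Proof.
by rewrite /funrpos /funrneg; case: (lerP (a i) 0); case: (lerP (- a i) 0); lra.
Qed.

Lemma posD_neg a i : a^\+ i + a^\- i = `|a i|.
Proof.
rewrite /funrpos /funrneg; case: (lerP (a i) 0) => h.
  by rewrite ler0_norm// max_l; lra.
by rewrite gtr0_norm// max_r; lra.
Qed.

Lemma esumr_ge0 f : (forall i, 0 <= f i) -> (0 <= esumr f)%E.
Proof. by move=> f0; apply: esum_ge0 => i _; rewrite lee_fin. Qed.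

Lemma le_esumr f g : (forall i, f i <= g i) -> (esumr f <= esumr g)%E.
Proof. by move=> fg; apply: le_esum => i _; rewrite lee_fin. Qed.

Lemma le_rsummable a M : (forall i, `|a i| <= M i) -> (esumr M < +oo)%E ->
  rsummable a.
Proof. by move=> aM; apply: le_lt_trans; exact: le_esumr. Qed.

Lemma rsummable_fin f : (forall i, 0 <= f i) -> rsummable f ->
  esumr f \is a fin_num.
Proof.
move=> f0; rewrite /rsummable.
have -> : (fun i => `|f i|) = f by apply/funext => i; rewrite ger0_norm.
by move=> h; rewrite ge0_fin_numE// esumr_ge0.
Qed.

Lemma rsummableD a b : rsummable a -> rsummable b -> rsummable (fun i => a i + b i).
Proof.
move=> sa sb; apply: (@le_rsummable _ (fun i => `|a i| + `|b i|)).
  by move=> i; exact: ler_normD.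
rewrite /esumr; under eq_esum do rewrite EFinD.
by rewrite esumD// ?lte_add_pinfty// => i _; rewrite lee_fin.
Qed.

Lemma rsummableN a : rsummable a -> rsummable (fun i => - a i).
Proof.
move=> sa; apply: le_rsummable sa => i; by rewrite normrN.
Qed.

(** The value of a sum may be computed from any decomposition into nonnegative
    summable families, which is how linearity is obtained. *)
Lemma rsum_diff f g : (forall i, 0 <= f i) -> (forall i, 0 <= g i) ->
  rsummable f -> rsummable g ->
  rsum (fun i => f i - g i) = fine (esumr f) - fine (esumr g).
Proof.
move=> f0 g0 sf sg; rewrite -fineB; try exact: rsummable_fin.
congr fine.
have := @esumB R I setT (EFin \o f) (EFin \o g).
by apply => //= i _; rewrite lee_fin.
Qed.

Lemma rsumE a : rsummable a ->
  [/\ rsum a = fine (esumr a^\+) - fine (esumr a^\-),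
      rsummable a^\+ & rsummable a^\-].
Proof.
move=> sa.
have sp : rsummable a^\+.
  apply: le_rsummable sa => i; rewrite ger0_norm ?funrpos_ge0//.
  by rewrite /funrpos ge_max ler_norm normr_ge0.
have sn : rsummable a^\-.
  apply: le_rsummable sa => i; rewrite ger0_norm ?funrneg_ge0//.
  by rewrite /funrneg ge_max normr_ge0 andbT -normrN ler_norm.
split=> //; rewrite -rsum_diff//; first by congr rsum; apply/funext => i; rewrite posB_neg.
Qed.

Lemma fine_esumrD f g : (forall i, 0 <= f i) -> (forall i, 0 <= g i) ->
  rsummable f -> rsummable g ->
  fine (esumr (fun i => f i + g i)) = fine (esumr f) + fine (esumr g).
Proof.
move=> f0 g0 sf sg.
rewrite -fineD; [|exact: (rsummable_fin f0)|exact: (rsummable_fin g0)].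
by congr fine; rewrite /esumr -esumD => [|i _|i _]; rewrite ?lee_fin.
Qed.

Lemma rsumD a b : rsummable a -> rsummable b ->
  rsum (fun i => a i + b i) = rsum a + rsum b.
Proof.
move=> sa sb; have [-> pa na] := rsumE sa; have [-> pb nb] := rsumE sb.
have p0 := @funrpos_ge0 I R; have n0 := @funrneg_ge0 I R.
have -> : (fun i => a i + b i) =
    (fun i => (a^\+ i + b^\+ i) - (a^\- i + b^\- i)).
  by apply/funext => i; rewrite -{1}(posB_neg a i) -{1}(posB_neg b i); ring.
rewrite rsum_diff; [|by move=> i; rewrite addr_ge0..|exact: rsummableD|exact: rsummableD].
rewrite (fine_esumrD (p0 a) (p0 b) pa pb) (fine_esumrD (n0 a) (n0 b) na nb).
by rewrite opprD addrACA.
Qed.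

Lemma rsumN a : rsum (fun i => - a i) = - rsum a.
Proof.
rewrite /rsum.
set A := esum setT (EFin \o a)^\+%E; set B := esum setT (EFin \o a)^\-%E.
have -> : esum setT (EFin \o (fun i => (- a i)%R))^\+%E = B.
  by apply: eq_esum => i _; rewrite funeposE funenegE.
have -> : esum setT (EFin \o (fun i => (- a i)%R))^\-%E = A.
  by rewrite /A; apply: eq_esum => i _; rewrite funeposE funenegE /= opprK.
have A0 : (0 <= A)%E by apply: esum_ge0 => i _; exact: funepos_ge0.
have B0 : (0 <= B)%E by apply: esum_ge0 => i _; exact: funeneg_ge0.
by move: A0 B0; case: A => [a1| |] //= _; case: B => [b1| |] //= _; rewrite /= ?oppr0 ?opprB.
Qed.

Lemma rsum_le a M : (forall i, `|a i| <= M i) -> (esumr M < +oo)%E ->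
  `|rsum a| <= fine (esumr M).
Proof.
move=> aM sM; have sa := le_rsummable aM sM; have [-> sp sn] := rsumE sa.
have M0 i : 0 <= M i by apply: le_trans (aM i).
have fp : 0 <= fine (esumr a^\+) by rewrite fine_ge0// esumr_ge0.
have fn : 0 <= fine (esumr a^\-) by rewrite fine_ge0// esumr_ge0.
suff : fine (esumr a^\+) + fine (esumr a^\-) <= fine (esumr M).
  by move=> h; rewrite ler_norml; apply/andP; split; lra.
have fM : esumr M \is a fin_num by rewrite ge0_fin_numE// esumr_ge0.
rewrite -fineD; try exact: rsummable_fin.
rewrite fine_le// ?fin_numD ?rsummable_fin//.
rewrite /esumr -esumD => [|i _|i _]; rewrite ?lee_fin//.
apply: le_esum => i _; rewrite -EFinD lee_fin.
by rewrite posD_neg.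
Qed.

Lemma rsum_reindex (J : choiceType) (e : J -> I) a : bijective e ->
  rsum (fun j => a (e j)) = rsum a.
Proof.
move=> be; have sb : set_bij setT setT e.
  have [e' eK e'K] := be.
  split=> //; first by move=> i j _ _; exact: (can_inj eK).
  by move=> i _; exists (e' i).
rewrite /rsum !(reindex_esum _ _ _ _ sb).
by congr (fine (_ - _)%E); apply: eq_esum => j _; rewrite ?funeposE ?funenegE.
Qed.

End ChoiceIndex.

Section CountIndex.
Context {I J : countType}.

Lemma esumrZ (c : R) (f : I -> R) : 0 <= c -> (forall i, 0 <= f i) ->
  esumr (fun i => c * f i) = (c%:E * esumr f)%E.
Proof. by move=> c0 f0; rewrite /esumr -esumZ// => i; rewrite lee_fin. Qed.

Lemma rsummableZ c (a : I -> R) : rsummable a -> rsummable (fun i => c * a i).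
Proof.
move=> sa; rewrite /rsummable.
have -> : (fun i => `|c * a i|) = (fun i => `|c| * `|a i|).
  by apply/funext => i; rewrite normrM.
by rewrite esumrZ// lte_mul_pinfty// lee_fin.
Qed.

Lemma rsumZ c (a : I -> R) : rsummable a -> rsum (fun i => c * a i) = c * rsum a.
Proof.
wlog c0 : c / 0 <= c => [h sa|].
  have [c0|c0] := leP 0 c; first exact: h.
  rewrite -[c]opprK mulNr -h ?oppr_ge0 ?ltW// -rsumN; congr rsum.
  by apply/funext => i; rewrite mulNr.
move=> sa; have [-> sp sn] := rsumE sa.
have -> : (fun i => c * a i) = (fun i => c * a^\+ i - c * a^\- i).
  by apply/funext => i; rewrite -mulrBr posB_neg.
rewrite rsum_diff; [|by move=> i; rewrite mulr_ge0..|exact: rsummableZ|exact: rsummableZ].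
by rewrite !esumrZ// !fineM ?mulrBr// rsummable_fin.
Qed.

Lemma esumrM (f : I -> R) (g : J -> R) : (forall i, 0 <= f i) ->
  (forall j, 0 <= g j) -> rsummable g ->
  esumr (fun p : I * J => f p.1 * g p.2) = (esumr f * esumr g)%E.
Proof.
move=> f0 g0 sg; have fg : esumr g \is a fin_num by exact: rsummable_fin.
rewrite -[esumr g]fineK// muleC -esumrZ ?fine_ge0 ?esumr_ge0//.
rewrite /esumr.
have -> : [set: I * J] = setT `*`` (fun=> setT) by apply/seteqP; split.
rewrite -(esum_esum (a := fun i j => (f i * g j)%:E)); last first.
  by move=> i j _ _; rewrite lee_fin mulr_ge0.
apply: eq_esum => i _.
have -> : \esum_(j in [set: J]) (f i * g j)%:E = esumr (fun j => f i * g j) by [].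
have -> : esumr (fun j => f i * g j) = ((f i)%:E * esumr g)%E.
  by rewrite /esumr -esumZ// => j; rewrite lee_fin.
by rewrite mulrC EFinM fineK.
Qed.

Lemma rsummableM (a : I -> R) (b : J -> R) : rsummable a -> rsummable b ->
  rsummable (fun p : I * J => a p.1 * b p.2).
Proof.
move=> sa sb; rewrite /rsummable.
have -> : (fun p : I * J => `|a p.1 * b p.2|) = (fun p => `|a p.1| * `|b p.2|).
  by apply/funext => p; rewrite normrM.
have s2 : rsummable (fun j => `|b j|) by apply: le_rsummable sb => j; rewrite normr_id.
rewrite (esumrM (f := fun i => `|a i|) (g := fun j => `|b j|))//.
by rewrite lte_mul_pinfty ?ge0_fin_numE ?esumr_ge0.
Qed.

Lemma rsumM (a : I -> R) (b : J -> R) : rsummable a -> rsummable b ->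
  rsum (fun p : I * J => a p.1 * b p.2) = rsum a * rsum b.
Proof.
move=> sa sb; have [-> pa na] := rsumE sa; have [-> pb nb] := rsumE sb.
have -> : (fun p : I * J => a p.1 * b p.2) = (fun p =>
   (a^\+ p.1 * b^\+ p.2 + a^\- p.1 * b^\- p.2) -
   (a^\+ p.1 * b^\- p.2 + a^\- p.1 * b^\+ p.2)).
  apply/funext => p; rewrite -{1}(posB_neg a p.1) -{1}(posB_neg b p.2); ring.
have p0 (K : Type) (h : K -> R) i : 0 <= h^\+ i := funrpos_ge0 h i.
have n0 (K : Type) (h : K -> R) i : 0 <= h^\- i := funrneg_ge0 h i.
have spp := rsummableM pa pb; have snn := rsummableM na nb.
have spn := rsummableM pa nb; have snp := rsummableM na pb.
have M0 (x : I -> R) (y : J -> R) : (forall i, 0 <= x i) -> (forall i, 0 <= y i) ->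
  forall p : I * J, 0 <= x p.1 * y p.2 by move=> x0 y0 p; rewrite mulr_ge0.
have pp0 := M0 _ _ (p0 _ a) (p0 _ b); have nn0 := M0 _ _ (n0 _ a) (n0 _ b).
have pn0 := M0 _ _ (p0 _ a) (n0 _ b); have np0 := M0 _ _ (n0 _ a) (p0 _ b).
rewrite rsum_diff; [|by move=> p; rewrite addr_ge0..|exact: rsummableD|exact: rsummableD].
rewrite (fine_esumrD pp0 nn0 spp snn) (fine_esumrD pn0 np0 spn snp).
rewrite (esumrM (p0 _ a) (p0 _ b) pb) (esumrM (n0 _ a) (n0 _ b) nb).
rewrite (esumrM (p0 _ a) (n0 _ b) nb) (esumrM (n0 _ a) (p0 _ b) pb).
have fpa := rsummable_fin (p0 _ a) pa; have fna := rsummable_fin (n0 _ a) na.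
have fpb := rsummable_fin (p0 _ b) pb; have fnb := rsummable_fin (n0 _ b) nb.
rewrite !fineM//.
by rewrite mulrBl !mulrBr opprB addrACA opprD [- _ - _]addrC addrA.
Qed.

Section Interchange.
Context d (T : measurableType d) (mu : {measure set T -> \bar R}).
Variables (D : set T) (xi : I -> T -> R) (M : I -> R).
Hypotheses (mD : measurable D) (fD : (mu D < +oo)%E).
Hypotheses (mxi : forall i, measurable_fun D (xi i)) (sM : (esumr M < +oo)%E).
Hypothesis xiM : forall i t, D t -> `|xi i t| <= M i.

Let nonneg_part (h : I -> T -> R) : (forall i, measurable_fun D (h i)) ->
  (forall i t, 0 <= h i t) -> (forall i t, D t -> h i t <= M i) ->
  [/\ mu.-integrable D (fun t => (fine (esumr (h ^~ t)))%:E),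
      \int[mu]_(t in D) fine (esumr (h ^~ t)) =
        fine (esumr (fun i => \int[mu]_(t in D) h i t)),
      rsummable (fun i => \int[mu]_(t in D) h i t) &
      forall i, mu.-integrable D (fun t => (h i t)%:E)].
Proof.
move=> mh h0 hM.
pose mD' := fine (mu D).
have muDE : mu D = mD'%:E by rewrite fineK// ge0_fin_numE.
have ih i : mu.-integrable D (fun t => (h i t)%:E).
  apply/integrableP; split; first exact/measurable_EFinP.
  apply: (@le_lt_trans _ _ (\int[mu]_(t in D) (M i)%:E)%E).
    apply: ge0_le_integral => //.
    - by apply/measurable_EFinP; apply: measurableT_comp.
    - by move=> t Dt; rewrite lee_fin ger0_norm// hM.
  rewrite integral_cst// muDE -EFinM ltry//.
have hE i : (\int[mu]_(t in D) (h i t)%:E = (\int[mu]_(t in D) h i t)%:E)%E.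
  by rewrite /Rintegral fineK// integrable_fin_num.
have ht t : D t -> esumr (h ^~ t) \is a fin_num.
  move=> Dt; rewrite ge0_fin_numE ?esumr_ge0//.
  by apply: le_lt_trans sM; apply: le_esumr => i; exact: hM.
pose b n t := oapp (fun i => (h i t)%:E) 0%E (@pickle_inv I n).
have bE t : esumr (h ^~ t) = (\sum_(0 <= n <oo) b n t)%E.
  by rewrite /esumr esum_count// => i; rewrite lee_fin.
have mb n : measurable_fun D (b n).
  rewrite /b; case: pickle_inv => [i|] /=; [exact/measurable_EFinP|exact: measurable_cst].
have b0 n t : (0 <= b n t)%E by rewrite /b; case: pickle_inv => //= i; rewrite lee_fin.
have swap : (\int[mu]_(t in D) esumr (h ^~ t) =
    esumr (fun i => (\int[mu]_(t in D) h i t)%R))%E.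
  under eq_integral do rewrite bE.
  rewrite integral_nneseries// /esumr esum_count; last first.
    by move=> i; rewrite lee_fin Rintegral_ge0.
  apply: eq_eseriesr => n _; rewrite /b; case: pickle_inv => [i|] /=; first exact: hE.
  by rewrite integral0.
have mE : measurable_fun D (fun t => esumr (h ^~ t)).
  rewrite (_ : (fun t => _) = fun t => (\sum_(0 <= n <oo) b n t)%E).
    exact: ge0_emeasurable_sum.
  by apply/funext => t; exact: bE.
have I0 i : 0 <= \int[mu]_(t in D) h i t by rewrite Rintegral_ge0.
have sI : rsummable (fun i => \int[mu]_(t in D) h i t).
  apply: (@le_rsummable _ _ (fun i => mD' * M i)).
    move=> i; rewrite ger0_norm// mulrC -(@Rintegral_cst _ _ _ mu D mD).
    apply: le_Rintegral => //; [exact: ih| |by move=> t; exact: hM].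
    have : mu.-integrable D (fun=> (M i)%:E); last by [].
    apply/integrableP; split; first exact: measurable_cst.
    by rewrite integral_cst// muDE -EFinM ltry.
  have [[t Dt]|D0] := pselect (exists t, D t).
    have M0 i : 0 <= M i by apply: le_trans (hM i t Dt).
    by rewrite esumrZ ?fine_ge0// lte_mul_pinfty// lee_fin fine_ge0.
  have -> : mD' = 0.
    by rewrite /mD' (_ : D = set0) ?measure0//; apply/seteqP; split=> // t Dt; apply: D0; exists t.
  rewrite (_ : (fun i => _) = fun=> 0); last by apply/funext => i; rewrite mul0r.
  by rewrite /esumr esum1.
have fI : esumr (fun i => \int[mu]_(t in D) h i t) \is a fin_num by exact: rsummable_fin.
have sw2 : (\int[mu]_(t in D) (fine (esumr (h ^~ t)))%:E =
    esumr (fun i => (\int[mu]_(t in D) h i t)%R))%E.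
  by rewrite -swap; apply: eq_integral => t; rewrite inE => Dt; rewrite fineK// ht.
split=> //; last by rewrite {1}/Rintegral sw2.
apply/integrableP; split.
  apply/measurable_EFinP.
  by apply: (@measurableT_comp _ _ _ _ _ _ fine); first exact: fine_measurable.
under eq_integral do rewrite gee0_abs ?lee_fin ?fine_ge0 ?esumr_ge0//.
by rewrite sw2 -ge0_fin_numE// esumr_ge0.
Qed.

(** Exchange of sum and integral under a summable bound that is uniform on a
    set of finite measure, by Tonelli's theorem for both signs. *)
Lemma rsum_Rintegral :
  mu.-integrable D (fun t => (rsum (xi ^~ t))%:E) /\
  \int[mu]_(t in D) rsum (xi ^~ t) = rsum (fun i => \int[mu]_(t in D) xi i t).
Proof.
pose p i t := Num.max (xi i t) 0; pose n i t := Num.max (- xi i t) 0.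
have [ip pE sp pI] : [/\ mu.-integrable D (fun t => (fine (esumr (p ^~ t)))%:E),
      \int[mu]_(t in D) fine (esumr (p ^~ t)) =
        fine (esumr (fun i => \int[mu]_(t in D) p i t)),
      rsummable (fun i => \int[mu]_(t in D) p i t) &
      forall i, mu.-integrable D (fun t => (p i t)%:E)].
  apply: nonneg_part => [i|i t|i t Dt]; first exact: (measurable_funrpos (mxi i)).
    by rewrite le_max lexx orbT.
  by rewrite ge_max (le_trans (ler_norm _) (xiM i Dt)) (le_trans _ (xiM i Dt)).
have [iN nE sn nI] : [/\ mu.-integrable D (fun t => (fine (esumr (n ^~ t)))%:E),
      \int[mu]_(t in D) fine (esumr (n ^~ t)) =
        fine (esumr (fun i => \int[mu]_(t in D) n i t)),
      rsummable (fun i => \int[mu]_(t in D) n i t) &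
      forall i, mu.-integrable D (fun t => (n i t)%:E)].
  apply: nonneg_part => [i|i t|i t Dt]; first exact: (measurable_funrneg (mxi i)).
    by rewrite le_max lexx orbT.
  rewrite ge_max (le_trans _ (xiM i Dt)) ?(le_trans _ (xiM i Dt))//.
  by rewrite -normrN ler_norm.
have E t : D t -> rsum (xi ^~ t) = fine (esumr (p ^~ t)) - fine (esumr (n ^~ t)).
  by move=> Dt; have [] := rsumE (le_rsummable (fun i => xiM i Dt) sM).
split.
  apply: (eq_integrable mD (fun t => ((fine (esumr (p ^~ t)))%:E - (fine (esumr (n ^~ t)))%:E)%E)).
    by move=> t; rewrite inE => /E ->; rewrite EFinB.
  exact: integrableB.
rewrite (@eq_Rintegral _ _ _ mu _ (fun t => fine (esumr (p ^~ t)) - fine (esumr (n ^~ t)))); last first.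
  by move=> t; rewrite inE => /E.
rewrite RintegralB// pE nE -rsum_diff//; last 2 first.
- by move=> i; apply: Rintegral_ge0 => t _; rewrite le_max lexx orbT.
- by move=> i; apply: Rintegral_ge0 => t _; rewrite le_max lexx orbT.
congr rsum; apply/funext => i; rewrite -RintegralB//; [|exact: pI|exact: nI].
by apply: eq_Rintegral => t _; rewrite -[RHS](posB_neg (fun=> xi i t) t).
Qed.

End Interchange.
End CountIndex.
End RealSum.

(** * The modulus *)

Section Modulus.
Context {R : realType}.
Local Notation C := R[i].
Implicit Types z w : C.

Definition cabs z : R := complex.Re `|z|.

Lemma cabsE z : `|z| = (cabs z)%:C%C.
Proof. by rewrite /cabs normc_def. Qed.

Lemma cabs_sqrt z : cabs z = Num.sqrt (sqmod z).
Proof. by rewrite /cabs normc_def. Qed.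

Lemma cabs_ge0 z : 0 <= cabs z.
Proof. by rewrite cabs_sqrt sqrtr_ge0. Qed.

Lemma sqr_cabs z : cabs z ^+ 2 = sqmod z.
Proof. by rewrite cabs_sqrt sqr_sqrtr// sqmod_ge0. Qed.

Lemma cabsM z w : cabs (z * w) = cabs z * cabs w.
Proof. by apply: complexI; rewrite rmorphM /= -!cabsE normrM. Qed.

Lemma cabsD z w : cabs (z + w) <= cabs z + cabs w.
Proof. by rewrite -lecR rmorphD /= -!cabsE ler_normD. Qed.

Lemma cabsN z : cabs (- z) = cabs z.
Proof. by apply: complexI; rewrite -!cabsE normrN. Qed.

Lemma cabsB z w : cabs (z - w) <= cabs z + cabs w.
Proof. by rewrite (le_trans (cabsD _ _))// cabsN. Qed.

Lemma cabsX z n : cabs (z ^+ n) = cabs z ^+ n.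
Proof. by apply: complexI; rewrite rmorphXn /= -!cabsE normrX. Qed.

Lemma cabsV z : cabs z^-1 = (cabs z)^-1.
Proof. by apply: complexI; rewrite fmorphV /= -!cabsE normfV. Qed.

Lemma cabsJ z : cabs z^* = cabs z.
Proof. by rewrite !cabs_sqrt /sqmod cReJ cImJ sqrrN. Qed.

Lemma cabsR (r : R) : cabs r%:C%C = `|r|.
Proof. by rewrite cabs_sqrt /sqmod /= expr0n addr0 sqrtr_sqr. Qed.

Lemma cabs0_eq0 z : cabs z = 0 -> z = 0.
Proof. by move=> h; apply: sqmod_eq0; rewrite -sqr_cabs h expr0n. Qed.

Lemma Re_le_cabs z : `|complex.Re z| <= cabs z.
Proof. by rewrite -sqrtr_sqr cabs_sqrt ler_wsqrtr// /sqmod lerDl sqr_ge0. Qed.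

Lemma Im_le_cabs z : `|complex.Im z| <= cabs z.
Proof. by rewrite -sqrtr_sqr cabs_sqrt ler_wsqrtr// /sqmod lerDr sqr_ge0. Qed.

Lemma cabs_le_ReIm z : cabs z <= `|complex.Re z| + `|complex.Im z|.
Proof.
rewrite {1}(complexE z); apply: le_trans (cabsD _ _) _; rewrite cabsM !cabsR.
by rewrite {1}cabs_sqrt /sqmod /= expr0n expr1n add0r sqrtr1 mul1r.
Qed.

End Modulus.

(** * Unconditional complex sums *)

Section ComplexSum.
Context {R : realType}.
Local Notation C := R[i].

Definition csummable (I : choiceType) (a : I -> C) :=
  rsummable (fun i => complex.Re (a i)) /\ rsummable (fun i => complex.Im (a i)).

Section ChoiceIndex.
Context {I : choiceType}.
Implicit Types (a b : I -> C) (M : I -> R).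

Lemma dominated_csummable a M : (forall i, cabs (a i) <= M i) ->
  (esumr M < +oo)%E -> csummable a.
Proof.
move=> aM sM; split; apply: le_rsummable sM => i; apply: le_trans (aM i).
  exact: Re_le_cabs.
exact: Im_le_cabs.
Qed.

Lemma cabs_csum a M : (forall i, cabs (a i) <= M i) ->
  (esumr M < +oo)%E -> cabs (csum a) <= 2 * fine (esumr M).
Proof.
move=> aM sM; apply: le_trans (cabs_le_ReIm _) _; rewrite mulr_natl mulr2n.
apply: lerD; apply: rsum_le => // i; apply: le_trans (aM i).
  exact: Re_le_cabs.
exact: Im_le_cabs.
Qed.

Lemma csum_reindex (J : choiceType) (e : J -> I) a : bijective e ->
  csum (fun j => a (e j)) = csum a.
Proof.
move=> be; rewrite /csum (rsum_reindex (fun i => complex.Re (a i)) be).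
by rewrite (rsum_reindex (fun i => complex.Im (a i)) be).
Qed.

Lemma csumN a : csum (fun i => - a i) = - csum a.
Proof.
apply: complex_eqP; rewrite ?cReN ?cImN /csum /= -rsumN; congr rsum;
  by apply/funext => i; rewrite ?cReN ?cImN.
Qed.

Lemma csumJ a : csum (fun i => (a i)^*) = (csum a)^*.
Proof.
apply: complex_eqP; rewrite ?cReJ ?cImJ /csum /= -?rsumN; congr rsum;
  by apply/funext => i; rewrite ?cReJ ?cImJ.
Qed.

Lemma csumD a b : csummable a -> csummable b ->
  csum (fun i => a i + b i) = csum a + csum b.
Proof.
move=> [a1 a2] [b1 b2]; apply: complex_eqP; rewrite ?cReD ?cImD /csum /= -rsumD//;
  by congr rsum; apply/funext => i; rewrite ?cReD ?cImD.
Qed.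

Lemma csummableD a b : csummable a -> csummable b -> csummable (fun i => a i + b i).
Proof.
move=> [a1 a2] [b1 b2]; split.
  by under eq_fun do rewrite cReD; exact: rsummableD.
by under eq_fun do rewrite cImD; exact: rsummableD.
Qed.

Lemma csummableN a : csummable a -> csummable (fun i => - a i).
Proof.
move=> [a1 a2]; split.
  by under eq_fun do rewrite cReN; exact: rsummableN.
by under eq_fun do rewrite cImN; exact: rsummableN.
Qed.

Lemma csummableJ a : csummable a -> csummable (fun i => (a i)^*).
Proof.
move=> [a1 a2]; split.
  by under eq_fun do rewrite cReJ.
by under eq_fun do rewrite cImJ; exact: rsummableN.
Qed.

End ChoiceIndex.

Section CountIndex.
Context {I J : countType}.

Lemma csummableZ c (a : I -> C) : csummable a -> csummable (fun i => c * a i).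
Proof.
move=> [a1 a2]; split.
  under eq_fun do rewrite cReM.
  exact: (rsummableD (rsummableZ _ a1) (rsummableN (rsummableZ _ a2))).
under eq_fun do rewrite cImM.
exact: (rsummableD (rsummableZ _ a2) (rsummableZ _ a1)).
Qed.

Lemma csumZ c (a : I -> C) : csummable a -> csum (fun i => c * a i) = c * csum a.
Proof.
move=> [a1 a2]; apply: complex_eqP; rewrite ?cReM ?cImM /csum /= -!rsumZ//.
  rewrite -rsumN -rsumD; [|exact: (rsummableZ _ a1)|exact: (rsummableN (rsummableZ _ a2))].
  by congr rsum; apply/funext => i; rewrite cReM.
rewrite -rsumD; [|exact: (rsummableZ _ a2)|exact: (rsummableZ _ a1)].
by congr rsum; apply/funext => i; rewrite cImM.
Qed.

Lemma csumM (a : I -> C) (b : J -> C) : csummable a -> csummable b ->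
  csum (fun p : I * J => a p.1 * b p.2) = csum a * csum b.
Proof.
move=> [a1 a2] [b1 b2]; apply: complex_eqP; rewrite ?cReM ?cImM /csum /= -!rsumM//.
  rewrite -rsumN -rsumD; [|exact: (rsummableM a1 b1)|exact: (rsummableN (rsummableM a2 b2))].
  by congr rsum; apply/funext => i; rewrite cReM.
rewrite -rsumD; [|exact: (rsummableM a1 b2)|exact: (rsummableM a2 b1)].
by congr rsum; apply/funext => i; rewrite cImM.
Qed.

Lemma csum_cintegral (T : R) (xi : I -> R -> C) (M : I -> R) :
  (forall i, cmeasurable T (xi i)) -> (esumr M < +oo)%E ->
  (forall i t, 0 < t < T -> cabs (xi i t) <= M i) ->
  cintegrable T (fun t => csum (xi ^~ t)) /\
  cintegral 0 T (fun t => csum (xi ^~ t)) = csum (fun i => cintegral 0 T (xi i)).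
Proof.
move=> mxi sM xiM.
have mD : measurable (`]0, T[%classic : set (measurableTypeR R)) by exact: measurable_itv.
have Dt (t : R) : (`]0, T[%classic : set R) t -> 0 < t < T by rewrite /= in_itv.
have [i1 e1] := rsum_Rintegral (mu := @lebesgue_measure R) (xi := fun i t => complex.Re (xi i t)) mD
  (finite_itv0T T) (fun i => (mxi i).1) sM
  (fun i t h => le_trans (Re_le_cabs _) (xiM i t (Dt t h))).
have [i2 e2] := rsum_Rintegral (mu := @lebesgue_measure R) (xi := fun i t => complex.Im (xi i t)) mD
  (finite_itv0T T) (fun i => (mxi i).2) sM
  (fun i t h => le_trans (Im_le_cabs _) (xiM i t (Dt t h))).
by split=> //; rewrite /cintegral /csum; congr (_ +i* _)%C.
Qed.

End CountIndex.
End ComplexSum.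

(** * The complex exponential and its first order remainder *)

Section ComplexExp.
Context {R : realType}.
Local Notation C := R[i].
Implicit Types (z w : C) (a b x : R).

Lemma Re1 : complex.Re (1 : C) = 1. Proof. by []. Qed.
Lemma Im1 : complex.Im (1 : C) = 0. Proof. by []. Qed.

Lemma Re_cexp z : complex.Re (cexp z) = expR (complex.Re z) * cos (complex.Im z).
Proof. by []. Qed.

Lemma Im_cexp z : complex.Im (cexp z) = expR (complex.Re z) * sin (complex.Im z).
Proof. by []. Qed.

Lemma cexpD z w : cexp (z + w) = cexp z * cexp w.
Proof.
apply: complex_eqP; rewrite !(cReM, cImM, Re_cexp, Im_cexp, cReD, cImD) expRD.
  by rewrite cosD; ring.
by rewrite sinD; ring.
Qed.

Lemma cexpJ z : cexp z^* = (cexp z)^*.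
Proof.
apply: complex_eqP; rewrite !(cReJ, cImJ, Re_cexp, Im_cexp).
  by rewrite cosN.
by rewrite sinN mulrN.
Qed.

Lemma cabs_cexp z : cabs (cexp z) = expR (complex.Re z).
Proof.
rewrite cabs_sqrt /sqmod Re_cexp Im_cexp !exprMn -mulrDr cos2Dsin2 mulr1 sqrtr_sqr.
by rewrite ger0_norm// expR_ge0.
Qed.

Lemma expR_sub1_le a : `|expR a - 1| <= `|a| * expR `|a|.
Proof.
have h1 := expR_ge1Dx a; have h2 := expR_ge1Dx (- a).
have e0 := expR_gt0 a.
have h3 : (1 - a) * expR a <= 1.
  by rewrite -[leRHS](expRxMexpNx_1 a) mulrC ler_wpM2l// ?expR_ge0.
have h4 : expR a <= expR `|a| by rewrite ler_expR ler_norm.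
have h5 : 1 <= expR `|a| by rewrite (le_trans _ (expR_ge1Dx _))// lerDl.
have n1 := ler_norm a; have n2 : - a <= `|a| by rewrite -normrN ler_norm.
have n0 := normr_ge0 a.
rewrite ler_norml; apply/andP; split; first by nra.
apply: (@le_trans _ _ (a * expR a)); first by nra.
by apply: (@le_trans _ _ (`|a| * expR a)); [nra|apply: ler_wpM2l].
Qed.

Lemma expR_sub1B_le a : `|expR a - 1 - a| <= a ^+ 2 * expR `|a|.
Proof.
have h1 := expR_ge1Dx a; have h2 := expR_ge1Dx (- a).
have h3 : (1 - a) * expR a <= 1.
  by rewrite -[leRHS](expRxMexpNx_1 a) mulrC ler_wpM2l// ?expR_ge0.
rewrite ger0_norm; last by lra.
apply: (@le_trans _ _ (`|a| * `|expR a - 1|)).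
  by rewrite -normrM; apply: le_trans (ler_norm _); lra.
apply: le_trans (ler_wpM2l (normr_ge0 a) (expR_sub1_le a)) _.
by rewrite mulrA -normrM -expr2 ger0_norm// sqr_ge0.
Qed.

Lemma continuous_within_itv (f : R -> R) a b : continuous f ->
  {within `[a, b], continuous f}.
Proof. by move=> cf; apply: continuous_subspaceT. Qed.

Lemma abs_sin_le x : `|sin x| <= `|x|.
Proof.
wlog x0 : x / 0 <= x => [h|].
  have [x0|x0] := leP 0 x; first exact: h.
  by rewrite -normrN -(normrN x) -sinN h// oppr_ge0 ltW.
have [c _] := MVT_segment x0 (fun y _ => is_derive_sin y)
  (@continuous_within_itv _ _ _ (@continuous_sin R)).
rewrite sin0 !subr0 => ->; rewrite normrM ler_piMl// ?normr_ge0//.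
exact: cos_max.
Qed.

Lemma abs_cos_sub1_le x : `|cos x - 1| <= x ^+ 2.
Proof.
have -> : cos x - 1 = - (2 * sin (x / 2) ^+ 2).
  by rewrite {1}(splitr x) cosD; have := cos2Dsin2 (x / 2); lra.
rewrite normrN ger0_norm; last by rewrite mulr_ge0// sqr_ge0.
have : sin (x / 2) ^+ 2 <= (x / 2) ^+ 2.
  by rewrite -real_normK ?num_real// -[leRHS]real_normK ?num_real// lerXn2r ?nnegrE// abs_sin_le.
by have := sqr_ge0 x; nra.
Qed.

Lemma abs_cos_sub1_le1 x : `|cos x - 1| <= `|x|.
Proof.
have -> : cos x - 1 = - (2 * sin (x / 2) ^+ 2).
  by rewrite {1}(splitr x) cosD; have := cos2Dsin2 (x / 2); lra.
rewrite normrN ger0_norm; last by rewrite mulr_ge0// sqr_ge0.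
have h1 := abs_sin_le (x / 2); have h2 := sin_max (x / 2).
rewrite -real_normK ?num_real//; have h0 := normr_ge0 (sin (x / 2)).
have : `|x / 2| = `|x| / 2 by rewrite normrM [X in _ * X]gtr0_norm.
move=> h; rewrite h in h1; nra.
Qed.

Lemma abs_sin_subx_le x : `|sin x - x| <= x ^+ 2.
Proof.
wlog x0 : x / 0 <= x => [h|].
  have [x0|x0] := leP 0 x; first exact: h.
  have := h (- x); rewrite sinN sqrrN oppr_ge0 (ltW x0) => /(_ isT).
  by rewrite -opprD normrN.
have dd (y : R) : is_derive y 1 (fun u : R => sin u - u) (cos y - 1).
  by apply: is_deriveB.
have cc : continuous (fun u : R => sin u - u).
  by move=> y; apply: cvgB; [exact: continuous_sin|exact: cvg_id].
have [c] := MVT_segment x0 (fun y _ => dd y) (@continuous_within_itv _ _ _ cc).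
rewrite in_itv /= => /andP[c0 cx]; rewrite sin0 !subr0 => ->.
rewrite normrM (ger0_norm x0) expr2 ler_wpM2r//.
by rewrite (le_trans (abs_cos_sub1_le1 _))// ger0_norm.
Qed.

(** Each of the four error terms of the real and imaginary parts contributes
    one multiple of [|w|^2 exp |w|]. *)
Lemma cexp_remainder w :
  cabs (cexp w - 1 - w) <= 4 * cabs w ^+ 2 * expR (cabs w).
Proof.
have [ra ia] := (Re_le_cabs w, Im_le_cabs w).
have m0 := cabs_ge0 w.
apply: le_trans (cabs_le_ReIm _) _; rewrite !(cReD, cImD, cReN, cImN).
rewrite Re_cexp Im_cexp Re1 Im1 oppr0 addr0.
set a := complex.Re w; set b := complex.Im w; set m := cabs w.
rewrite -/a -/b -/m in ra ia m0.
have em : expR a <= expR m by rewrite ler_expR (le_trans (ler_norm _)).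
have em' : expR `|a| <= expR m by rewrite ler_expR.
have m1 : 1 <= expR m by rewrite (le_trans _ (expR_ge1Dx _))// lerDl.
have a2 : a ^+ 2 <= m ^+ 2 by rewrite -real_normK ?num_real// lerXn2r ?nnegrE.
have b2 : b ^+ 2 <= m ^+ 2 by rewrite -real_normK ?num_real// lerXn2r ?nnegrE.
have h1 : `|expR a - 1 - a| <= m ^+ 2 * expR m.
  by apply: le_trans (expR_sub1B_le a) _; apply: ler_pM => //; rewrite ?sqr_ge0 ?expR_ge0.
have h2 : `|expR a * (cos b - 1)| <= m ^+ 2 * expR m.
  rewrite normrM mulrC; apply: ler_pM => //.
    by rewrite (le_trans (abs_cos_sub1_le b)).
  by rewrite ger0_norm ?expR_ge0.
have h3 : `|expR a * (sin b - b)| <= m ^+ 2 * expR m.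
  rewrite normrM mulrC; apply: ler_pM => //.
    by rewrite (le_trans (abs_sin_subx_le b)).
  by rewrite ger0_norm ?expR_ge0.
have h4 : `|b * (expR a - 1)| <= m ^+ 2 * expR m.
  rewrite normrM expr2 -mulrA; apply: ler_pM => //.
  by apply: le_trans (expR_sub1_le a) _; apply: ler_pM => //; rewrite expR_ge0.
have -> : expR a * cos b - 1 - a = (expR a - 1 - a) + expR a * (cos b - 1) by ring.
have -> : expR a * sin b - b = expR a * (sin b - b) + b * (expR a - 1) by ring.
apply: le_trans (lerD (ler_normD _ _) (ler_normD _ _)) _; lra.
Qed.

Lemma expRN_le x (n : nat) : 0 < x -> expR (- x) <= (n.+1)`!%:R / x ^+ n.+1.
Proof.
move=> x0; have h := expR_ge1Dxn n (ltW x0).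
have f0 : 0 < (n.+1)`!%:R :> R by rewrite ltr0n fact_gt0.
have X0 : 0 < x ^+ n.+1 by rewrite exprn_gt0.
rewrite expRN -[leRHS]invf_div lef_pV2 ?posrE ?expR_gt0 ?divr_gt0//.
by apply: le_trans h; rewrite lerDr.
Qed.

End ComplexExp.

(** * Decay along the lattice of even integers *)

Section LatticeWeights.
Context {R : realType}.
Local Notation C := R[i].

Definition weight (n : int) : R := (1 + (n%:~R) ^+ 2)^-1.

Lemma weight_gt0 n : 0 < weight n.
Proof. by rewrite invr_gt0 ltr_pwDl// sqr_ge0. Qed.

(** Comparison with the telescoping series of [4 / ((n + 1) (n + 2))]. *)
Lemma nat_weight_sum (e : nat -> int) :
  (forall n, weight (e n) <= (1 + n%:R ^+ 2)^-1) ->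
  (\sum_(0 <= n <oo) (weight (e n))%:E <= 4%:E)%E.
Proof.
move=> le_e; apply: lime_le.
  by apply: is_cvg_nneseries => n _ _; rewrite lee_fin ltW// weight_gt0.
apply: nearW => N; rewrite sumEFin lee_fin.
apply: (@le_trans _ _ (4 * (1 - N.+1%:R^-1))); last first.
  by rewrite ler_piMr// lerBlDr lerDl invr_ge0.
elim: N => [|N ih]; first by rewrite big_geq// invr1 subrr mulr0.
rewrite big_nat_recr//=; apply: le_trans (lerD ih (le_e N)) _.
rewrite -[leRHS]subr0 -[leLHS]subr0.
have N0 : (0:R) <= N%:R by [].
rewrite -[N.+2%:R]natr1 -[N.+1%:R]natr1.
move: (N%:R) N0 => x x0.
rewrite !subr0 -subr_ge0.
have -> : 4 * (1 - (x + 1 + 1)^-1) - (4 * (1 - (x + 1)^-1) + (1 + x ^+ 2)^-1) =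
  (3 * x ^+ 2 - 3 * x + 2) / ((x + 1) * (x + 1 + 1) * (1 + x ^+ 2)).
  by field; apply/and3P; split; apply/eqP; nra.
apply: divr_ge0; first by have := sqr_ge0 (x - 1); nra.
by rewrite !mulr_ge0//; nra.
Qed.

Lemma weight_summable : (esumr weight < +oo)%E.
Proof.
rewrite /esumr (esumID (range Posz)); last by move=> i _; rewrite lee_fin ltW// weight_gt0.
have pos_bij : set_bij [set: nat] ([set: int] `&` range Posz) Posz.
  by split=> [n _|m n _ _ []//|_ [_ [n _ <-]]]; [split=> //; exists n|exists n].
have neg_bij : set_bij [set: nat] ([set: int] `&` ~` range Posz) Negz.
  split=> [n _|m n _ _ []//|[n|n] [_ h]]; [by split=> // -[m _]| |by exists n].
  by exfalso; apply: h; exists n.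
rewrite (reindex_esum _ _ _ _ pos_bij) (reindex_esum _ _ _ _ neg_bij).
have w0 (e : nat -> int) n : (0 <= (weight (e n))%:E)%E by rewrite lee_fin ltW// weight_gt0.
rewrite -!nneseries_esumT//.
have h1 := @nat_weight_sum Posz (fun n => lexx _).
have h2 : (\sum_(0 <= n <oo) (weight (Negz n))%:E <= 4%:E)%E.
  apply: nat_weight_sum => n; rewrite /weight NegzE mulrNz sqrrN.
  rewrite lef_pV2 ?posrE ?ltr_pwDl ?sqr_ge0// lerD2l lerXn2r ?nnegrE//.
  by rewrite -[n.+1%:~R]/(n.+1%:R) ler_nat.
by apply: le_lt_trans (leeD h1 h2) _; rewrite -EFinD ltry.
Qed.

(** The real part of the square controls the modulus of the Gaussian factor:
    this is the condition under which the periodised kernel converges, uniformly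
    for small times. *)
Definition lattice_coercive (z : C) := exists2 c : R, 0 < c &
  forall n : int, c * (1 + n%:~R ^+ 2) <= complex.Re ((z + (2 * n)%:~R) ^+ 2).

Lemma int_C (n : int) : n%:~R = (n%:~R : R)%:C%C :> C.
Proof. by rewrite rmorph_int. Qed.

(** Let [d] be the smaller margin in the two inequalities that define the
    diamond.  After [m] steps beyond it on either side, the real part exceeds
    the imaginary part in modulus by [d + 2 m], so that the real part of the
    square is at least [(d + 2 m)^2]. *)
Lemma D_lattice_coercive z : D z -> lattice_coercive z.
Proof.
move=> [h1 h2]; set y := complex.Im z in h1 h2 *; set x := complex.Re z in h1 h2 *.
pose d := Num.min (x - `|y|) (2 - x - `|y|).
have d0 : 0 < d by rewrite lt_min; apply/andP; split; lra.
have y0 := normr_ge0 y.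
have [dx dx'] : d <= x - `|y| /\ d <= 2 - x - `|y|.
  by rewrite !ge_min !lexx orbT.
have d1 : d <= 1 by lra.
have y2 : y ^+ 2 = `|y| ^+ 2 by rewrite real_normK// num_real.
have dd : d ^+ 2 <= 1 by nra.
have dm m : d ^+ 2 * m ^+ 2 <= m ^+ 2 by rewrite ler_piMl// sqr_ge0.
exists (d ^+ 2 / 3); first by rewrite divr_gt0// exprn_gt0.
move=> n; rewrite int_C expr2 !cReImE -/x -/y addr0 rmorphM /=.
rewrite -!expr2 y2 -[(2%:~R : R)]/(2 : R).
case: n => n.
  have n0 : (0 : R) <= (Posz n)%:~R by [].
  move: ((Posz n)%:~R : R) n0 => m m0.
  have : (d + 2 * m) ^+ 2 <= (x + 2 * m) ^+ 2 - `|y| ^+ 2 by nra.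
  by apply: le_trans; have := dm m; have := mulr_ge0 (ltW d0) m0;
    have := sqr_ge0 m; have := sqr_ge0 d; lra.
have -> : (Negz n)%:~R = - (1 + n%:R) :> R by rewrite NegzE mulrNz -pmulrn mulrSr addrC.
have n0 : (0 : R) <= n%:R by [].
move: (n%:R : R) n0 => m m0.
have : (d + 2 * m) ^+ 2 <= (x + 2 * - (1 + m)) ^+ 2 - `|y| ^+ 2 by nra.
by apply: le_trans; have := dm m; have := mulr_ge0 (ltW d0) m0;
  have := sqr_ge0 (d * (m - 1)); have := sqr_ge0 m; have := sqr_ge0 d; lra.
Qed.

Lemma lattice_coercive_shift z (k : int) :
  lattice_coercive z -> lattice_coercive (z + (2 * k)%:~R).
Proof.
move=> [c c0 hc].
exists (c / (2 + 2 * k%:~R ^+ 2)) => [|n].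
  by rewrite divr_gt0// ltr_pwDl// mulr_ge0// sqr_ge0.
have -> : z + (2 * k)%:~R + (2 * n)%:~R = z + (2 * (k + n))%:~R :> C.
  by rewrite mulrDr intrD addrA.
apply: le_trans (hc _).
rewrite -mulrA ler_pM2l// intrD mulrC ler_pdivrMr; last first.
  by rewrite ltr_pwDl// mulr_ge0// sqr_ge0.
move: (k%:~R : R) (n%:~R : R) => a b.
have := sqr_ge0 (b + 2 * a); have := sqr_ge0 (a * (a + b)); have := sqr_ge0 (a+b).
nra.
Qed.

Lemma Dr_infty_coercive z : Dr_infty z -> lattice_coercive (z + 1).
Proof.
move=> [_ [k _ [d Dd <-] <-]].
have -> : -1 + ((2 * k)%:~R + d) + 1 = d + (2 * k)%:~R :> C by ring.
by apply: lattice_coercive_shift; exact: D_lattice_coercive.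
Qed.

End LatticeWeights.

(** * Estimates on the derivative of the heat kernel *)

Section KernelBounds.
Context {R : realType}.
Local Notation C := R[i].
Implicit Types (p h z : C) (t : R).

Definition prefactor t : R := (4 * Num.sqrt pi * t `^ (3 / 2))^-1.

(** The complex derivative of [dxK] in its space variable. *)
Definition dxxK p t : C :=
  - ((prefactor t)%:C%C * (1 - p ^+ 2 / (2 * t)%:C%C) * cexp (- (p ^+ 2 / (4 * t)%:C%C))).

Lemma dxKE p t : dxK p t = - ((prefactor t)%:C%C * p * cexp (- (p ^+ 2 / (4 * t)%:C%C))).
Proof. by rewrite /dxK mulNr /prefactor fmorphV [p / _]mulrC. Qed.

Lemma prefactor_ge0 t : 0 <= prefactor t.
Proof. by rewrite invr_ge0 !mulr_ge0 ?sqrtr_ge0 ?powR_ge0. Qed.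

Lemma sqr_powR32 t : 0 <= t -> (t `^ (3 / 2)) ^+ 2 = t ^+ 3.
Proof.
move=> t0; rewrite -powR_mulrn ?powR_ge0// -powRrM.
by have -> : 3 / 2 * 2%:R = 3%:R :> R by [field|]; rewrite powR_mulrn.
Qed.

Lemma prefactor_le t : 0 < t -> prefactor t <= 1 + t^-1 ^+ 3.
Proof.
move=> t0; set r := t `^ (3 / 2).
have r0 : 0 < r by rewrite powR_gt0.
have -> : t^-1 ^+ 3 = r^-1 ^+ 2 by rewrite !exprVn sqr_powR32// ltW.
have s1 : 1 <= Num.sqrt pi :> R.
  by rewrite -[leLHS]sqrtr1 ler_sqrt ?(le_trans _ (pi_ge2 R)) ?ler1n// pi_gt0.
apply: (@le_trans _ _ r^-1).
  by rewrite lef_pV2 ?posrE// -/r; nra.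
by have := sqr_ge0 (r^-1 - 1); have : 0 < r^-1 by [rewrite invr_gt0|]; nra.
Qed.

(** The factor [120 * 8^5] comes from [exp (- x) <= 5! / x^5] at
    [x = q / (8 t)]; the powers of [T] bound those of [t] that remain. *)
Definition gauss_const (T : R) : R :=
  120 * 8 ^+ 5 * (T ^+ 4 + T ^+ 3 + T ^+ 5 + T + 1 + T ^+ 2).

Lemma gauss_const_ge0 T : 0 <= T -> 0 <= gauss_const T.
Proof. by move=> T0; rewrite /gauss_const !mulr_ge0 ?addr_ge0 ?exprn_ge0. Qed.

(** The Gaussian factor absorbs the singularity at [t = 0] of everything that
    occurs in the expansion of the kernel.  The fifth power of [q] is the first
    one that compensates [t^-3 * t^-2], and it is also what makes the sums over
    the lattice converge. *)
Lemma prefactor_gauss_le (T t q : R) : 0 < t <= T -> 0 < q ->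
  prefactor t * (1 + (2 * t)^-1 + (4 * t ^+ 2)^-1) * expR (- (q / (8 * t)))
    <= gauss_const T / q ^+ 5.
Proof.
move=> /andP[t0 tT] q0.
have q8 : 0 < q / (8 * t) by rewrite divr_gt0// mulr_gt0.
have e0 := expRN_le 4 q8.
have pl := prefactor_le t0.
have s0 : 0 < 1 + (2 * t)^-1 + (4 * t ^+ 2)^-1.
  by rewrite !addr_gt0 ?invr_gt0 ?mulr_gt0 ?exprn_gt0.
apply: (@le_trans _ _ ((1 + t^-1 ^+ 3) * (1 + (2 * t)^-1 + (4 * t ^+ 2)^-1) *
    (5`!%:R / (q / (8 * t)) ^+ 5))).
  apply: ler_pM => //; rewrite ?expR_ge0 ?mulr_ge0 ?prefactor_ge0 ?(ltW s0)//.
  by rewrite ler_wpM2r// ltW.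
have -> : (1 + t^-1 ^+ 3) * (1 + (2 * t)^-1 + (4 * t ^+ 2)^-1) *
    (5`!%:R / (q / (8 * t)) ^+ 5) =
    120 * 8 ^+ 5 * (t ^+ 5 + t ^+ 4 / 2 + t ^+ 3 / 4 + t ^+ 2 + t / 2 + 1 / 4) / q ^+ 5.
  rewrite (_ : 5`!%:R = 120)//; field; by rewrite !gt_eqF.
rewrite ler_wpM2r ?invr_ge0 ?exprn_ge0 ?(ltW q0)// /gauss_const ler_wpM2l//.
have le_pow n : t ^+ n <= T ^+ n by rewrite lerXn2r ?nnegrE ?(ltW t0) ?(le_trans (ltW t0)).
have t_pow n : 0 <= t ^+ n by rewrite exprn_ge0// ltW.
have := le_pow 5%N; have := le_pow 4%N; have := le_pow 3%N; have := le_pow 2%N.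
have := t_pow 5%N; have := t_pow 4%N; have := t_pow 3%N; have := t_pow 2%N.
lra.
Qed.

Lemma Re_divR p (r : R) : complex.Re (- (p / r%:C%C)) = - (complex.Re p / r).
Proof. by rewrite -fmorphV /= cReN cReM cReR cImR mulr0 subr0. Qed.

Lemma expR_halve (q t : R) : 0 < t -> 0 < q ->
  expR (- (q / (4 * t))) <= expR (- (q / (8 * t))).
Proof.
move=> t0 q0; rewrite ler_expR lerN2 ler_wpM2l ?(ltW q0)// lef_pV2 ?posrE ?mulr_gt0//.
lra.
Qed.

Lemma cabs_dxK_le (T t : R) p : 0 < t <= T -> 0 < complex.Re (p ^+ 2) ->
  cabs (dxK p t) <= cabs p * (gauss_const T / complex.Re (p ^+ 2) ^+ 5).
Proof.
move=> tT q0; have /andP[t0 _] := tT.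
rewrite dxKE cabsN !cabsM cabsR ger0_norm ?prefactor_ge0// cabs_cexp Re_divR.
rewrite [prefactor t * _]mulrC -mulrA ler_wpM2l ?cabs_ge0//.
apply: le_trans (prefactor_gauss_le tT q0).
apply: ler_pM; rewrite ?expR_ge0 ?prefactor_ge0 ?expR_halve//.
rewrite ler_peMr ?prefactor_ge0// -addrA lerDl addr_ge0// invr_ge0 mulr_ge0 ?exprn_ge0// ltW//.
Qed.

Lemma cabs_dxxK_le (T t : R) p : 0 < t <= T -> 0 < complex.Re (p ^+ 2) ->
  cabs (dxxK p t) <= (2 * cabs p + 1) ^+ 3 * (gauss_const T / complex.Re (p ^+ 2) ^+ 5).
Proof.
move=> tT q0; have /andP[t0 _] := tT.
have p0 := cabs_ge0 p; set P := 2 * cabs p + 1; have P1 : 1 <= P by rewrite /P; lra.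
rewrite /dxxK cabsN !cabsM cabsR ger0_norm ?prefactor_ge0// cabs_cexp Re_divR.
apply: le_trans (ler_wpM2l _ (prefactor_gauss_le tT q0)); last by rewrite exprn_ge0//; lra.
rewrite mulrA; apply: ler_pM; rewrite ?expR_ge0 ?expR_halve//.
  by rewrite mulr_ge0 ?prefactor_ge0 ?cabs_ge0.
rewrite mulrCA ler_wpM2l ?prefactor_ge0//.
apply: le_trans (cabsB _ _) _; rewrite cabsM cabsV cabsR cabsX.
rewrite (_ : cabs 1 = 1); last by rewrite cabs_sqrt /sqmod /= expr0n expr1n addr0 sqrtr1.
rewrite gtr0_norm ?mulr_gt0//.
have i2 : 0 < (2 * t)^-1 by rewrite invr_gt0 mulr_gt0.
have i4 : 0 < (4 * t ^+ 2)^-1 by rewrite invr_gt0 mulr_gt0 ?exprn_gt0.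
have P3 : P ^+ 2 <= P ^+ 3 by rewrite [leRHS]exprS ler_peMl ?exprn_ge0//; lra.
have P2 : 1 <= P ^+ 2 by rewrite exprn_ege1.
have pP : cabs p ^+ 2 <= P ^+ 2 by rewrite lerXn2r ?nnegrE// /P; lra.
move: (P ^+ 3) (P ^+ 2) (cabs p ^+ 2) P3 P2 pP => a b c ab b1 cb.
have : c * (2 * t)^-1 <= a * (2 * t)^-1 by rewrite ler_wpM2r ?(ltW i2)//; lra.
have : 0 <= a * (4 * t ^+ 2)^-1 by rewrite mulr_ge0 ?(ltW i4)//; lra.
lra.
Qed.

(** Writing the Gaussian at [p + h] as the one at [p] times [exp w], the
    remainder is a combination of [h^2], [h w] and the remainder of [exp w], all
    of second order in [h].  The last hypothesis ensures that [exp |w|] costs at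
    most half of the exponent [q / (4 t)]. *)
Lemma cabs_dxK_remainder_le (T t : R) p h : 0 < t <= T ->
  0 < complex.Re (p ^+ 2) -> cabs h <= 1 ->
  cabs h * (2 * cabs p + 1) <= complex.Re (p ^+ 2) / 2 ->
  cabs (dxK (p + h) t - dxK p t - h * dxxK p t) <=
    cabs h ^+ 2 * ((2 * cabs p + 1) ^+ 3 * (gauss_const T / complex.Re (p ^+ 2) ^+ 5)).
Proof.
move=> tT q0 h1 hq; have /andP[t0 _] := tT.
have p0 := cabs_ge0 p; have h0 := cabs_ge0 h.
set P := 2 * cabs p + 1; have P1 : 1 <= P by rewrite /P; lra.
set q := complex.Re _ in q0 hq *.
pose w := - ((2 * p * h + h ^+ 2) / (4 * t)%:C%C).
pose r := cexp w - 1 - w.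
have tC : (t%:C%C != 0 :> C) by rewrite fmorph_eq0 gt_eqF.
have two (x : R) : (2 * x)%:C%C = 2 * x%:C%C :> C by rewrite rmorphM /= rmorph_nat.
have four (x : R) : (4 * x)%:C%C = 4 * x%:C%C :> C by rewrite rmorphM /= rmorph_nat.
have -> : dxK (p + h) t - dxK p t - h * dxxK p t =
    - ((prefactor t)%:C%C * cexp (- (p ^+ 2 / (4 * t)%:C%C)) *
       (- (p * h ^+ 2 / (4 * t)%:C%C) + h * w + (p + h) * r)).
  rewrite !dxKE /dxxK.
  have -> : - ((p + h) ^+ 2 / (4 * t)%:C%C) = - (p ^+ 2 / (4 * t)%:C%C) + w.
    by rewrite /w; ring.
  rewrite cexpD; have -> : cexp w = 1 + w + r by rewrite /r; ring.
  by rewrite /w two four; field.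
rewrite cabsN !cabsM cabsR ger0_norm ?prefactor_ge0// cabs_cexp Re_divR -/q.
have cw : cabs w <= cabs h * P / (4 * t).
  rewrite /w cabsN cabsM cabsV cabsR gtr0_norm ?mulr_gt0//.
  rewrite ler_wpM2r ?invr_ge0 ?mulr_ge0 ?(ltW t0)//.
  have -> : 2 * p * h + h ^+ 2 = h * (2 * p + h) by ring.
  rewrite cabsM ler_wpM2l//; apply: le_trans (cabsD _ _) _.
  rewrite cabsM (_ : cabs 2 = 2) /P ?lerD2l//.
  by rewrite (_ : 2 = 2%:C%C :> C) ?cabsR ?gtr0_norm// rmorph_nat.
have wq : cabs w <= q / (8 * t).
  apply: le_trans cw _.
  have -> : q / (8 * t) = (q / 2) / (4 * t) by field; rewrite gt_eqF.
  by rewrite ler_wpM2r ?invr_ge0 ?mulr_ge0 ?(ltW t0).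
have rw := cexp_remainder w.
pose E := expR (q / (8 * t)).
have E1 : 1 <= E.
  by rewrite (le_trans _ (expR_ge1Dx _))// lerDl divr_ge0 ?mulr_ge0 ?ltW.
have br : cabs (- (p * h ^+ 2 / (4 * t)%:C%C) + h * w + (p + h) * r) <=
    cabs h ^+ 2 * P ^+ 3 * (1 + (2 * t)^-1 + (4 * t ^+ 2)^-1) * E.
  set x := (4 * t)^-1; have x0 : 0 < x by rewrite invr_gt0 mulr_gt0.
  have -> : (2 * t)^-1 = 2 * x by rewrite /x; field; rewrite gt_eqF.
  have -> : (4 * t ^+ 2)^-1 = 4 * x ^+ 2 by rewrite /x; field; rewrite gt_eqF.
  rewrite -/x in cw.
  have b1 : cabs (- (p * h ^+ 2 / (4 * t)%:C%C)) <= cabs h ^+ 2 * P ^+ 3 * x * E.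
    rewrite cabsN cabsM cabsV cabsR gtr0_norm ?mulr_gt0// -/x cabsM cabsX.
    rewrite [cabs p * _]mulrC -[leLHS]mulr1; apply: ler_pM => //.
      by rewrite !mulr_ge0 ?exprn_ge0 ?(ltW x0).
    rewrite ler_wpM2r ?(ltW x0)// ler_wpM2l ?exprn_ge0//.
    by apply: (@le_trans _ _ P); [rewrite /P; lra|rewrite exprS ler_peMr ?exprn_ege1//; lra].
  have b2 : cabs (h * w) <= cabs h ^+ 2 * P ^+ 3 * x * E.
    rewrite cabsM -[leLHS]mulr1; apply: ler_pM => //.
      by rewrite mulr_ge0// cabs_ge0.
    apply: le_trans (ler_wpM2l h0 cw) _.
    have -> : cabs h * (cabs h * P * x) = cabs h ^+ 2 * P * x by ring.
    rewrite ler_wpM2r ?(ltW x0)// ler_wpM2l ?exprn_ge0//.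
    by rewrite exprS ler_peMr ?exprn_ege1//; lra.
  have b3 : cabs ((p + h) * r) <= cabs h ^+ 2 * P ^+ 3 * (4 * x ^+ 2) * E.
    rewrite cabsM; apply: (@le_trans _ _ (P * (4 * (cabs h * P * x) ^+ 2 * E))).
      apply: ler_pM; rewrite ?cabs_ge0//.
        by apply: le_trans (cabsD _ _) _; rewrite /P; lra.
      apply: le_trans rw _.
      have w2 : 4 * cabs w ^+ 2 <= 4 * (cabs h * P * x) ^+ 2.
        by rewrite ler_wpM2l// lerXn2r ?nnegrE ?cabs_ge0// (le_trans (cabs_ge0 w)).
      by apply: ler_pM => //; rewrite ?ler_expR ?expR_ge0 ?mulr_ge0 ?cabs_ge0.
    by rewrite le_eqVlt; apply/orP; left; apply/eqP; ring.
  apply: le_trans (cabsD _ _) _; apply: le_trans (lerD (cabsD _ _) (lexx _)) _.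
  have : 0 <= cabs h ^+ 2 * P ^+ 3 * E by rewrite !mulr_ge0 ?exprn_ge0 ?expR_ge0//; lra.
  nra.
have s0 : 0 < 1 + (2 * t)^-1 + (4 * t ^+ 2)^-1.
  by rewrite !addr_gt0 ?invr_gt0 ?mulr_gt0 ?exprn_gt0.
have EE : expR (- (q / (4 * t))) * E = expR (- (q / (8 * t))).
  by rewrite /E -expRD; congr expR; field; rewrite gt_eqF.
apply: le_trans (ler_wpM2l _ br) _; first by rewrite mulr_ge0 ?prefactor_ge0 ?expR_ge0.
have -> : prefactor t * expR (- (q / (4 * t))) *
   (cabs h ^+ 2 * P ^+ 3 * (1 + (2 * t)^-1 + (4 * t ^+ 2)^-1) * E) =
   cabs h ^+ 2 * P ^+ 3 * (prefactor t * (1 + (2 * t)^-1 + (4 * t ^+ 2)^-1) *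
     (expR (- (q / (4 * t))) * E)) by ring.
rewrite EE [leRHS]mulrA ler_wpM2l ?(prefactor_gauss_le tT q0)//.
by rewrite mulr_ge0 ?exprn_ge0//; lra.
Qed.

End KernelBounds.

(** * Holomorphy from quadratic remainders *)

Section QuadraticRemainder.
Context {R : realType}.
Local Notation C := R[i].

(** Unlike differentiability, an explicit quadratic remainder is inherited by
    sums and integrals under mere domination. *)
Definition quadratic_expansion (f : C -> C) (z : C) := exists l M r,
  0 < r /\ forall h : C, cabs h <= r -> cabs (f (z + h) - f z - h * l) <= M * cabs h ^+ 2.

Lemma quadratic_expansion_derivable (f : C -> C) z :
  quadratic_expansion f z -> derivable (f : C^o -> C^o) z 1.
Proof.
move=> [l [M [r [r0 fM]]]]; apply/cvg_ex; exists l; apply/cvgrPdist_le => e e0.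
have eE : e = (complex.Re e)%:C%C.
  by apply: complex_eqP => //=; move: e0; rewrite ltcE => /andP[/eqP].
have e0' : 0 < complex.Re e by move: e0; rewrite eE ltcR.
pose M' := `|M| + 1; have M'0 : 0 < M' by rewrite ltr_wpDl.
pose d := Num.min r (complex.Re e / M').
have d0 : 0 < d by rewrite lt_min r0 divr_gt0.
near=> h.
have h0 : h != 0 by near: h; exact: nbhs_dnbhs_neq.
have hd : `|h| < d%:C%C.
  by near: h; apply: dnbhs0_lt; rewrite ltcR.
rewrite cabsE ltcR in hd.
have hr : cabs h <= r by apply: ltW; apply: lt_le_trans hd _; rewrite /d ge_min lexx.
have ch : 0 < cabs h.
  by rewrite lt_def cabs_ge0 andbT; apply: contra_neq h0; exact: cabs0_eq0.
have he : cabs h <= complex.Re e / M'.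
  by apply: ltW; apply: lt_le_trans hd _; rewrite /d ge_min lexx orbT.
rewrite eE cabsE lecR /=.
rewrite -[_ *: 1]/(h * 1) mulr1 -[h^-1 *: _]/(h^-1 * _) [h + z]addrC.
have -> : l - h^-1 * (f (z + h) - f z) = - (h^-1 * (f (z + h) - f z - h * l)) by field.
rewrite cabsN cabsM cabsV ler_pdivrMl//; apply: le_trans (fM _ hr) _.
have Mle : M <= M' by rewrite /M' (le_trans (ler_norm _))// lerDl.
apply: (@le_trans _ _ (M' * cabs h ^+ 2)); first by rewrite ler_wpM2r ?sqr_ge0.
by rewrite expr2 mulrCA ler_pM2l// mulrC -ler_pdivlMr.
Unshelve. all: by end_near.
Qed.

Lemma quadratic_expansion_local (f g : C -> C) z r : 0 < r ->
  (forall h, cabs h <= r -> f (z + h) = g (z + h)) ->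
  quadratic_expansion g z -> quadratic_expansion f z.
Proof.
move=> r0 fg [l [M [r' [r'0 gM]]]]; exists l, M, (Num.min r r').
split=> [|h]; first by rewrite lt_min r0.
rewrite le_min => /andP[hr hr']; rewrite fg// (_ : f z = g z) ?gM//.
have := fg 0; rewrite addr0 cabs_sqrt sqmod0 sqrtr0; apply; exact: ltW.
Qed.

Lemma quadratic_expansionZ c (f : C -> C) z : quadratic_expansion f z ->
  quadratic_expansion (fun w => c * f w) z.
Proof.
move=> [l [M [r [r0 fM]]]]; exists (c * l), (cabs c * M), r; split=> // h hr.
have -> : c * f (z + h) - c * f z - h * (c * l) = c * (f (z + h) - f z - h * l) by ring.
by rewrite cabsM -mulrA ler_wpM2l ?cabs_ge0// fM.
Qed.

Lemma D_open z : D z -> exists2 r : R, 0 < r & forall h, cabs h <= r -> D (z + h).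
Proof.
move=> [h1 h2]; set y := complex.Im z in h1 h2; set x := complex.Re z in h1 h2.
pose r := Num.min (x - `|y|) (2 - x - `|y|) / 4.
have d0 : 0 < Num.min (x - `|y|) (2 - x - `|y|).
  by rewrite lt_min; apply/andP; split; lra.
have [dx dx'] : 4 * r <= x - `|y| /\ 4 * r <= 2 - x - `|y|.
  by rewrite /r mulrC mulfVK// !ge_min !lexx orbT.
have r0 : 0 < r by rewrite /r divr_gt0.
exists r => // h hr.
have a := le_trans (Re_le_cabs h) hr; have b := le_trans (Im_le_cabs h) hr.
have [a1 a2] := (ler_norm (complex.Re h), ler_norm (- complex.Re h)); rewrite normrN in a2.
rewrite /D /= cReD cImD -/x -/y.
have := ler_normD y (complex.Im h); split; lra.
Qed.

Lemma Dr_infty_open z : Dr_infty z ->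
  exists2 r : R, 0 < r & forall h, cabs h <= r -> Dr_infty (z + h).
Proof.
move=> [_ [k _ [d Dd <-] <-]]; have [r r0 hr] := D_open Dd; exists r => // h hh.
exists ((2 * k)%:~R + (d + h)); last by ring.
by exists k => //; exists (d + h) => //; exact: hr.
Qed.

Lemma Dr_sub_Dr_infty : @Dr R `<=` Dr_infty.
Proof.
move=> _ [d Dd <-]; exists d => //; exists 0 => //; exists d => //.
by rewrite mulr0 add0r.
Qed.

End QuadraticRemainder.

(** * The periodised kernel *)

Section Theta.
Context {R : realType}.
Local Notation C := R[i].
Implicit Types (z h : C) (t T : R).

Definition dxxtheta z t : C := csum (fun n : int => dxxK (z + (2 * n)%:~R) t).

Lemma dxK_odd z t : dxK (- z) t = - dxK z t.
Proof. by rewrite !dxKE sqrrN mulrN mulNr. Qed.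

Lemma dxtheta_periodic z (k : int) t : dxtheta (z + (2 * k)%:~R) t = dxtheta z t.
Proof.
have be : bijective (fun n : int => k + n).
  by exists (fun n => n - k) => n; ring.
rewrite /dxtheta -(csum_reindex (fun n : int => dxK (z + (2 * n)%:~R) t) be).
by congr csum; apply/funext => n; rewrite mulrDr intrD addrA.
Qed.

Lemma dxtheta_odd z t : dxtheta (- z) t = - dxtheta z t.
Proof.
have be : bijective (fun n : int => - n) by exists -%R => n; rewrite opprK.
rewrite /dxtheta -csumN -(csum_reindex (fun n : int => - dxK (z + (2 * n)%:~R) t) be).
congr csum; apply/funext => n; rewrite -dxK_odd; congr dxK.
by rewrite mulrN rmorphN; ring.
Qed.

(** The polynomial growth in [n] of the kernel estimates is at most [a^3] with
    [a = 1 + n^2], whereas the denominators grow like [a^5]. *)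
Lemma lattice_bounds T z : 0 < T -> lattice_coercive z -> exists B r : R,
  [/\ 0 <= B, 0 < r,
   forall t n, 0 < t <= T -> cabs (dxK (z + (2 * n)%:~R) t) <= B * weight n,
   forall t n, 0 < t <= T -> cabs (dxxK (z + (2 * n)%:~R) t) <= B * weight n &
   forall h, cabs h <= r -> lattice_coercive (z + h) /\
     forall t n, 0 < t <= T ->
     cabs (dxK (z + h + (2 * n)%:~R) t - dxK (z + (2 * n)%:~R) t
           - h * dxxK (z + (2 * n)%:~R) t) <= cabs h ^+ 2 * (B * weight n)].
Proof.
move=> T0 [c c0 hc].
have z0 := cabs_ge0 z.
pose L := 2 * cabs z + 5; have L0 : 0 < L by rewrite /L; lra.
pose a (n : int) : R := 1 + n%:~R ^+ 2.
have a1 n : 1 <= a n by rewrite /a lerDl sqr_ge0.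
have a0 n : 0 < a n by apply: lt_le_trans (a1 n).
have aw n : weight n = (a n)^-1 by [].
have PL n : 2 * cabs (z + (2 * n)%:~R) + 1 <= L * a n.
  have : cabs (z + (2 * n)%:~R) <= cabs z + 2 * `|n%:~R|.
    apply: le_trans (cabsD _ _) _; rewrite int_C cabsR rmorphM /= normrM.
    by rewrite -[(2%:~R : R)]/(2 : R) gtr0_norm.
  have : `|n%:~R : R| <= a n.
    rewrite /a -[n%:~R ^+ 2]real_normK ?num_real//; have := sqr_ge0 (`|n%:~R : R| - 1).
    by have := normr_ge0 (n%:~R : R); nra.
  have := a1 n; rewrite /L; nra.
have P1 n : 1 <= 2 * cabs (z + (2 * n)%:~R) + 1 by have := cabs_ge0 (z + (2 * n)%:~R); lra.
have q0 n : 0 < complex.Re ((z + (2 * n)%:~R) ^+ 2).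
  by apply: lt_le_trans (hc n); rewrite mulr_gt0// -/(a n).
have G0 := gauss_const_ge0 (ltW T0).
pose B := L ^+ 3 * (gauss_const T / c ^+ 5).
have B0 : 0 <= B.
  by apply: mulr_ge0; [rewrite exprn_ge0 ?ltW|rewrite mulr_ge0 ?invr_ge0 ?exprn_ge0 ?(ltW c0)].
have main n : (2 * cabs (z + (2 * n)%:~R) + 1) ^+ 3 *
    (gauss_const T / complex.Re ((z + (2 * n)%:~R) ^+ 2) ^+ 5) <= B * weight n.
  apply: (@le_trans _ _ ((L * a n) ^+ 3 * (gauss_const T / (c * a n) ^+ 5))).
    have La0 : 0 <= L * a n by rewrite mulr_ge0 ?ltW.
    have ca0 : 0 < c * a n by rewrite mulr_gt0.
    have Pn0 : 0 <= 2 * cabs (z + (2 * n)%:~R) + 1 by apply: le_trans (P1 n).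
    apply: ler_pM.
    - by rewrite exprn_ge0.
    - by rewrite mulr_ge0// invr_ge0 exprn_ge0// ltW.
    - by rewrite lerXn2r ?nnegrE.
    - rewrite ler_wpM2l// lef_pV2 ?posrE ?exprn_gt0//.
      by rewrite lerXn2r ?nnegrE ?(ltW ca0) ?(ltW (q0 n))//; exact: hc.
  have -> : (L * a n) ^+ 3 * (gauss_const T / (c * a n) ^+ 5) = B * ((a n)^-1 * (a n)^-1).
    by rewrite /B; field; rewrite !gt_eqF.
  rewrite aw ler_wpM2l// ler_piMr ?invr_ge0 ?(ltW (a0 n))//.
  by rewrite invf_le1.
pose r := Num.min 1 (c / (2 * L)).
have r0 : 0 < r by rewrite lt_min ltr01 divr_gt0// mulr_gt0.
have hq h n : cabs h <= r ->
    cabs h * (2 * cabs (z + (2 * n)%:~R) + 1) <= complex.Re ((z + (2 * n)%:~R) ^+ 2) / 2.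
  rewrite le_min => /andP[_ hr].
  apply: (@le_trans _ _ (c / (2 * L) * (L * a n))).
    by apply: ler_pM; rewrite ?cabs_ge0 ?(le_trans _ (P1 n)).
  have -> : c / (2 * L) * (L * a n) = c * a n / 2 by field; rewrite gt_eqF.
  by rewrite ler_wpM2r// hc.
have P3 n : 2 * cabs (z + (2 * n)%:~R) + 1 <= (2 * cabs (z + (2 * n)%:~R) + 1) ^+ 3.
  by rewrite exprS ler_peMr ?exprn_ege1//; apply: le_trans (P1 n).
exists B, r; split=> //.
- move=> t n tT; apply: le_trans (cabs_dxK_le tT (q0 n)) _; apply: le_trans (main n).
  apply: ler_wpM2r; first by rewrite mulr_ge0// invr_ge0 exprn_ge0// ltW.
  by apply: le_trans (P3 n); have := cabs_ge0 (z + (2 * n)%:~R); lra.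
- by move=> t n tT; exact: le_trans (cabs_dxxK_le tT (q0 n)) (main n).
- move=> h hr; have h1 : cabs h <= 1 by move: hr; rewrite le_min => /andP[].
  split.
    exists (c / 2); first by rewrite divr_gt0.
    move=> n; have hn := hq h n hr; rewrite addrAC.
    set p := z + _ in hn *.
    have -> : (p + h) ^+ 2 = p ^+ 2 + h * (2 * p + h) by ring.
    rewrite cReD.
    have : - complex.Re (h * (2 * p + h)) <= cabs h * (2 * cabs p + 1).
      apply: le_trans (ler_norm _) _; rewrite normrN.
      apply: le_trans (Re_le_cabs _) _; rewrite cabsM ler_wpM2l ?cabs_ge0//.
      apply: le_trans (cabsD _ _) _; rewrite cabsM (_ : cabs 2 = 2) ?lerD2l//.
      by rewrite (_ : 2 = 2%:C%C :> C) ?cabsR ?gtr0_norm// rmorph_nat.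
    by have := hc n; rewrite -/p -/(a n); lra.
  move=> t n tT; rewrite [z + h + _]addrAC.
  apply: le_trans (cabs_dxK_remainder_le tT (q0 n) h1 (hq h n hr)) _.
  by rewrite ler_wpM2l ?exprn_ge0 ?cabs_ge0.
Qed.

Lemma scaled_weight_summable (B : R) : 0 <= B ->
  (esumr (fun n => (B * weight n)%R) < +oo)%E.
Proof.
move=> B0; rewrite esumrZ// => [|n]; last exact/ltW/weight_gt0.
by rewrite lte_mul_pinfty// weight_summable.
Qed.

Lemma dxtheta_expansion T z : 0 < T -> lattice_coercive z -> exists B r : R,
  [/\ 0 < r,
   forall t, 0 < t <= T -> cabs (dxtheta z t) <= B,
   forall t, 0 < t <= T -> cabs (dxxtheta z t) <= B &
   forall h, cabs h <= r -> lattice_coercive (z + h) /\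
     forall t, 0 < t <= T ->
     cabs (dxtheta (z + h) t - dxtheta z t - h * dxxtheta z t) <= B * cabs h ^+ 2].
Proof.
move=> T0 cz; have [B [r [B0 r0 b1 b2 b3]]] := lattice_bounds T0 cz.
have sB := scaled_weight_summable B0.
exists (2 * fine (esumr (fun n => B * weight n))), r; split=> //.
- by move=> t tT; apply: cabs_csum => // n; exact: b1.
- by move=> t tT; apply: cabs_csum => // n; exact: b2.
move=> h hr; have [czh b3'] := b3 h hr; split=> // t tT.
have [B' [_ [B'0 _ b1' _ _]]] := lattice_bounds T0 czh.
have s1 : csummable (fun n : int => dxK (z + h + (2 * n)%:~R) t).
  exact: dominated_csummable (fun n => b1' t n tT) (scaled_weight_summable B'0).
have s2 : csummable (fun n : int => dxK (z + (2 * n)%:~R) t).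
  exact: dominated_csummable (fun n => b1 t n tT) sB.
have s3 : csummable (fun n : int => dxxK (z + (2 * n)%:~R) t).
  exact: dominated_csummable (fun n => b2 t n tT) sB.
have s3h := csummableZ h s3.
rewrite /dxtheta /dxxtheta -(csumZ _ s3) -!csumN.
rewrite -(csumD s1 (csummableN s2)).
rewrite -(csumD (csummableD s1 (csummableN s2)) (csummableN s3h)).
have h2 : 0 <= cabs h ^+ 2 by rewrite exprn_ge0 ?cabs_ge0.
apply: le_trans (cabs_csum (fun n => b3' t n tT) _) _.
  rewrite esumrZ// => [|n]; last by rewrite mulr_ge0// ltW// weight_gt0.
  by rewrite lte_mul_pinfty.
have w0 n : 0 <= B * weight n by rewrite mulr_ge0// ltW// weight_gt0.
rewrite esumrZ// fineM// ?ge0_fin_numE ?esumr_ge0//.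
by rewrite -mulrA [_ * fine _]mulrC.
Qed.

End Theta.

(** * Integration of functions that are flat at the origin *)

Section ComplexDerivative.
Context {R : realType}.
Local Notation C := R[i].

Definition is_cderive (f : R -> C) (x : R) (l : C) :=
  is_derive x 1 (fun t => complex.Re (f t)) (complex.Re l) /\
  is_derive x 1 (fun t => complex.Im (f t)) (complex.Im l).

Lemma is_derive_ext (f g : R -> R) (x a b : R) : (forall t, f t = g t) -> a = b ->
  is_derive x 1 f a -> is_derive x 1 g b.
Proof. by move=> /funext -> ->. Qed.

Lemma is_cderive_eq f x l l' : is_cderive f x l -> l = l' -> is_cderive f x l'.
Proof. by move=> h <-. Qed.

Lemma is_cderive_affine (a b : C) x : is_cderive (fun t => a + b * t%:C%C) x b.
Proof.
have h (c d : R) : is_derive x 1 (fun t : R => c + d * t) d.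
  apply: (is_derive_ext _ _ (is_deriveD (is_derive_cst c x 1)
    (is_deriveM (is_derive_cst d x 1) (is_derive_id x 1)))) => //.
  by rewrite /GRing.scale /=; ring.
split.
  by apply: is_derive_ext (h (complex.Re a) (complex.Re b)) => // t; rewrite !cReImE mulr0 subr0.
by apply: is_derive_ext (h (complex.Im a) (complex.Im b)) => // t; rewrite !cReImE mulr0 add0r.
Qed.

Lemma is_cderiveM f g x a b : is_cderive f x a -> is_cderive g x b ->
  is_cderive (fun t => f t * g t) x (f x * b + a * g x).
Proof.
move=> [f1 f2] [g1 g2]; split.
  have := is_deriveB (is_deriveM f1 g1) (is_deriveM f2 g2).
  apply: is_derive_ext => [t|]; first by rewrite cReM.
  by rewrite /GRing.scale /= !cReImE; ring.
have := is_deriveD (is_deriveM f1 g2) (is_deriveM f2 g1).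
apply: is_derive_ext => [t|]; first by rewrite cImM.
by rewrite /GRing.scale /= !cReImE; ring.
Qed.

Lemma is_cderive_comp f (g : R -> R) t l d : is_cderive f (g t) l ->
  is_derive t 1 g d -> is_cderive (fun s => f (g s)) t (l * d%:C%C).
Proof.
move=> [f1 f2] dg; split.
  by have := is_derive1_comp f1 dg; apply: is_derive_ext => //; rewrite !cReImE mulr0 subr0.
by have := is_derive1_comp f2 dg; apply: is_derive_ext => //; rewrite !cReImE mulr0 add0r.
Qed.

Lemma is_cderive_cexp (c : C) x :
  is_cderive (fun t => cexp (c * t%:C%C)) x (c * cexp (c * x%:C%C)).
Proof.
pose a := complex.Re c; pose b := complex.Im c.
have l d : is_derive x 1 (fun t : R => d * t) d.
  have [h _] := is_cderive_affine 0 (d%:C%C) x; apply: is_derive_ext h => // t.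
  by rewrite !cReImE mulr0 subr0 add0r.
have dE := is_derive1_comp (is_derive_expR (a * x)) (l a).
have dC := is_derive1_comp (is_derive_cos (b * x)) (l b).
have dS := is_derive1_comp (is_derive_sin (b * x)) (l b).
have ReE t : complex.Re (c * t%:C%C) = a * t by rewrite !cReImE mulr0 subr0.
have ImE t : complex.Im (c * t%:C%C) = b * t by rewrite !cReImE mulr0 add0r.
split.
  have := is_deriveM dE dC; apply: is_derive_ext => [t|].
    by rewrite Re_cexp ReE ImE.
  by rewrite /GRing.scale /= cReM Re_cexp Im_cexp ReE ImE -/a -/b; ring.
have := is_deriveM dE dS; apply: is_derive_ext => [t|].
  by rewrite Im_cexp ReE ImE.
by rewrite /GRing.scale /= cImM Re_cexp Im_cexp ReE ImE -/a -/b; ring.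
Qed.

Lemma is_derive_inv (x : R) : x != 0 -> is_derive x 1 (fun t : R => t^-1) (- x^-1 ^+ 2).
Proof.
move=> x0.
have h := @is_deriveV R (fun t : R => t) x 1 1 x0 (is_derive_id x 1).
by apply: is_derive_ext h => //; rewrite /GRing.scale /= mulr1 exprVn.
Qed.

Lemma is_derive_continuous (f : R -> R) (x l : R) : is_derive x 1 f l -> {for x, continuous f}.
Proof. by move=> h; apply: differentiable_continuous; apply/derivable1_diffP; exact: ex_derive. Qed.

Definition flat (g : R -> R) (s : R) : R := if 0 < s then g s else 0.

Lemma flat_near (g : R -> R) (s : R) : 0 < s -> \forall t \near s, g t = flat g t.
Proof.
move=> s0; have := lt_nbhsr s0; apply: filterS => t t0.
by rewrite /flat t0.
Qed.

Lemma continuous_flat (g : R -> R) (B : R) :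
  (forall s : R, 0 < s -> {for s, continuous g}) ->
  (forall s : R, 0 < s <= 1 -> `|g s| <= B * s) -> continuous (flat g).
Proof.
move=> cg gB s; rewrite /continuous_at; have [s0|s0|->] := ltgtP s 0.
- have : (cst 0 : R -> R) @ s --> (0 : R) by exact: cvg_cst.
  have -> : flat g s = 0 by rewrite /flat ltNge (ltW s0).
  apply: cvg_trans; apply: near_eq_cvg.
  by have := lt_nbhsl s0; apply: filterS => t t0; rewrite /flat ltNge (ltW t0).
- have -> : flat g s = g s by rewrite /flat s0.
  have := cg s s0; rewrite /prop_for /continuous_at.
  by apply: cvg_trans; apply: near_eq_cvg; have := flat_near g s0; apply: filterS.
- have -> : flat g 0 = 0 by rewrite /flat ltxx.
  suff h : flat g x @[x --> (0 : R)] --> (0 : R) by exact: h.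
  apply/cvgrPdist_le => e e0.
  pose b := `|B| + 1; have b0 : 0 < b by rewrite ltr_wpDl.
  have hm : 0 < Num.min 1 (e / b) by rewrite lt_min ltr01 divr_gt0.
  have := @nbhs0_lt _ R^o _ hm; apply: filterS => t td.
  rewrite sub0r normrN /flat; case: ifPn => [t0|_]; last by rewrite normr0 ltW.
  rewrite gtr0_norm// lt_min in td; have /andP[t1 te] := td.
  apply: le_trans (gB t _) _; first by rewrite t0 ltW.
  apply: (@le_trans _ _ (b * t)).
    by rewrite ler_wpM2r ?(ltW t0)// /b (le_trans (ler_norm _))// lerDl.
  by rewrite mulrC -ler_pdivlMr// ltW.
Qed.

(** The integral is improper at [t = T], where [f] and [F] have singular
    expressions; as both are bounded by a multiple of the argument near 0, their
    extensions by 0 are continuous and the fundamental theorem applies to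
    them. *)
Lemma flat_FTC (F f : R -> R) (B T : R) : 0 < T ->
  (forall s : R, 0 < s -> is_derive s 1 F (f s)) ->
  (forall s : R, 0 < s -> {for s, continuous f}) ->
  (forall s : R, 0 < s <= 1 -> `|F s| <= B * s) ->
  (forall s : R, 0 < s <= 1 -> `|f s| <= B * s) ->
  \int[@lebesgue_measure R]_(t in `]0, T[) f (T - t) = F T.
Proof.
move=> T0 dF cf FB fB.
have cF (s : R) : 0 < s -> {for s, continuous F}.
  by move=> s0; exact: is_derive_continuous (dF s s0).
have cFf := continuous_flat cF FB; have cff := continuous_flat cf fB.
pose phi t := flat f (T - t); pose psi t := - flat F (T - t).
have cT : continuous (fun t : R => T - t).
  by move=> t; apply: cvgB; [exact: cvg_cst|exact: cvg_id].
have cphi : continuous phi.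
  by move=> t; exact: (continuous_comp (cT t) (cff _)).
have cpsi : continuous psi.
  by move=> t; apply: cvgN; exact: (continuous_comp (cT t) (cFf _)).
have dpsi (t : R) : t < T -> is_derive t 1 psi (phi t).
  move=> tT; have s0 : 0 < T - t by rewrite subr_gt0.
  have d1 := near_eq_is_derive (flat_near F s0) (dF _ s0).
  have d2 : is_derive t 1 (fun t : R => T - t) (-1).
    apply: (is_derive_ext _ _ (is_deriveB (is_derive_cst T t 1) (is_derive_id t 1))) => //.
    by rewrite sub0r.
  have h2 := is_deriveN (is_derive1_comp (g := fun t : R => T - t) d1 d2).
  apply: (is_derive_ext _ _ h2) => //.
  by rewrite /phi /flat s0 mulrN1 opprK.
have mphi D : measurable_fun D (fun t => (phi t)%:E).
  by apply/measurable_EFinP; apply: measurable_funTS; exact: continuous_measurable_fun.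
have := @continuous_FTC2 R phi psi 0 T T0 (@continuous_within_itv R _ _ _ cphi).
move=> ftc.
rewrite /Rintegral.
have -> : (\int[lebesgue_measure]_(x in `]0%R, T[) (f (T - x)%R)%:E =
    \int[lebesgue_measure]_(x in `[0%R, T]) (phi x)%:E)%E.
  rewrite -integral_itv_obnd_cbnd// -integral_itv_bndo_bndc//.
  apply: eq_integral => t; rewrite inE /= in_itv /= => /andP[t0 tT].
  by rewrite /phi /flat subr_gt0 tT.
rewrite ftc.
- by rewrite -EFinB /= /psi subrr subr0 /flat ltxx T0 oppr0 opprK add0r.
- split.
  + by move=> t; rewrite in_itv /= => /andP[_ tT]; have h := dpsi t tT; exact: ex_derive.
  + by apply: cvg_at_right_filter; exact: cpsi.
  + by apply: cvg_at_left_filter; exact: cpsi.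
- move=> t; rewrite in_itv /= => /andP[_ tT].
  by rewrite derive1E; have := dpsi t tT => /@derive_val.
Qed.

End ComplexDerivative.

(** * The scalar products of heat kernel derivatives *)

Section KernelIntegral.
Context {R : realType}.
Local Notation C := R[i].

Lemma realCM (x y : R) : (x * y)%:C%C = x%:C%C * y%:C%C :> C.
Proof. exact: rmorphM. Qed.

Lemma realCX (x : R) n : (x ^+ n)%:C%C = x%:C%C ^+ n :> C.
Proof. exact: rmorphXn. Qed.

Lemma realCN (x : R) : (- x)%:C%C = - x%:C%C :> C.
Proof. exact: rmorphN. Qed.

Lemma realC_nat n : (n%:R)%:C%C = n%:R :> C.
Proof. exact: rmorph_nat. Qed.

Lemma conj_dxK (w : C) (s : R) : (dxK w s)^* =
  - ((prefactor s)%:C%C * w^* * cexp (- (w^* ^+ 2 / (4 * s)%:C%C))).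
Proof.
have cM (x y : C) : (x * y)^* = x^* * y^* by exact: rmorphM.
have cN (x : C) : (- x)^* = - x^* by exact: rmorphN.
have cV (x : C) : (x^-1)^* = (x^*)^-1 by exact: fmorphV.
by rewrite dxKE cN !cM conj_realC -cexpJ cN cM expr2 cM cV conj_realC -expr2.
Qed.

Lemma dxK_mul_conj (p w : C) (s : R) : 0 < s ->
  dxK p s * (dxK w s)^* = p * w^* / (16 * pi)%:C%C *
    (cexp (- ((p ^+ 2 + w^* ^+ 2) / 4) * (s^-1)%:C%C) * (s^-1)%:C%C ^+ 3).
Proof.
move=> s0; rewrite conj_dxK dxKE mulrNN.
have -> : - ((p ^+ 2 + w^* ^+ 2) / 4) * (s^-1)%:C%C =
    - (p ^+ 2 / (4 * s)%:C%C) - w^* ^+ 2 / (4 * s)%:C%C.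
  rewrite fmorphV rmorphM /= rmorph_nat; field.
  by rewrite fmorph_eq0 gt_eqF.
rewrite cexpD.
have pp : (prefactor s)%:C%C * (prefactor s)%:C%C = (16 * pi)%:C%C^-1 * (s^-1)%:C%C ^+ 3 :> C.
  rewrite -!rmorphM -fmorphV -rmorphXn -rmorphM; congr (_ %:C)%C.
  rewrite /prefactor -invfM -expr2 !exprMn sqr_sqrtr ?ltW ?pi_gt0// sqr_powR32 ?ltW//.
  by rewrite exprVn -invfM; congr (_^-1); ring.
move: (cexp _) (cexp _) => e2 e1.
have -> : (prefactor s)%:C%C * p * e1 * ((prefactor s)%:C%C * w^* * e2) =
   ((prefactor s)%:C%C * (prefactor s)%:C%C) * (p * w^* * (e1 * e2)) by ring.
by rewrite pp; ring.
Qed.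

(** With [x = 1 / s] the integrand is [x^3 exp (- q x / 4)] up to a constant
    factor, and [x = 1 / s] also turns [ds] into [- dx / x^2]; integrating
    [x exp (- q x / 4)] by parts gives the primitive [F]. *)
Lemma dxK_integral (T : R) (p w : C) : 0 < T ->
  0 < complex.Re (p ^+ 2) -> 0 < complex.Re (w ^+ 2) ->
  cintegral 0 T (fun t => dxK p (T - t) * (dxK w (T - t))^*) = K0 T p w.
Proof.
move=> T0 p0 w0; pose q := p ^+ 2 + w^* ^+ 2; pose c := q / 4.
have Rew : complex.Re (w^* ^+ 2) = complex.Re (w ^+ 2).
  by rewrite -rmorphXn cReJ.
have Req : 0 < complex.Re q by rewrite cReD Rew addr_gt0.
have q0 : q != 0 by apply: contraTneq Req => ->; rewrite ltxx.
pose a := complex.Re q / 4; have a0 : 0 < a by rewrite divr_gt0.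
have pi0 : pi%:C%C != 0 :> C by rewrite fmorph_eq0 gt_eqF// pi_gt0.
have mulRC (r : R) (z : C) : complex.Re (z * r%:C%C) = complex.Re z * r.
  by rewrite !cReImE mulr0 subr0.
have Rec (s : R) : complex.Re (- c * (s^-1)%:C%C) = - (a / s).
  have -> : c = q * (4^-1)%:C%C by rewrite fmorphV rmorph_nat.
  by rewrite mulRC cReN mulRC mulNr.
pose P := p * w^* / (16 * pi)%:C%C.
pose f s := P * (cexp (- c * (s^-1)%:C%C) * (s^-1)%:C%C ^+ 3).
pose Q := p * w^* / pi%:C%C.
pose F s := Q * (cexp (- c * (s^-1)%:C%C) * (1 / q ^+ 2 + 1 / (4 * q) * (s^-1)%:C%C)).
have dF s : 0 < s -> is_cderive F s (f s).
  move=> s0; have si := is_derive_inv (lt0r_neq0 s0).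
  pose G (x : R) := (Q + 0 * x%:C%C) * (cexp (- c * x%:C%C) * (1 / q ^+ 2 + 1 / (4 * q) * x%:C%C)).
  have -> : F = fun s => G (s^-1) by apply/funext => t; rewrite /G mul0r addr0.
  have := is_cderive_comp (is_cderiveM (is_cderive_affine Q 0 s^-1)
    (is_cderiveM (is_cderive_cexp (- c) s^-1)
       (is_cderive_affine (1 / q ^+ 2) (1 / (4 * q)) s^-1))) si.
  move=> /is_cderive_eq; apply.
  rewrite /f /P /Q /c realCN realCX (realCM 16 pi) (realC_nat 16).
  by move: pi%:C%C pi0 (s^-1)%:C%C (cexp _) => u u0 x e; field; rewrite u0 q0.
have cf s : 0 < s -> exists l, is_cderive f s l.
  move=> s0; have si := is_derive_inv (lt0r_neq0 s0).
  pose G (x : R) := (P + 0 * x%:C%C) * (cexp (- c * x%:C%C) *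
    ((0 + 1 * x%:C%C) * ((0 + 1 * x%:C%C) * (0 + 1 * x%:C%C)))).
  have -> : f = fun s => G (s^-1).
    by apply/funext => t; rewrite /G /f mul0r addr0 !add0r !mul1r; ring.
  eexists; exact: is_cderive_comp (is_cderiveM (is_cderive_affine P 0 s^-1)
    (is_cderiveM (is_cderive_cexp (- c) s^-1)
       (is_cderiveM (is_cderive_affine 0 1 s^-1)
       (is_cderiveM (is_cderive_affine 0 1 s^-1) (is_cderive_affine 0 1 s^-1))))) si.
have exp_le n s : 0 < s -> cabs (cexp (- c * (s^-1)%:C%C)) <= (n.+1)`!%:R / a ^+ n.+1 * s ^+ n.+1.
  move=> s0; rewrite cabs_cexp Rec.
  apply: le_trans (expRN_le n (divr_gt0 a0 s0)) _.
  by rewrite expr_div_n invf_div mulrA mulrAC.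
pose B1 := cabs P * (4`!%:R / a ^+ 4).
have b1 s : 0 < s -> cabs (f s) <= B1 * s.
  move=> s0; rewrite /f /B1 (cabsM P) (cabsM (cexp _)) -[leRHS]mulrA ler_wpM2l ?cabs_ge0//.
  rewrite cabsX cabsR ger0_norm ?invr_ge0 ?(ltW s0)//.
  apply: le_trans (ler_wpM2r _ (exp_le 3%N s s0)) _; first by rewrite exprn_ge0 ?invr_ge0 ?ltW.
  rewrite le_eqVlt; apply/orP; left; apply/eqP; field.
  by rewrite !gt_eqF.
pose B2 := cabs Q * (2`!%:R / a ^+ 2 * (cabs (1 / q ^+ 2) + cabs (1 / (4 * q)))).
have b2 s : 0 < s <= 1 -> cabs (F s) <= B2 * s.
  move=> /andP[s0 s1]; rewrite /F /B2 (cabsM Q) (cabsM (cexp _)).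
  rewrite -[leRHS]mulrA ler_wpM2l ?cabs_ge0//.
  set A := cabs (1 / q ^+ 2); set B := cabs (1 / (4 * q)).
  have A0 : 0 <= A by exact: cabs_ge0.
  have B0 : 0 <= B by exact: cabs_ge0.
  have : cabs (1 / q ^+ 2 + 1 / (4 * q) * (s^-1)%:C%C) <= A + B / s.
    apply: le_trans (cabsD _ _) _; rewrite -/A lerD2l cabsM -/B.
    by rewrite cabsR ger0_norm ?invr_ge0 ?(ltW s0).
  move=> h; apply: (@le_trans _ _ ((2`!%:R / a ^+ 2 * s ^+ 2) * (A + B / s))).
    by apply: ler_pM; rewrite ?cabs_ge0//; exact: exp_le 1%N s s0.
  have -> : 2`!%:R / a ^+ 2 * s ^+ 2 * (A + B / s) = 2`!%:R / a ^+ 2 * (A * s ^+ 2 + B * s).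
    by field; rewrite !gt_eqF.
  rewrite -[leRHS]mulrA ler_wpM2l ?mulr_ge0 ?invr_ge0 ?exprn_ge0 ?(ltW a0)//.
  by rewrite mulrDl lerD2r ler_wpM2l// expr2 ler_piMl ?(ltW s0).
pose B := `|B1| + `|B2|.
have bB s : 0 < s <= 1 -> cabs (f s) <= B * s /\ cabs (F s) <= B * s.
  move=> s01; have /andP[s0 _] := s01; split.
    apply: le_trans (b1 s s0) _; rewrite ler_wpM2r ?(ltW s0)// /B.
    by rewrite (le_trans (ler_norm _))// lerDl.
  apply: le_trans (b2 s s01) _; rewrite ler_wpM2r ?(ltW s0)// /B.
  by rewrite (le_trans (ler_norm _))// lerDr.
have -> : K0 T p w = F T.
  have TV : (T^-1)%:C%C = T%:C%C^-1 :> C by exact: fmorphV.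
  have T4 : (4 * T)%:C%C = 4 * T%:C%C :> C by rewrite realCM (realC_nat 4).
  have TC : T%:C%C != 0 :> C by rewrite fmorph_eq0 gt_eqF.
  rewrite /K0 /F -/q -/Q -mulrA; congr (_ * (cexp _ * (_ + _))).
    by rewrite /c TV T4; field.
  by rewrite TV T4; field; rewrite q0 TC.
rewrite (@eq_cintegral _ T _ (fun t => f (T - t))); last first.
  move=> t; rewrite /= in_itv /= => /andP[_ tT].
  by rewrite dxK_mul_conj ?subr_gt0.
have hRe := @flat_FTC R (fun s => complex.Re (F s)) (fun s => complex.Re (f s)) B T T0
  (fun s s0 => (dF s s0).1)
  (fun s s0 => let: ex_intro _ h := cf s s0 in is_derive_continuous h.1)
  (fun s s01 => le_trans (Re_le_cabs _) (bB s s01).2)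
  (fun s s01 => le_trans (Re_le_cabs _) (bB s s01).1).
have hIm := @flat_FTC R (fun s => complex.Im (F s)) (fun s => complex.Im (f s)) B T T0
  (fun s s0 => (dF s s0).2)
  (fun s s0 => let: ex_intro _ h := cf s s0 in is_derive_continuous h.2)
  (fun s s01 => le_trans (Im_le_cabs _) (bB s s01).2)
  (fun s s01 => le_trans (Im_le_cabs _) (bB s s01).1).
by rewrite /cintegral hRe hIm; case: (F T).
Qed.

End KernelIntegral.

(** * Measurability and boundedness in the time variable *)

Section Measurability.
Context {R : realType}.
Local Notation C := R[i].
Variable T : R.
Let I : set (measurableTypeR R) := `]0, T[%classic.

Lemma cmeasurable_real (r : R -> R) : measurable_fun I r -> cmeasurable T (fun t => (r t)%:C%C).
Proof. by move=> mr; split=> //=; exact: measurable_cst. Qed.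

Lemma cmeasurable_cexp (g : R -> C) : cmeasurable T g -> cmeasurable T (fun t => cexp (g t)).
Proof.
move=> [g1 g2].
have e : measurable_fun I (fun t => expR (complex.Re (g t))).
  by apply: (@measurableT_comp _ _ _ _ _ _ expR) => //; exact: measurable_expR.
have c : measurable_fun I (fun t => cos (complex.Im (g t))).
  apply: (@measurableT_comp _ _ _ _ _ _ cos) => //.
  by apply: continuous_measurable_fun; exact: continuous_cos.
have s : measurable_fun I (fun t => sin (complex.Im (g t))).
  apply: (@measurableT_comp _ _ _ _ _ _ sin) => //.
  by apply: continuous_measurable_fun; exact: continuous_sin.
by split; [exact: (measurable_funM e c)|exact: (measurable_funM e s)].
Qed.

Let mpow r : measurable_fun I (fun t => (T - t) `^ r).
Proof.
apply: (@measurableT_comp _ _ _ _ _ _ (@powR R ^~ r)); first exact: measurable_powR.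
by apply: measurable_funB; [exact: measurable_cst|exact: measurable_id].
Qed.

Lemma cmeasurable_prefactor : cmeasurable T (fun t => (prefactor (T - t))%:C%C).
Proof.
apply: cmeasurable_real; under eq_fun do rewrite /prefactor invfM -powRN.
by apply: measurable_funM; [exact: measurable_cst|exact: mpow].
Qed.

Lemma cmeasurable_inv4 : cmeasurable T (fun t => ((4 * (T - t))^-1)%:C%C).
Proof.
apply: cmeasurable_real.
have : measurable_fun I (fun t => 4^-1 * (T - t) `^ (-1)).
  by apply: measurable_funM; [exact: measurable_cst|exact: mpow].
apply: eq_measurable_fun => t.
rewrite inE /I /= in_itv /= => /andP[_ tT].
by rewrite invfM powR_inv1// subr_ge0 ltW.
Qed.

Let cst c := @cmeasurable_cst R T c.

Lemma cmeasurable_gauss (p : C) :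
  cmeasurable T (fun t => cexp ((- p ^+ 2) * ((4 * (T - t))^-1)%:C%C)).
Proof.
apply: cmeasurable_cexp; apply: cmeasurableM; [exact: cst|exact: cmeasurable_inv4].
Qed.

Let gaussE (p : C) t :
  cexp (- (p ^+ 2 / (4 * (T - t))%:C%C)) = cexp ((- p ^+ 2) * ((4 * (T - t))^-1)%:C%C).
Proof. by rewrite fmorphV mulNr. Qed.

Lemma cmeasurable_dxK p : cmeasurable T (fun t => dxK p (T - t)).
Proof.
have := cmeasurableM (cmeasurableM (cst (- p)) cmeasurable_prefactor) (cmeasurable_gauss p).
by congr (cmeasurable T _); apply/funext => t; rewrite dxKE gaussE; ring.
Qed.

Lemma cmeasurable_dxxK p : cmeasurable T (fun t => dxxK p (T - t)).
Proof.
have := cmeasurableM (cmeasurableM cmeasurable_prefactor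
  (cmeasurableD (cst (- 1)) (cmeasurableM (cst (2 * p ^+ 2)) cmeasurable_inv4)))
  (cmeasurable_gauss p).
congr (cmeasurable T _); apply/funext => t; rewrite /dxxK gaussE.
have -> : (2 * (T - t))%:C%C^-1 = 2 * ((4 * (T - t))^-1)%:C%C :> C.
  rewrite -fmorphV -[2 in RHS](realC_nat 2) -realCM; congr (_ %:C)%C.
  rewrite !invfM mulrA; congr (_ * _).
  by field.
by ring.
Qed.

Lemma cintegrable_measurable f : cintegrable T f -> cmeasurable T f.
Proof.
move=> [/measurable_int/measurable_EFinP h1 /measurable_int/measurable_EFinP h2].
by split.
Qed.

Lemma bounded_L2C f (B : R) : cmeasurable T f ->
  (forall t, 0 < t < T -> cabs (f t) <= B) -> L2C T f.
Proof.
move=> mf fB; apply/L2CP; split=> //.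
have mD : measurable I by exact: measurable_itv.
apply: (le_integrable mD _ _ (integrable_cst_itv T (B ^+ 2))).
  by apply/measurable_EFinP; exact: measurable_sqmod.
move=> t; rewrite /I /= in_itv /= => tT.
rewrite lee_fin !ger0_norm ?sqmod_ge0 ?sqr_ge0// -sqr_cabs.
by rewrite lerXn2r ?nnegrE ?cabs_ge0 ?fB// (le_trans (cabs_ge0 (f t)))// fB.
Qed.

Lemma cabs_cintegral_le f (g : R -> R) : cintegrable T f ->
  lebesgue_measure.-integrable I (fun t => (g t)%:E) ->
  (forall t, 0 < t < T -> cabs (f t) <= g t) ->
  cabs (cintegral 0 T f) <= 2 * \int[@lebesgue_measure R]_(t in I) g t.
Proof.
move=> [f1 f2] ig fg.
have mD : measurable I by exact: measurable_itv.
have It t : I t -> 0 < t < T by rewrite /I /= in_itv.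
apply: le_trans (cabs_le_ReIm _) _; rewrite mulr_natl mulr2n /cintegral /=.
apply: lerD.
  apply: le_trans (le_normr_Rintegral mD f1) _.
  apply: le_Rintegral => //; first exact: integrable_norm.
  by move=> t /It tT; exact: le_trans (Re_le_cabs _) (fg t tT).
apply: le_trans (le_normr_Rintegral mD f2) _.
apply: le_Rintegral => //; first exact: integrable_norm.
by move=> t /It tT; exact: le_trans (Im_le_cabs _) (fg t tT).
Qed.

End Measurability.

(** * The control-to-state operator *)

Section ReachableOperator.
Context {R : realType}.
Local Notation C := R[i].
Variable T : R.
Hypothesis T0 : 0 < T.

Lemma cmeasurable_dxtheta z : lattice_coercive z ->
  cmeasurable T (fun t => dxtheta z (T - t)).
Proof.
move=> cz; have [B [r [B0 _ b1 _ _]]] := lattice_bounds T0 cz.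
apply: cintegrable_measurable.
have [] // := csum_cintegral (T := T) (xi := fun (n : int) t => dxK (z + (2 * n)%:~R) (T - t))
  (M := fun n => B * weight n) (fun n => cmeasurable_dxK T _) (scaled_weight_summable B0).
by move=> n t /andP[t0 tT]; apply: b1; rewrite subr_gt0 tT lerBlDr lerDl ltW.
Qed.

Lemma cmeasurable_dxxtheta z : lattice_coercive z ->
  cmeasurable T (fun t => dxxtheta z (T - t)).
Proof.
move=> cz; have [B [r [B0 _ _ b2 _]]] := lattice_bounds T0 cz.
apply: cintegrable_measurable.
have [] // := csum_cintegral (T := T) (xi := fun (n : int) t => dxxK (z + (2 * n)%:~R) (T - t))
  (M := fun n => B * weight n) (fun n => cmeasurable_dxxK T _) (scaled_weight_summable B0).
by move=> n t /andP[t0 tT]; apply: b2; rewrite subr_gt0 tT lerBlDr lerDl ltW.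
Qed.

(** The representer in L^2(0, T) of the evaluation of [Lr T u] at [z]. *)
Definition feature (z : C) (t : R) : C := (dxtheta (z + 1) (T - t))^*.

Lemma L2C_dxtheta z : lattice_coercive z -> L2C T (fun t => dxtheta z (T - t)).
Proof.
move=> cz; have [B [r [_ b1 _ _]]] := dxtheta_expansion T0 cz.
apply: (bounded_L2C (cmeasurable_dxtheta cz) (B := B)) => t /andP[t0 tT].
by apply: b1; rewrite subr_gt0 tT lerBlDr lerDl ltW.
Qed.

Lemma L2C_feature z : Dr_infty z -> L2C T (feature z).
Proof. by move=> /Dr_infty_coercive cz; apply: L2C_conj; exact: L2C_dxtheta. Qed.

Lemma LrE u z : Lr T u z = L2ip T u (feature z).
Proof.
by apply: eq_cintegral => t _; rewrite /feature conjCK mulrC.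
Qed.

(** The product of the two series defining the features is expanded into a
    double series, dominated by a product of summable weights uniformly in
    time, and integrated term by term. *)
Lemma feature_gram z w : Dr_infty z -> Dr_infty w ->
  L2ip T (feature w) (feature z) = Kr T z w.
Proof.
move=> /Dr_infty_coercive cz /Dr_infty_coercive cw.
have [Bz [_ [Bz0 _ bz _ _]]] := lattice_bounds T0 cz.
have [Bw [_ [Bw0 _ bw _ _]]] := lattice_bounds T0 cw.
have sz := scaled_weight_summable Bz0; have sw := scaled_weight_summable Bw0.
have tT (t : R) : 0 < t < T -> 0 < T - t <= T.
  by move=> /andP[t0 tT]; rewrite subr_gt0 tT lerBlDr lerDl ltW.
pose xi (mn : int * int) t := (dxK (w + 1 + (2 * mn.1)%:~R) (T - t))^* *
  dxK (z + 1 + (2 * mn.2)%:~R) (T - t).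
pose M (mn : int * int) := (Bw * weight mn.1) * (Bz * weight mn.2).
have wz n : 0 <= Bz * weight n by rewrite mulr_ge0// ltW// weight_gt0.
have ww n : 0 <= Bw * weight n by rewrite mulr_ge0// ltW// weight_gt0.
have sM : (esumr M < +oo)%E.
  rewrite /M (esumrM (f := fun m => Bw * weight m) (g := fun n => Bz * weight n))//.
    by rewrite lte_mul_pinfty ?esumr_ge0// ge0_fin_numE// esumr_ge0.
  by apply: le_rsummable sz => n; rewrite ger0_norm.
have [_ swap] := csum_cintegral (T := T) (xi := xi) (M := M)
  (fun mn => cmeasurableM (cmeasurableJ (cmeasurable_dxK T _)) (cmeasurable_dxK T _)) sM
  (fun mn t h => ltac:(by rewrite /xi cabsM cabsJ; apply: ler_pM;
     rewrite ?cabs_ge0 ?bw ?bz ?tT)).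
transitivity (cintegral 0 T (fun t => csum (xi ^~ t))).
  apply: eq_cintegral => t; rewrite /= in_itv /= => /tT ht.
  have s1 : csummable (fun n : int => dxK (w + 1 + (2 * n)%:~R) (T - t)).
    exact: dominated_csummable (fun n => bw _ n ht) sw.
  have s2 : csummable (fun n : int => dxK (z + 1 + (2 * n)%:~R) (T - t)).
    exact: dominated_csummable (fun n => bz _ n ht) sz.
  by rewrite /feature conjCK /dxtheta -csumJ -(csumM (csummableJ s1) s2).
rewrite swap /Kr; congr csum; apply/funext => -[m n] /=.
have pos (v : C) k : lattice_coercive v -> 0 < complex.Re ((v + (2 * k)%:~R) ^+ 2).
  by move=> [c c0 h]; apply: lt_le_trans (h k); rewrite mulr_gt0// ltr_pwDl// sqr_ge0.
rewrite [z + _ + 1]addrAC [w + _ + 1]addrAC.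
rewrite -(dxK_integral T0 (pos _ n cz) (pos _ m cw)).
by apply: eq_cintegral => t _; rewrite /xi mulrC.
Qed.

(** The expansion of [dxtheta] is uniform in time, and [|u| <= 1 + |u|^2] is
    integrable, so the remainder can be integrated against [u]. *)
Lemma Lr_quadratic_expansion u z : L2C T u -> Dr_infty z ->
  quadratic_expansion (Lr T u) z.
Proof.
move=> Lu /Dr_infty_coercive cz.
have [B [r [r0 b1 b2 b3]]] := dxtheta_expansion T0 cz.
have tT (t : R) : 0 < t < T -> 0 < T - t <= T.
  by move=> /andP[t0 tT]; rewrite subr_gt0 tT lerBlDr lerDl ltW.
have Lx : L2C T (fun t => dxxtheta (z + 1) (T - t)).
  by apply: (bounded_L2C (cmeasurable_dxxtheta cz) (B := B)) => t /tT; exact: b2.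
have /L2CP[_ iu] := Lu.
have mI : measurable (`]0, T[%classic : set (measurableTypeR R)) by exact: measurable_itv.
pose U := \int[@lebesgue_measure R]_(t in `]0, T[) (1 + sqmod (u t)).
exists (cintegral 0 T (fun t => dxxtheta (z + 1) (T - t) * u t)), (2 * (`|B| * U)), r.
split=> // h hr; have [czh b3'] := b3 h hr.
have L1 := L2C_dxtheta czh; have L2 := L2C_dxtheta cz.
have i1 := L2C_mul L1 Lu; have i2 := L2C_mul L2 Lu; have i3 := L2C_mul Lx Lu.
rewrite /Lr -[z + h + 1]/(z + h + 1) [z + h + 1]addrAC.
rewrite -(cintegralZ _ i3) -[X in _ + X - _]mulN1r -(cintegralZ _ i2) -[X in _ + X]mulN1r.
rewrite -(cintegralZ _ (cintegrableZ h i3)).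
have i2' := cintegrableZ (-1) i2; have i3' := cintegrableZ (-1) (cintegrableZ h i3).
rewrite -(cintegralD i1 i2') -(cintegralD (cintegrableD i1 i2') i3').
have iU : (@lebesgue_measure R).-integrable `]0, T[ (fun t => (1 + sqmod (u t))%:E).
  exact: (integrableD mI (integrable_cst_itv T 1) iu).
have h2 : 0 <= cabs h ^+ 2 by rewrite exprn_ge0 ?cabs_ge0.
apply: le_trans (cabs_cintegral_le (g := fun t => (`|B| * cabs h ^+ 2) * (1 + sqmod (u t)))
  (cintegrableD (cintegrableD i1 i2') i3') _ _) _.
- exact: (integrableZl mI _ iU).
- move=> t t0T; have := b3' _ (tT t t0T).
  set d1 := dxtheta _ _; set d2 := dxtheta _ _; set d3 := dxxtheta _ _ => hb.
  have -> : d1 * u t + -1 * (d2 * u t) + -1 * (h * (d3 * u t)) = (d1 - d2 - h * d3) * u t.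
    by ring.
  rewrite cabsM; apply: ler_pM; rewrite ?cabs_ge0//.
    by apply: le_trans hb _; rewrite ler_wpM2r// ler_norm.
  rewrite -sqr_cabs; have := sqr_ge0 (cabs (u t) - 1); have := cabs_ge0 (u t); nra.
- rewrite RintegralZl// -/U.
  by rewrite le_eqVlt; apply/orP; left; apply/eqP; ring.
Qed.

Lemma Lr_periodic u z (k : int) : Lr T u (z + (2 * k)%:~R) = Lr T u z.
Proof.
by apply: eq_cintegral => t _; rewrite addrAC dxtheta_periodic.
Qed.

Lemma LrZ c u z : L2C T u -> Dr_infty z -> Lr T (fun t => c * u t) z = c * Lr T u z.
Proof.
by move=> Lu Dz; rewrite !LrE (ph_ipZl (L2_prehilbert T))//; exact: L2C_feature.
Qed.

Lemma LrN u z : L2C T u -> Dr_infty z -> Lr T u (- z) = - Lr T u z.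
Proof.
move=> Lu Dz; rewrite -[RHS]mulN1r -(LrZ (-1) Lu Dz); apply: eq_cintegral => t _.
have -> : - z + 1 = - (z + 1) + (2 * 1)%:~R :> C by ring.
by rewrite dxtheta_periodic dxtheta_odd; ring.
Qed.

Lemma heat_solution_Lr u z : heat_solution (fun=> 0) u z T = 2 * Lr T u z.
Proof.
rewrite /heat_solution (@eq_cintegral _ T _ (fun=> 0)); last by move=> t _; rewrite mulr0.
have -> : cintegral 0 T (fun=> 0) = 0 :> C.
  by rewrite /cintegral /= !Rintegral_cst// mul0r.
have -> : cintegral 0 T (fun t => dxtheta (z - 1) (T - t) * u t) = Lr T u z.
  apply: eq_cintegral => t _.
  have -> : z + 1 = (z - 1) + (2 * 1)%:~R :> C by ring.
  by rewrite dxtheta_periodic.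
by rewrite mulr0 add0r.
Qed.

Lemma Dr_infty_shift z (k : int) : Dr_infty z -> Dr_infty (z + (2 * k)%:~R : C).
Proof.
move=> [_ [m _ [d Dd <-] <-]]; exists ((2 * (m + k))%:~R + d).
  by exists (m + k) => //; exists d.
by ring.
Qed.

Lemma Dr_infty_opp z : Dr_infty z -> Dr_infty (- z : C).
Proof.
move=> [_ [m _ [d [d1 d2] <-] <-]]; exists ((2 * (- m))%:~R + (2 - d)); last by ring.
exists (- m) => //; exists (2 - d) => //.
have R2 : complex.Re (2 - d) = 2 - complex.Re d by rewrite -(realC_nat 2) cReD cReN cReR.
have I2 : complex.Im (2 - d) = - complex.Im d by rewrite -(realC_nat 2) cImD cImN cImR sub0r.
by split; rewrite R2 I2 normrN// opprB addrCA subrr addr0.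
Qed.

(** Negative translations follow from positive ones applied to the translated
    point. *)
Lemma periodic_shift (f : C -> C) : (forall z, Dr_infty z -> f (z + 2) = f z) ->
  forall z (k : int), Dr_infty z -> f (z + (2 * k)%:~R) = f z.
Proof.
move=> fp; have pos n z : Dr_infty z -> f (z + (2 * Posz n)%:~R) = f z.
  elim: n => [|n ih] Dz; first by rewrite mulr0 addr0.
  have -> : z + (2 * Posz n.+1)%:~R = z + (2 * Posz n)%:~R + 2 :> C.
    by rewrite (_ : Posz n.+1 = 1 + Posz n)//; ring.
  by rewrite fp ?ih//; exact: Dr_infty_shift.
move=> z [n|n] Dz; first exact: pos.
rewrite -(pos n.+1 (z + (2 * Negz n)%:~R)); last exact: Dr_infty_shift.
by congr f; rewrite NegzE; ring.
Qed.

End ReachableOperator.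

(** * The reachable space as a reproducing kernel Hilbert space *)

Section ReproducingSpace.
Context {R : realType}.
Local Notation C := R[i].
Variable T : R.
Hypothesis T0 : 0 < T.

Definition Dr_feature (z : @Dr R) : R -> C := feature T (set_val z).

Lemma Dr_point (z : @Dr R) : Dr_infty (set_val z : C).
Proof. by apply: Dr_sub_Dr_infty; exact: set_valP. Qed.

Lemma L2C_Dr_feature z : L2C T (Dr_feature z).
Proof. exact: (L2C_feature T0 (Dr_point z)). Qed.

Lemma Kr_Dr_gram : Kr_Dr T = fun z w : @Dr R => L2ip T (Dr_feature w) (Dr_feature z).
Proof.
apply/funext => z; apply/funext => w.
by rewrite (feature_gram T0 (Dr_point z) (Dr_point w)).
Qed.

Lemma sigL_Lr u : sigL Dr (Lr T u) = fun z : @Dr R => L2ip T u (Dr_feature z).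
Proof. by apply/funext => z; rewrite /sigL /= LrE. Qed.

Lemma sigL_LrZ c u : L2C T u ->
  sigL Dr (fun z => c * Lr T u z) = sigL Dr (Lr T (fun t => c * u t)).
Proof.
move=> Lu; apply/funext => z; rewrite /sigL /= LrZ//; exact: Dr_point.
Qed.

Lemma Kr_rkhs_exists : exists H ip, is_rkhs (Kr_Dr T) H ip.
Proof.
exists (feature_range (L2C T) (L2ip T) Dr_feature).
exists (feature_ip (L2C T) (L2ip T) Dr_feature).
rewrite Kr_Dr_gram.
exact: (feature_rkhs (L2_prehilbert T) (@L2_complete R T) L2C_Dr_feature).
Qed.

Section AnyRKHS.
Variables (H : set (@Dr R -> C)) (ip : (@Dr R -> C) -> (@Dr R -> C) -> C).
Hypothesis rkH : is_rkhs (Kr_Dr T) H ip.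

Let rkH' : is_rkhs (fun z w : @Dr R => L2ip T (Dr_feature w) (Dr_feature z)) H ip.
Proof. by rewrite -Kr_Dr_gram. Qed.

Lemma rkhs_Lr u : L2C T u -> H (sigL Dr (Lr T u)) /\
  ipnorm ip (sigL Dr (Lr T u)) <= L2norm T u.
Proof.
move=> Lu; rewrite sigL_Lr L2norm_ipnorm.
exact: (rkhs_feature (L2_prehilbert T) L2C_Dr_feature rkH' Lu).
Qed.

Lemma rkhs_Lr_preimage g : H g -> exists u, [/\ L2C T u, g = sigL Dr (Lr T u) &
  L2norm T u <= ipnorm ip g].
Proof.
move=> Hg.
have [u [Lu gE nu]] := rkhs_preimage (L2_prehilbert T) (@L2_complete R T)
  L2C_Dr_feature rkH' Hg.
by exists u; rewrite sigL_Lr L2norm_ipnorm.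
Qed.

Lemma rkhs_analytic g : H g -> analytic_on g.
Proof.
move=> /rkhs_Lr_preimage[u [Lu -> _]]; exists (Lr T u) => // z Dz.
apply: quadratic_expansion_derivable; apply: Lr_quadratic_expansion => //.
exact: Dr_sub_Dr_infty.
Qed.

Lemma reach_r_rkhs : reach_r T = [set f : C -> C |
  [/\ hol Dr_infty f,
      forall z, Dr_infty z -> f (z + 2) = f z /\ f z = - f (- z) &
      H (sigL Dr f)]].
Proof.
have shift2 (z : C) : z + 2 = z + (2 * 1)%:~R by [].
apply/seteqP; split=> f /=.
  move=> [u Lu fE0].
  have fE z : Dr_infty z -> f z = 2 * Lr T u z.
    by move=> Dz; rewrite fE0// heat_solution_Lr.
  split.
  - move=> z Dz; apply: quadratic_expansion_derivable.
    have [r r0 hr] := Dr_infty_open Dz.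
    apply: (quadratic_expansion_local (g := fun z => 2 * Lr T u z) r0 (fun h hh => fE _ (hr h hh))).
    by apply: quadratic_expansionZ; exact: Lr_quadratic_expansion.
  - move=> z Dz; split.
      by rewrite shift2 !fE ?Lr_periodic//; exact: Dr_infty_shift.
    rewrite !fE//; last exact: Dr_infty_opp.
    by rewrite (LrN T0 Lu Dz) mulrN opprK.
  - have -> : sigL Dr f = sigL Dr (fun z => 2 * Lr T u z).
      by apply/funext => z; rewrite /sigL /= fE//; exact: Dr_point.
    rewrite sigL_LrZ//; apply: (rkhs_Lr _).1.
    exact: (ph_scale (L2_prehilbert T) 2 Lu).
move=> [_ fper Hf]; have [u [Lu fE _]] := rkhs_Lr_preimage Hf.
have Lu2 : L2C T (fun t => 2^-1 * u t) := ph_scale (L2_prehilbert T) _ Lu.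
exists (fun t => 2^-1 * u t) => // z Dz.
rewrite heat_solution_Lr LrZ// mulrA mulfV ?mul1r ?pnatr_eq0//.
have [_ [k _ [d Dd <-] zE]] := Dz.
have Dd' : Dr (-1 + d : C) by exists d.
have zE' : z = -1 + d + (2 * k)%:~R by rewrite -zE; ring.
rewrite zE' Lr_periodic (periodic_shift (fun z h => (fper z h).1)); last first.
  exact: Dr_sub_Dr_infty.
by have /(congr1 (@^~ (SigSub (mem_set Dd')))) := fE.
Qed.

(** A control [u] with [g = 2 * Lr T u] amounts to [2 u] with
    [g = Lr T (2 u)], and the norm of [H] is the least norm of such a
    preimage under [Lr T]. *)
Lemma rkhs_range_norm g : H g -> (ipnorm ip g)%:E = (2%:E * range_norm T g)%E.
Proof.
move=> Hg.
have nZ c u : L2C T u -> L2norm T (fun t => c%:C%C * u t) = `|c| * L2norm T u.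
  move=> Lu; rewrite !L2norm_ipnorm /ipnorm.
  rewrite (ph_n2Z (L2_prehilbert T) _ Lu) sqrtrM ?sqmod_ge0//.
  by rewrite -cabs_sqrt cabsR.
have scale c u : L2C T u -> L2C T (fun t => c * u t).
  by move=> Lu; exact: (ph_scale (L2_prehilbert T) c Lu).
have two : 2 = (2 : R)%:C%C :> C by rewrite realC_nat.
suff -> : range_norm T g = (ipnorm ip g / 2)%:E.
  by rewrite -EFinM; congr EFin; field.
apply/eqP; rewrite eq_le; apply/andP; split.
  have [u [Lu gE nu]] := rkhs_Lr_preimage Hg.
  have two' : 2^-1 = (2^-1 : R)%:C%C :> C by rewrite two fmorphV.
  apply: ge_ereal_inf; exists (L2norm T (fun t => 2^-1 * u t))%:E.
    exists (fun t => 2^-1 * u t) => //; split; first exact: scale.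
    rewrite (sigL_LrZ _ (scale _ _ Lu)) gE; congr sigL; apply/funext => z.
    by congr (Lr T _ z); apply/funext => t; rewrite mulrA mulfV ?mul1r ?pnatr_eq0.
  by rewrite lee_fin two' nZ// gtr0_norm ?invr_gt0// mulrC ler_wpM2r.
apply: le_ereal_inf_tmp => _ [u [Lu gE] <-].
rewrite lee_fin ler_pdivrMr// mulrC gE sigL_LrZ//.
apply: le_trans (rkhs_Lr (scale 2 u Lu)).2 _.
by rewrite two nZ// gtr0_norm.
Qed.

End AnyRKHS.
End ReproducingSpace.

Unset Implicit Arguments.

Theorem theorem2 (R : realType) (T : R) (hT : 0 < T) :
  (exists (H : set (@Dr R -> R[i])) (ip : (@Dr R -> R[i]) -> (@Dr R -> R[i]) -> R[i]),
     is_rkhs (Kr_Dr T) H ip) /\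
  (forall (H : set (@Dr R -> R[i])) (ip : (@Dr R -> R[i]) -> (@Dr R -> R[i]) -> R[i]),
     is_rkhs (Kr_Dr T) H ip ->
     [/\ forall g, H g -> analytic_on g,
         reach_r T =
           [set f : R[i] -> R[i] |
              [/\ hol Dr_infty f,
                  forall z, Dr_infty z -> f (z + 2) = f z /\ f z = - f (- z) &
                  H (sigL Dr f)]] &
         forall g, H g -> (ipnorm ip g)%:E = (2%:E * range_norm T g)%E]).
Proof.
split; first exact: Kr_rkhs_exists.
move=> H ip rkH; split.
- by move=> g; exact: (rkhs_analytic hT rkH).
- exact: (reach_r_rkhs hT rkH).
- by move=> g; exact: (rkhs_range_norm hT rkH).
Qed.
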